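(* Let $c>0$ be a constant and $p(n)=cn^{-1}$. Consider the theory $T$ consisting of the following sentences about graphs: (1) for each $\ell\in\mathbb{N}$, the sentence $\mathrm{NO}_\ell$: there does not exist any subset of $\ell$ vertices with $\ell+1$ edges (among these vertices); (2) for each $m\in\mathbb{N}_0$, $k\in\mathbb{N}$ and tree-type $\sigma\in\Sigma_{m,k}$, the sentence $\mathrm{YES}_\sigma$: there exist at least $k$ tree components with $(m,k)$-type $\sigma$. Then each sentence in $T$ holds almost surely for $p(n)=cn^{-1}$. Moreover, every first order sentence $B$ that holds almost surely for the edge probability sequence $p(n)=cn^{-1}$ can be derived from $T$.
   Context: $\mathbb{N}=\{1,2,\dots\}$, $\mathbb{N}_0=\{0,1,2,\dots\}$; $x\wedge y=\min(x,y)$. $G(n,p)$ is the Erdős–Rényi random graph on $n$ vertices in which each edge is present independently with probability $p$. First order (FO) language on graphs: variables range over vertices; atomic formulas are equality $x=y$ and adjacency $x\sim y$; one uses Boolean connectives and existential and universal quantification over vertices only. A first order property is one expressible by a finite sentence of this language. A graph property $A$ holds almost surely with respect to $p(n)$ if $\lim_{n\to\infty}\mathbf{P}[G(n,p(n))\models A]=1$. A model of a set of sentences $T$ is a graph satisfying all sentences of $T$. A sentence $B$ can be derived from $T$ if it is a logical consequence of $T$, i.e. it holds in every model of $T$. Tree types. For a rooted tree $t$, $t|_m$ is the truncation consisting of the vertices at depth at most $m$ (the root has depth $0$); the principal branches of $t$ are the subtrees $t(v)$, rooted at $v$, consisting of a child $v$ of the root and all descendants of $v$. For $m\in\mathbb{N}_0$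 and $k\in\mathbb{N}$, the $(m,k)$-type of $t$ is by definition that of $t|_m$, and is defined recursively on $m$: there is only one $(0,k)$-type (that of the single root). If $\Sigma_{m-1,k}$ denotes the (finite) set of all $(m-1,k)$-types and $t$ has depth at most $m$, let $n_\sigma$ be the number of principal branches of $t$ with $(m-1,k)$-type $\sigma$; the $(m,k)$-type of $t$ is the vector $(n_\sigma\wedge k:\sigma\in\Sigma_{m-1,k})$. $\Sigma_{m,k}$ is the set of all $(m,k)$-types. A tree component of a graph (a connected component that is a tree) has $(m,k)$-type $\sigma$ if it has this type when rooted at a suitable vertex. *)

(* Defs.v *)
From HB Require Import structures.
From Stdlib Require Import Relation_Operators.
From mathcomp Require Import all_boot all_order all_algebra.
From mathcomp Require Import all_classical all_reals.
From mathcomp Require Import topology normedtype sequences.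

Set Implicit Arguments.
Unset Strict Implicit.
Unset Printing Implicit Defensive.

Import Order.TTheory GRing.Theory Num.Theory.
Import numFieldNormedType.Exports.

Local Open Scope classical_set_scope.
Local Open Scope card_scope.
Local Open Scope ring_scope.

(** * Graphs (finite or infinite) *)

Record graph : Type := Graph {
  vertex :> Type;
  adj : vertex -> vertex -> Prop;
  adj_sym : forall x y, adj x y -> adj y x;
  adj_irrefl : forall x, ~ adj x x }.

Definition property := graph -> Prop.

Definition theory := property -> Prop.

(** * First order sentences *)

(* [formula n] has its free variables in ['I_n]. A quantifier binds the
   variable [ord0] of its body; the other variables of the body are
   [lift ord0 i], with [i] a variable of the quantified formula. *)
Inductive formula : nat -> Type :=
| FEq n (i j : 'I_n) : formula n
| FAdj n (i j : 'I_n) : formula n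
| FNot n (f : formula n) : formula n
| FAnd n (f g : formula n) : formula n
| FOr n (f g : formula n) : formula n
| FImp n (f g : formula n) : formula n
| FForall n (f : formula n.+1) : formula n
| FExists n (f : formula n.+1) : formula n.

Definition sentence := formula 0.

Definition env_cons (V : Type) n (x : V) (s : 'I_n -> V) (i : 'I_n.+1) : V :=
  if unlift ord0 i is Some j then s j else x.

Definition env_nil (V : Type) (i : 'I_0) : V :=
  False_rect V (notF (ltn_ord i)).

Fixpoint holds (G : graph) n (f : formula n) : ('I_n -> G) -> Prop :=
  match f in formula n0 return ('I_n0 -> G) -> Prop with
  | FEq _ i j => fun s => s i = s j
  | FAdj _ i j => fun s => adj (s i) (s j)
  | FNot _ f => fun s => ~ holds f s
  | FAnd _ f g => fun s => holds f s /\ holds g s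
  | FOr _ f g => fun s => holds f s \/ holds g s
  | FImp _ f g => fun s => holds f s -> holds g s
  | FForall _ f => fun s => forall x : G, holds f (env_cons x s)
  | FExists _ f => fun s => exists x : G, holds f (env_cons x s)
  end.

Definition satisfies (B : sentence) : property :=
  fun G => @holds G 0 B (@env_nil G).

(** * The random graph G(n,p) *)

Definition pairs n : {set {set 'I_n}} := [set e : {set 'I_n} | #|e| == 2]%SET.

Section FiniteGraph.
Context (n : nat) (E : {set {set 'I_n}}).

Definition edge_adj (x y : 'I_n) : Prop := x != y /\ [set x; y]%SET \in E.

Lemma edge_adj_sym x y : edge_adj x y -> edge_adj y x.
Proof. by case=> xy xyE; split; [rewrite eq_sym | rewrite finset.setUC]. Qed.

Lemma edge_adj_irrefl x : ~ edge_adj x x.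
Proof. by case=> /eqP. Qed.

Definition graph_of_edges : graph := Graph edge_adj_sym edge_adj_irrefl.
End FiniteGraph.

Section RandomGraph.
Context {R : realType}.

(* This is the probability of the edge set [E] when [0 <= p <= 1]. For
   [p = c / n] this range is left only for the finitely many [n < c], which
   do not affect limits. *)
Definition edge_weight n (p : R) (E : {set {set 'I_n}}) : R :=
  \prod_(e in pairs n) (if e \in E then p else 1 - p).

Definition Gnp n (p : R) (A : property) : R :=
  \sum_(E : {set {set 'I_n}} | (E \subset pairs n) && `[< A (graph_of_edges E) >])
     edge_weight p E.

Definition almost_surely (p : nat -> R) (A : property) : Prop :=
  (Gnp n (p n) A) @[n --> \oo] --> (1 : R).
End RandomGraph.

(** * Theories *)

Definition model (T : theory) (G : graph) : Prop :=
  forall A, T A -> A G.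

Definition derivable (T : theory) (A : property) : Prop :=
  forall G, model T G -> A G.

(** * Tree components *)

Definition at_least (U : Type) (k : nat) (A : set U) : bool := `I_k #<= A.

(* [min(#|A|, k)], where [A] may be infinite. *)
Definition capped_card (U : Type) (k : nat) (A : set U) : 'I_k.+1 :=
  [arg max_(j > ord0 :> 'I_k.+1 | at_least j A) (j : nat)].

Section Trees.
Context {G : graph}.
Implicit Types (D t : set G) (r u v w x y : G).

Inductive walk D : nat -> G -> G -> Prop :=
| walk0 x : D x -> walk D 0 x x
| walkS d x y z : walk D d x y -> D z -> adj y z -> walk D d.+1 x z.

Definition component x : set G := [set y | exists d, walk setT d x y].

Definition connected_on D : Prop :=
  D !=set0 /\ forall x y, D x -> D y -> exists d, walk D d x y.

Definition acyclic_on D : Prop :=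
  ~ exists n (z : 'I_n -> G),
      [/\ (2 < n)%N, injective z, forall i, D (z i)
        & forall i, adj (z i) (z (ordS i))].

Definition is_tree D : Prop := connected_on D /\ acyclic_on D.

(* In the following a rooted tree is given by its vertex set [t] in [G]
   and its root [r]. *)

Definition depth t r v d : Prop :=
  walk t d r v /\ forall e, walk t e r v -> (d <= e)%N.

Definition truncation t r m : set G :=
  [set v | exists2 d, depth t r v d & (d <= m)%N].

Definition child t r u v : Prop :=
  adj u v /\ exists2 d, depth t r u d & depth t r v d.+1.

Definition branch t r v : set G := [set w | clos_refl_trans G (child t r) v w].
End Trees.

(** * Tree types *)

(* All vectors of multiplicities bounded by [k] are allowed, since each of
   them is the type of a tree: join copies of realizing branches to a root. *)
Fixpoint Sigma (m k : nat) : finType :=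
  if m is m'.+1 then {ffun Sigma m' k -> 'I_k.+1} : finType else unit : finType.

Fixpoint tree_type (G : graph) (m k : nat) (t : set G) (r : G) : Sigma m k :=
  match m return Sigma m k with
  | 0 => tt
  | m'.+1 =>
      let t' := truncation t r m'.+1 in
      [ffun s : Sigma m' k =>
         capped_card k [set v | child t' r r v /\
                                tree_type m' k (branch t' r v) v = s]]
  end.

Definition tree_component (G : graph) (C : set G) : Prop :=
  (exists x, C = component x) /\ is_tree C.

Definition component_has_type (G : graph) m k (s : Sigma m k) (C : set G) : Prop :=
  exists2 r, C r & tree_type m k C r = s.

(** * The theory T *)

Definition edges_in (G : graph) (A : set G) : set (set G) :=
  [set e | exists x y, [/\ A x, A y, adj x y & e = [set x; y]]].

Definition NO (l : nat) : property := fun G =>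
  ~ exists A : set G, A #= `I_l /\ at_least l.+1 (edges_in A).

(* A tree component may be deeper than [m], so [YES s] is not literally first
   order. But it follows from [YES s'], where [s'] is the [(m.+1, k)]-type of
   a tree of depth at most [m] and type [s], and for such [s'] the components
   have depth at most [m]: the theory below has the same models as its
   first order part. *)
Definition YES m k (s : Sigma m k) : property := fun G =>
  at_least k [set C : set G | tree_component C /\ component_has_type s C].

Definition theoryT : theory := fun A =>
  (exists2 l, (0 < l)%N & A = NO l) \/
  (exists m k (s : Sigma m k), (0 < k)%N /\ A = YES s).

(* Main.v *)
(* A finite vertex set is called dense if it spans at least as many edges as it
   has vertices. In a model [M] of the theory the sentences [NO l] say that no
   finite set has more edges than vertices; as the number of edges is
   supermodular, the minimal dense sets (the cycles) are pairwise disjoint and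
   non-adjacent, and around the union [S] of the short ones (the core) the graph
   branches like a forest. By composition of games, some finite induced subgraph
   [J] of [M] is game-equivalent, for a prescribed number of rounds, to a large
   ball around [S].
   Let [N] be a graph with an isolated copy of [J], no other short dense sets,
   and many tree components of each relevant type. Then [M] and [N] agree on
   sentences of rank [q]: the duplicator keeps the balls of radius [radius j]
   around the played vertices and the core equivalent; a move close to these is
   answered inside the balls, and a move far from them has a tree as its
   neighbourhood and is answered in a fresh tree component of the same type.
   Finally [J] has at most as many edges as vertices, so [G(n,c/n)] has an
   isolated copy of [J] and no other short dense set with a probability bounded
   away from 0: the events for different vertex sets are disjoint, and avoiding
   the remaining dense sets is bounded below by a Harris type inequality. Hence a
   sentence that fails in some model of the theory does not hold almost surely.
   That the theory itself holds almost surely follows from the first moment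
   method for [NO l] and from Chebyshev's inequality for [YES s]. *)
From Stdlib Require Import Relation_Operators.
From mathcomp Require Import all_boot all_order all_algebra.
From mathcomp Require Import all_classical all_reals.
From mathcomp Require Import normedtype sequences exp.
From mathcomp Require Import zify ring lra.
Require Import Defs.

Set Implicit Arguments.
Unset Strict Implicit.
Unset Printing Implicit Defensive.

Import Order.TTheory GRing.Theory Num.Theory.
Import numFieldNormedType.Exports.

Local Open Scope classical_set_scope.
Local Open Scope card_scope.
Local Open Scope nat_scope.

(** * Ehrenfeucht-Fraisse games *)

(** The theory is not complete, since it leaves open which short cycles occur; so a model [M] cannot
    be compared with a typical random graph, only with graphs that appear with probability bounded
    below. This suffices, because a limit equal to 1 excludes failure with such a probability. The
    obstacle is that [M] may have infinitely many short cycles and vertices of infinite degree near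
    them. A template with [h] vertices and at most [h] edges has about n^h positions, each of
    probability at least a constant times p^h, so the expected number of copies stays above a
    constant; with more edges than vertices it would tend to 0. If [M] has no short cycles, [J] is
    empty and only the avoidance bound remains. Different positions exclude each other because the
    vertex set of the copy can be read off from the random graph: it is the ball of radius [R]
    around its core. *)

Record cstruct (K : Type) := CStruct {
  car :> Type;
  sdom : set car;
  srel : car -> car -> Prop;
  scol : car -> K }.
Arguments CStruct {K car}.

(** The colours carry unary information that is not part of the language of graphs: membership in
    the core, being a root, or the game type of a piece hanging at the vertex. Domains are sets so
    that substructures share one carrier. *)
Definition partial_iso K (A B : cstruct K) (P : A -> B -> Prop) :=
  forall x x', P x x' ->
    [/\ sdom x, sdom x', scol x = scol x' &
      forall y y', P y y' -> (x = y <-> x' = y') /\ (srel x y <-> srel x' y')].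

Definition pos_add (U V : Type) (P : U -> V -> Prop) x x' :=
  fun y y' => P y y' \/ y = x /\ y' = x'.

(** Positions are relations instead of lists of pairs, so that positions of several games can be
    united by a formula, as in [EF_glue]. Legality of an answer is enforced by [partial_iso] of the
    next position. *)
Fixpoint EF K n (A B : cstruct K) (P : A -> B -> Prop) : Prop :=
  partial_iso P /\
  if n is n'.+1 then
    (forall x, sdom x -> exists x', EF n' (pos_add P x x')) /\
    (forall x', sdom x' -> exists x, EF n' (pos_add P x x'))
  else True.

Definition pos0 (U V : Type) (_ : U) (_ : V) : Prop := False.

Section EFBasics.
Context {K : Type}.
Implicit Types A B C : cstruct K.

Lemma EF_piso n A B (P : A -> B -> Prop) : EF n P -> partial_iso P.
Proof. by case: n => [|n] []. Qed.

Lemma EF_sub n A B (P Q : A -> B -> Prop) :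
  (forall x y, P x y -> Q x y) -> EF n Q -> EF n P.
Proof.
elim: n P Q => [|n IH] P Q PQ [pQ].
  move=> _; split=> // x x' /PQ /pQ [? ? ? H]; split=> // y y' /PQ; exact: H.
move=> [F B']; split.
  by move=> x x' /PQ /pQ [? ? ? H]; split=> // y y' /PQ; exact: H.
have PQa x x' y y' : pos_add P x x' y y' -> pos_add Q x x' y y'.
  by case=> [/PQ|]; [left|right].
split=> [x /F[x' h]|x' /B'[x h]].
  by exists x'; apply: IH h; apply: PQa.
by exists x; apply: IH h; apply: PQa.
Qed.

Lemma EF_pred n A B (P : A -> B -> Prop) : EF n.+1 P -> EF n P.
Proof.
elim: n P => [|n IH] P; first by case.
case=> pP [F B']; split=> //; split=> [x /F[x' h]|x' /B'[x h]].
  by exists x'; apply: IH.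
by exists x; apply: IH.
Qed.

Lemma EF_le m n A B (P : A -> B -> Prop) : m <= n -> EF n P -> EF m P.
Proof.
move=> /subnK <-; elim: (n - m) => // d IH; rewrite addSn => h.
exact/IH/EF_pred.
Qed.

Lemma EF_sym n A B (P : A -> B -> Prop) : EF n P -> EF n (fun y x => P x y).
Proof.
have pisym (Q : A -> B -> Prop) : partial_iso Q -> partial_iso (fun y x => Q x y).
  move=> pQ x x' /pQ [? ? ? H]; split=> // y y' /H [h1 h2].
  by split; apply: iff_sym.
elim: n P => [|n IH] P [pP]; first by split=> //; exact: pisym.
move=> [F B']; split; first exact: pisym.
split=> [x /B'[x' /IH h]|x' /F[x /IH h]].
  exists x'; apply: EF_sub h => y y' [|[-> ->]]; by [left|right].
exists x; apply: EF_sub h => y y' [|[-> ->]]; by [left|right].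
Qed.

Lemma EF_trans n A B C (P : A -> B -> Prop) (Q : B -> C -> Prop) :
  EF n P -> EF n Q -> EF n (fun x z => exists2 y, P x y & Q y z).
Proof.
have pit (P' : A -> B -> Prop) (Q' : B -> C -> Prop) :
    partial_iso P' -> partial_iso Q' ->
    partial_iso (fun x z => exists2 y, P' x y & Q' y z).
  move=> pP pQ x z [y /pP[dx dy cxy H] /pQ[_ dz cyz H']]; split=> //.
    by rewrite cxy.
  move=> x' z' [y' /H[h1 h2] /H'[h3 h4]].
  by split; [apply: iff_trans h1 h3|apply: iff_trans h2 h4].
elim: n P Q => [|n IH] P Q [pP FP] [pQ FQ]; first by split=> //; exact: pit.
have sb x y z x' z' :
    pos_add (fun x z => exists2 y, P x y & Q y z) x z x' z' ->
    exists2 y', pos_add P x y x' y' & pos_add Q y z y' z'.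
  by case=> [[y' h1 h2]|[-> ->]]; [exists y'; left|exists y; right].
case: FP => F1 B1; case: FQ => F2 B2; split; first exact: pit.
split.
  move=> x /F1[y h1].
  have [_ dy _ _] := EF_piso h1 (or_intror (conj erefl erefl)).
  have [z h2] := F2 _ dy; exists z.
  by apply: EF_sub (IH _ _ h1 h2) => x' z'; apply: sb.
move=> z /B2[y h2].
have [dy _ _ _] := EF_piso h2 (or_intror (conj erefl erefl)).
have [x h1] := B1 _ dy; exists x.
by apply: EF_sub (IH _ _ h1 h2) => x' z'; apply: sb.
Qed.

Lemma EF_iso n A B (f : A -> B) :
  (forall x, sdom x -> sdom (f x) /\ scol (f x) = scol x) ->
  (forall x', sdom x' -> exists2 x, sdom x & f x = x') ->
  (forall x y, sdom x -> sdom y -> (f x = f y -> x = y) /\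
     (srel x y <-> srel (f x) (f y))) ->
  forall P : A -> B -> Prop, (forall x x', P x x' -> sdom x /\ x' = f x) ->
  EF n P.
Proof.
move=> fd fs fi; elim: n => [|n IH] P PP.
  split=> // x x' /PP[dx ->]; case: (fd x dx) => ? ?; split=> // y y' /PP[dy ->].
  by have [h1 h2] := fi x y dx dy; split=> //; split=> [->|/h1].
split.
  move=> x x' /PP[dx ->]; case: (fd x dx) => ? ?; split=> // y y' /PP[dy ->].
  by have [h1 h2] := fi x y dx dy; split=> //; split=> [->|/h1].
split=> [x dx|x' dx'].
  by exists (f x); apply: IH => y y' [/PP|[-> ->]].
have [x dx <-] := fs _ dx'.
by exists x; apply: IH => y y' [/PP|[-> ->]].
Qed.

(** If [x'] is the only candidate with the colour of [x], the answer is forced; this spends one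
    round to put a pair of roots on the board. *)
Lemma EF_step n A B (P : A -> B -> Prop) x x' :
  EF n.+1 P -> sdom x ->
  (forall y', sdom y' -> scol x = scol y' -> y' = x') ->
  EF n (pos_add P x x').
Proof.
move=> [_ [F _]] dx hu; have [y h] := F _ dx.
have [_ dy c _] := EF_piso h (or_intror (conj erefl erefl)).
by rewrite -(hu y dy c).
Qed.

End EFBasics.

Lemma EF_recolor K L (V V' : Type) (D : set V) (D' : set V') r r'
    (c : V -> K) (c' : V' -> K) (d : V -> L) (d' : V' -> L) n
    (P : V -> V' -> Prop) :
  (forall x x', D x -> D' x' -> c x = c' x' -> d x = d' x') ->
  @EF K n (CStruct D r c) (CStruct D' r' c') P ->
  @EF L n (CStruct D r d) (CStruct D' r' d') P.
Proof.
move=> cd; elim: n P => [|n IH] P [pP].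
  by move=> _; split=> // x x' /pP[dx dx' /cd -/(_ dx dx') ? ?].
move=> [F B]; split; first by move=> x x' /pP[dx dx' /cd -/(_ dx dx') ? ?].
by split=> [x /F[x' /IH]|x' /B[x /IH]]; [exists x'|exists x].
Qed.

(* Feferman-Vaught: a structure glued from pieces [D i] along an index
   structure [I], where the only relations across pieces join root-coloured
   elements of pieces related in [I]. A winning strategy is composed from one in
   the index structure and one in each piece. *)
Section Gluing.
Context {K T : Type} (rt : K -> Prop).

Definition glued (X : cstruct K) (I : cstruct T) (D : I -> set X) :=
  [/\ forall x, sdom x <-> exists2 i, sdom i & D i x,
      forall i j x, sdom i -> sdom j -> D i x -> D j x -> i = j &
      forall i j x y, sdom i -> sdom j -> i <> j -> D i x -> D j y ->
        (srel x y <-> [/\ srel i j, rt (scol x) & rt (scol y)])].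

Definition piece (X : cstruct K) (D : set X) := CStruct D (@srel K X) (@scol K X).

(** Each move is played twice, as a move of the index game and as a move inside the chosen piece, so
    [n] rounds everywhere pay for [n] rounds of the composed game. The third hypothesis provides a
    strategy for pairs of pieces that the index game opens later. *)
Lemma EF_glue n (X X' : cstruct K) (I I' : cstruct T)
    (D : I -> set X) (D' : I' -> set X') (W : I -> I' -> Prop)
    (Q : I -> I' -> X -> X' -> Prop) :
  glued D -> glued D' ->
  (forall i i', sdom i -> sdom i' -> scol i = scol i' ->
     @EF K n (piece (D i)) (piece (D' i')) (@pos0 _ _)) ->
  EF n W ->
  (forall i i', W i i' -> @EF K n (piece (D i)) (piece (D' i')) (Q i i')) ->
  EF n (fun x x' => exists i i', W i i' /\ Q i i' x x').
Proof.
move=> gD gD'.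
have pi m (W0 : I -> I' -> Prop) (Q0 : I -> I' -> X -> X' -> Prop) :
    EF m W0 ->
    (forall i i', W0 i i' -> @EF K m (piece (D i)) (piece (D' i')) (Q0 i i')) ->
    partial_iso (fun x x' => exists i i', W0 i i' /\ Q0 i i' x x').
  move=> /EF_piso pW eQ x x' [i [i' [Wi Qi]]].
  have [di di' _ Hi] := pW _ _ Wi.
  have [/= Dx Dx' cx Hx] := EF_piso (eQ _ _ Wi) Qi.
  case: gD => dD uD rD; case: gD' => dD' uD' rD'.
  split=> //; first by apply/dD; exists i.
    by apply/dD'; exists i'.
  move=> y y' [j [j' [Wj Qj]]].
  have [dj dj' _ _] := pW _ _ Wj.
  have [/= Dy Dy' cy _] := EF_piso (eQ _ _ Wj) Qj.
  have [Hij rij] := Hi _ _ Wj.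
  have [eij|nij] := pselect (i = j).
    have eij' := proj1 Hij eij; subst j j'.
    exact: Hx.
  have nij' : i' <> j' by move/(proj2 Hij).
  split.
    split=> exy; exfalso; subst; first exact/nij/(uD i j y).
    exact/nij'/(uD' i' j' y').
  split.
    move/(rD i j x y di dj nij Dx Dy) => [/rij h1 h2 h3].
    by apply/(rD' i' j' x' y' di' dj' nij' Dx' Dy'); rewrite -cx -cy.
  move/(rD' i' j' x' y' di' dj' nij' Dx' Dy') => [/rij h1 h2 h3].
  by apply/(rD i j x y di dj nij Dx Dy); rewrite cx cy.
elim: n W Q => [|n IH] W Q base eW eQ.
  by split=> //; apply: pi eW eQ.
split; first exact: pi eW eQ.
have key x x' i i' Q1 : EF n (pos_add W i i') ->
    @EF K n (piece (D i)) (piece (D' i')) (pos_add Q1 x x') ->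
    (forall y y', W i i' -> Q i i' y y' -> Q1 y y') ->
    EF n (pos_add (fun x x' => exists i i', W i i' /\ Q i i' x x') x x').
  move=> eW1 eQ1 QQ1.
  (* Only the game in the pair of pieces just played advances; [W j j'] discards the values of [Q]
     at index pairs that are not yet on the board. *)
  pose Q2 j j' y y' := Q j j' y y' /\ W j j' \/
    [/\ j = i, j' = i' & pos_add Q1 x x' y y'].
  apply: EF_sub (IH (pos_add W i i') Q2 _ eW1 _).
  - move=> y y' [[j [j' [Wj Qj]]]|[-> ->]].
      by exists j, j'; split; [left|left].
    by exists i, i'; split; right => //; split=> //; right.
  - by move=> j j' dj dj' cj; apply/EF_pred/base.
  - move=> j j' [Wj|[-> ->]].
      have [e|ne] := pselect (j = i).
        have e' : j' = i'.
          have [_ _ _ H] := EF_piso eW1 (or_introl Wj).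
          by apply/(proj1 (H i i' (or_intror (conj erefl erefl)))).
        subst; apply: EF_sub eQ1 => y y' [[Qy _]|[_ _]] //.
        by left; apply: QQ1.
      apply: EF_sub (EF_pred (eQ _ _ Wj)) => y y' [[]|[]] //.
    apply: EF_sub eQ1 => y y' [[Qy Wi]|[_ _]] //.
    by left; apply: QQ1.
case: eW => pW [FW BW].
have [dD _ _] := gD; have [dD' _ _] := gD'.
split.
  move=> x /dD[i di Dx]; have [i' eW1] := FW _ di.
  have [_ di' ci _] := EF_piso eW1 (or_intror (conj erefl erefl)).
  (* A pair of pieces already opened continues its game; a new pair starts from the empty position
     with [base]. *)
  have [Wi|nWi] := pselect (W i i').
    have [_ [/(_ x Dx)[x' h] _]] := eQ _ _ Wi.
    by exists x'; apply: key eW1 h _.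
  have [_ [/(_ x Dx)[x' h] _]] := base _ _ di di' ci.
  by exists x'; apply: key eW1 h _.
move=> x' /dD'[i' di' Dx']; have [i eW1] := BW _ di'.
have [di _ ci _] := EF_piso eW1 (or_intror (conj erefl erefl)).
have [Wi|nWi] := pselect (W i i').
  have [_ [_ /(_ x' Dx')[x h]]] := eQ _ _ Wi.
  by exists x; apply: key eW1 h _.
have [_ [_ /(_ x' Dx')[x h]]] := base _ _ di di' ci.
by exists x; apply: key eW1 h _.
Qed.

End Gluing.

(** * Cardinalities up to a bound, and games on coloured sets *)

Section Counting.
Context {U : Type}.
Implicit Types A : set U.

Lemma at_leastP k A : at_least k A <->
  exists s : seq {classic U}, [/\ uniq s, size s = k & forall x, x \in s -> A x].
Proof.
split.
  move=> /card_leP[f].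
  pose g (i : 'I_k) : {classic U} :=
    val (f (SigSub (mem_set (ltn_ord i : `I_k i)))).
  exists [seq g i | i <- enum 'I_k]; split.
  - rewrite map_inj_uniq ?enum_uniq // => i j /val_inj ij.
    have := @inj _ _ _ f _ _ (in_setT _) (in_setT _) ij.
    by move/(congr1 val) => /= /val_inj.
  - by rewrite size_map size_enum_ord.
  - by move=> x /mapP[i _ ->]; apply: set_valP.
case=> s [us <- sA].
case: s us sA => [|x0 s] us sA.
  by rewrite /at_least (_ : `I_(size [::]) = set0) ?card_ge0 //; apply/seteqP; split.
rewrite /at_least; set t := x0 :: s in us sA *.
have /card_le_eql <- : [set nth x0 t i | i in `I_(size t)] #= `I_(size t).
  apply: inj_card_eq => i j /set_mem /= i_t /set_mem /= j_t.
  by move/eqP; rewrite nth_uniq // => /eqP.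
by apply: subset_card_le => _ [i /= it <-]; apply/sA/mem_nth.
Qed.

Lemma at_least0 A : at_least 0 A.
Proof. by apply/at_leastP; exists [::]. Qed.

Lemma at_least_sub k A B : A `<=` B -> at_least k A -> at_least k B.
Proof. by move=> /subset_card_le AB h; apply: card_le_trans h AB. Qed.

Lemma at_least_le j k A : j <= k -> at_least k A -> at_least j A.
Proof. by move=> jk; apply: card_le_trans; rewrite /= card_le_II. Qed.

Lemma capped_cardP k A : at_least (capped_card k A) A /\
  forall j, j <= k -> at_least j A -> j <= capped_card k A.
Proof.
rewrite /capped_card; case: arg_maxnP => /=; first exact: at_least0.
move=> i Ai imax; split=> // j jk Aj.
by have := imax (inord j); rewrite inordK // => /(_ Aj).
Qed.

Lemma at_least_capped k j A : j <= k -> at_least j A <-> j <= capped_card k A.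
Proof.
move=> jk; have [h1 h2] := capped_cardP k A.
by split; [apply: h2|move=> h; apply: at_least_le h1].
Qed.

End Counting.

Lemma mem_classic (U : eqType) x (s : seq U) :
  (x : {classic U}) \in (s : seq {classic U}) = (x \in s).
Proof.
elim: s => //= y s IH; rewrite !in_cons; congr (_ || _) => //.
by apply/eqP/eqP.
Qed.

Lemma uniq_classic (U : eqType) (s : seq U) : @uniq {classic U} s = uniq s.
Proof. by elim: s => //= x s ->; rewrite mem_classic. Qed.

Lemma at_least_seqP (U : eqType) k (A : set U) : at_least k A <->
  exists s : seq U, [/\ uniq s, size s = k & forall x, x \in s -> A x].
Proof.
split=> [/at_leastP|] [s [us ss sA]]; last apply/at_leastP; exists s.
  by split=> // [|x xs]; [rewrite -(@uniq_classic U s)|apply: sA; rewrite (@mem_classic U x s)].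
by split=> // [|x xs]; [rewrite (@uniq_classic U s)|apply: sA; rewrite -(@mem_classic U x s)].
Qed.


(** From each of the finitely many colour classes keep all elements if there are at most [k], and
    [k] of them otherwise. *)
Lemma select_colors (U : eqType) (K : finType) (c : U -> K) k (A : set U) :
  exists J : seq U, (forall x, x \in J -> A x) /\
    forall s j, j <= k -> at_least j [set x | A x /\ c x = s] <->
      at_least j [set x | x \in J /\ c x = s].
Proof.
have ex s := (at_least_seqP _ _).1 (capped_cardP k [set x | A x /\ c x = s]).1.
pose J s := sval (cid (ex s)).
have JP s : [/\ uniq (J s), size (J s) = capped_card k [set x | A x /\ c x = s] &
    forall x, x \in J s -> A x /\ c x = s] by rewrite /J; case: cid.
exists (flatten [seq J s | s <- enum K]).
have sub x : x \in flatten [seq J s | s <- enum K] -> A x.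
  by case/flatten_mapP => s _ xs; case: (JP s) => _ _ /(_ x xs)[].
split=> // s j jk; split; last first.
  by apply: at_least_sub => x [/sub].
move/(at_least_capped _ jk) => jc; apply: at_least_le jc _.
apply/at_least_seqP; exists (J s); case: (JP s) => h1 h2 h3; split=> // x xs.
split; last by case: (h3 _ xs).
by apply/flatten_mapP; exists s; rewrite ?mem_enum.
Qed.

Lemma at_least_inj (U V : Type) k (A : set U) (B : set V) (f : U -> V) :
  (forall x, A x -> B (f x)) ->
  (forall x y, A x -> A y -> f x = f y -> x = y) ->
  at_least k A -> at_least k B.
Proof.
move=> fA fi /at_leastP[s [us <- sA]]; apply/at_leastP.
pose g : {classic U} -> {classic V} := f.
exists [seq g x | x <- s]; split.
- by rewrite map_inj_in_uniq // => x y /sA Ax /sA Ay; apply: fi.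
- by rewrite size_map.
by move=> x /mapP[y /sA Ay ->]; apply: fA.
Qed.

Section ColoredSets.
Context {K : Type} (e : K -> K -> Prop).

Definition color_adjacent (A : cstruct K) :=
  forall x y : A, sdom x -> sdom y -> (srel x y <-> x <> y /\ e (scol x) (scol y)).

Lemma EF_counts n0 (A B : cstruct K) :
  color_adjacent A -> color_adjacent B ->
  (forall s j, j <= n0 -> at_least j [set x : A | sdom x /\ scol x = s] <->
     at_least j [set x : B | sdom x /\ scol x = s]) ->
  EF n0 (@pos0 A B).
Proof.
move=> cA cB cnt.
have uzip (U V : eqType) (L : seq (U * V)) x a b :
    uniq (unzip1 L) -> (x, a) \in L -> (x, b) \in L -> a = b.
  elim: L => // -[y d] L IH /= /andP[yL uL]; rewrite !inE !xpair_eqE.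
  case/orP=> [/andP[/eqP-> /eqP->]|xa].
    by case/orP=> [/andP[_ /eqP->]|/(map_f fst)] //; rewrite (negbTE yL).
  case/orP=> [/andP[/eqP exy _]|]; last exact: IH.
  by move/(map_f fst): xa; rewrite exy (negbTE yL).
have uzip2 (U V : eqType) (L : seq (U * V)) x y a :
    uniq (unzip2 L) -> (x, a) \in L -> (y, a) \in L -> x = y.
  move=> uL xa ya; apply: (uzip _ _ [seq (p.2, p.1) | p <- L] a).
  - by rewrite /unzip1 -map_comp.
  - by apply/mapP; exists (x, a).
  - by apply/mapP; exists (y, a).
(* Stated for arbitrary sides, so that it serves both the forth and the back move. The class of [x]
   contains [x] and the played elements of its colour, at most [n0] in all; so the class on the
   other side has more elements than were played in it. *)
have step (U V : eqType) (DU : set U) (DV : set V) (cU : U -> K) (cV : V -> K)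
    (L : seq (U * V)) x :
    (forall s j, j <= n0 -> at_least j [set x | DU x /\ cU x = s] ->
       at_least j [set x | DV x /\ cV x = s]) ->
    size L < n0 ->
    (forall x x', (x, x') \in L -> [/\ DU x, DV x' & cU x = cV x']) ->
    uniq (unzip1 L) -> uniq (unzip2 L) -> DU x ->
    x \notin unzip1 L ->
    exists x' : V, [/\ DV x', cV x' = cU x & x' \notin unzip2 L].
  move=> cnt1 sL LP u1 u2 Dx xL.
  pose Ls := [seq p <- L | `[< cU p.1 = cU x >]].
  have sLs : size Ls < n0.
    by apply: leq_ltn_trans sL; rewrite size_filter count_size.
  have /(cnt1 _ _ sLs)/at_least_seqP[t [ut st tP]] :
      at_least (size Ls).+1 [set y | DU y /\ cU y = cU x].
    apply/at_least_seqP; exists (x :: unzip1 Ls); split=> /=.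
    - rewrite (subseq_uniq _ u1) ?andbT; last by apply/map_subseq/filter_subseq.
      by apply: contra xL => /mapP[p]; rewrite mem_filter => /andP[_ pL] ->;
        apply: map_f.
    - by rewrite size_map.
    move=> y; rewrite inE => /orP[/eqP->//|/mapP[[y1 y2]]].
    by rewrite mem_filter => /andP[/asboolP /= h /LP[? _ _]] ->.
  case: (pselect (exists2 x', x' \in t & x' \notin unzip2 Ls)).
    case=> x' /tP[Dx' cx'] nx'; exists x'; split=> //.
    apply: contra nx' => /mapP[[y y'] yL /= e']; subst x'.
    apply/mapP; exists (y, y') => //; rewrite mem_filter yL andbT.
    by apply/asboolP => /=; case: (LP _ _ yL) => _ _ ->.
  move=> nex; exfalso.
  have /(uniq_leq_size ut) : {subset t <= unzip2 Ls}.
    by move=> x' xt; apply/negPn/negP => h; apply: nex; exists x'.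
  by rewrite st size_map ltnn.
have pi (L : seq ({classic A} * {classic B})) :
    (forall x x', (x, x') \in L -> [/\ sdom x, sdom x' & scol x = scol x']) ->
    uniq (unzip1 L) -> uniq (unzip2 L) ->
    partial_iso (fun (x : A) (x' : B) => (x, x') \in L).
  move=> LP u1 u2 x x' xL; have [dx dx' cx] := LP _ _ xL; split=> //.
  move=> y y' yL; have [dy dy' cy] := LP _ _ yL.
  have exy : x = y <-> x' = y'.
    by split=> ?; subst; [exact: uzip u1 xL yL|exact: uzip2 u2 xL yL].
  split=> //; split=> [/(cA _ _ dx dy)|/(cB _ _ dx' dy')] [ne h].
    by apply/(cB _ _ dx' dy'); rewrite -cx -cy; split=> // /exy.
  by apply/(cA _ _ dx dy); rewrite cx cy; split=> // /exy.
have key n (L : seq ({classic A} * {classic B})) : size L + n <= n0 ->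
    (forall x x', (x, x') \in L -> [/\ sdom x, sdom x' & scol x = scol x']) ->
    uniq (unzip1 L) -> uniq (unzip2 L) ->
    EF n (fun (x : A) (x' : B) => (x, x') \in L).
  elim: n L => [|n IH] L sL LP u1 u2; first by split=> //; apply: pi.
  split; first exact: pi.
  split.
    move=> x dx; case: (boolP ((x : {classic A}) \in unzip1 L)).
      move=> /mapP[[y y'] yL /= ?]; subst y; exists y'.
      apply: EF_sub (IH L _ LP u1 u2) => [z z' [|[-> ->]]|] //.
      by apply: leq_trans sL; rewrite leq_add2l.
    move=> xL; have [|x' [dx' cx' xL']] :=
      step {classic A} {classic B} _ _ (@scol _ A) (@scol _ B) L x (fun s j jn => (cnt s j jn).1) _ LP u1 u2 dx xL.
      by apply: leq_trans sL; rewrite addnS ltnS leq_addr.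
    exists x'; apply: EF_sub (IH ((x, x') :: L) _ _ _ _).
    - by move=> y y' [h|[-> ->]]; apply/predU1P; [right|left].
    - by rewrite /= addSnnS.
    - move=> y y'; rewrite inE => /orP[/eqP[-> ->]|/LP] //.
    - by rewrite /= xL.
    - by rewrite /= xL'.
  move=> x' dx'; case: (boolP ((x' : {classic B}) \in unzip2 L)).
    move=> /mapP[[y y'] yL /= ?]; subst y'; exists y.
    apply: EF_sub (IH L _ LP u1 u2) => [z z' [|[-> ->]]|] //.
    by apply: leq_trans sL; rewrite leq_add2l.
  pose L' := [seq (p.2, p.1) | p <- L] => xL'.
  have u1' : unzip1 L' = unzip2 L by rewrite /unzip1 -map_comp.
  have u2' : unzip2 L' = unzip1 L by rewrite /unzip2 -map_comp.
  have [||||||x [dx cx xL]] :=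
    step {classic B} {classic A} _ _ (@scol _ B) (@scol _ A) L' x' (fun s j jn => (cnt s j jn).2).
  - by apply: leq_trans sL; rewrite size_map addnS ltnS leq_addr.
  - by move=> y y' /mapP[[z z'] /LP[? ? ?] [-> ->]].
  - by rewrite u1'.
  - by rewrite u2'.
  - by [].
  - by rewrite u1'.
  rewrite u2' in xL; exists x; apply: EF_sub (IH ((x, x') :: L) _ _ _ _).
  - by move=> y y' [h|[-> ->]]; apply/predU1P; [right|left].
  - by rewrite /= addSnnS.
  - move=> y y'; rewrite inE => /orP[/eqP[-> ->]|/LP] //.
  - by rewrite /= xL.
  - by rewrite /= xL'.
by apply: EF_sub (key n0 [::] _ _ _ _).
Qed.

End ColoredSets.

(** * Hintikka types *)

Section Hintikka.
Context {K : finType}.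

Definition atomic_type m : finType :=
  ({ffun 'I_m * 'I_m -> bool * bool} * {ffun 'I_m -> K})%type.

(** Types are needed as elements of a finite type, not merely as an equivalence relation: [EF_type]
    serves as a colour in the pruning, and [select_colors] requires finitely many colours. *)
Fixpoint hintikka n m : finType :=
  if n is n'.+1 then (atomic_type m * {set hintikka n' m.+1})%type : finType
  else atomic_type m.

Definition atom_of (A : cstruct K) m (a : 'I_m -> A) : atomic_type m :=
  ([ffun p => (`[< a p.1 = a p.2 >], `[< srel (a p.1) (a p.2) >])],
   [ffun i => scol (a i)]).

Fixpoint hintikka_of (A : cstruct K) n : forall m, ('I_m -> A) -> hintikka n m :=
  match n with
  | 0 => fun m a => atom_of a
  | n'.+1 => fun m a => (atom_of a,
      [set t | `[< exists2 x, sdom x & hintikka_of n' (env_cons x a) = t >]]%SET)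
  end.

Lemma EF_hintikka n (A B : cstruct K) m (a : 'I_m -> A) (b : 'I_m -> B) :
  (forall i, sdom (a i)) -> (forall i, sdom (b i)) ->
  hintikka_of n a = hintikka_of n b ->
  EF n (fun x x' => exists2 i, a i = x & b i = x').
Proof.
have at_pi k (a1 : 'I_k -> A) (b1 : 'I_k -> B) :
    (forall i, sdom (a1 i)) -> (forall i, sdom (b1 i)) ->
    atom_of a1 = atom_of b1 ->
    partial_iso (fun x x' => exists2 i, a1 i = x & b1 i = x').
  move=> da db [/ffunP h1 /ffunP h2] _ _ [i <- <-]; split=> //.
    by have := h2 i; rewrite !ffunE.
  move=> _ _ [j <- <-]; have := h1 (i, j); rewrite !ffunE /= => -[h3 h4].
  by split; apply: asbool_eq_equiv.
elim: n m a b => [|n IH] m a b da db /= h.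
  by split=> //; apply: at_pi h.
have hs := (congr1 snd h).
move: hs => /= /setP hs; split; first by apply: at_pi => //; exact: (congr1 fst h).
split.
  move=> x dx; have := hs (hintikka_of n (env_cons x a)); rewrite !inE.
  rewrite asboolT; last by exists x.
  move/esym/asboolP => [x' dx' hx]; exists x'.
  apply: EF_sub (IH _ _ _ _ _ (esym hx)).
  - move=> y y' [[i <- <-]|[-> ->]].
      by exists (lift ord0 i); rewrite /env_cons liftK.
    by exists ord0; rewrite /env_cons unlift_none.
  - by move=> i; rewrite /env_cons; case: unliftP.
  - by move=> i; rewrite /env_cons; case: unliftP.
move=> x' dx'; have := hs (hintikka_of n (env_cons x' b)); rewrite !inE.
rewrite [RHS]asboolT; last by exists x'.
move/asboolP => [x dx hx]; exists x.
apply: EF_sub (IH _ _ _ _ _ hx).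
- move=> y y' [[i <- <-]|[-> ->]].
    by exists (lift ord0 i); rewrite /env_cons liftK.
  by exists ord0; rewrite /env_cons unlift_none.
- by move=> i; rewrite /env_cons; case: unliftP.
- by move=> i; rewrite /env_cons; case: unliftP.
Qed.

Definition EF_type n (A : cstruct K) : hintikka n 0 :=
  hintikka_of n (@env_nil A).

Lemma EF_typeP n (A B : cstruct K) :
  EF_type n A = EF_type n B -> EF n (@pos0 A B).
Proof. by move=> h; apply: EF_sub (EF_hintikka _ _ h) => // -[]. Qed.

End Hintikka.

(** * Dense vertex sets and balls *)

Section Balls.
Context {V : Type} (ad : V -> V -> Prop).
Hypothesis ad_sym : forall x y, ad x y -> ad y x.

Fixpoint ball (D B : set V) r : set V :=
  if r is r'.+1 then
    [set x | ball D B r' x \/ D x /\ exists2 y, ball D B r' y & ad y x]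
  else B `&` D.

Lemma ball_dom D B r : ball D B r `<=` D.
Proof. by elim: r => [|r IH] x /=; [case|case=> [/IH|[]]]. Qed.

Lemma ball_base D B r x : B x -> D x -> ball D B r x.
Proof. by move=> Bx Dx; elim: r => [|r IH] /=; [|left]. Qed.

Lemma ball_le D B r r' : r <= r' -> ball D B r `<=` ball D B r'.
Proof. by move=> /subnK <-; elim: (r' - r) => // d IH x /IH; rewrite addSn; left. Qed.

Lemma ballS D B r x y : ball D B r x -> D y -> ad x y -> ball D B r.+1 y.
Proof. by move=> rx Dy xy; right; split=> //; exists x. Qed.

Lemma ball_sub D B B' r : B `<=` B' -> ball D B r `<=` ball D B' r.
Proof.
move=> BB'; elim: r => [|r IH] x /=; first by case=> /BB'.
by case=> [/IH|[Dx [y /IH]]]; [left|right; split=> //; exists y].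
Qed.

Lemma ball_domS D D' B r : D `<=` D' -> ball D B r `<=` ball D' B r.
Proof.
move=> DD'; elim: r => [|r IH] x /=; first by case=> ? /DD'.
by case=> [/IH|[/DD' Dx [y /IH]]]; [left|right; split=> //; exists y].
Qed.

Lemma ball_add D B r s : ball D (ball D B r) s = ball D B (r + s).
Proof.
apply/seteqP; split; elim: s => [|s IH] x; rewrite ?addn0 ?addnS.
- by case.
- by case=> [/IH|[Dx [y /IH]]]; [left|right; split=> //; exists y].
- by move=> h; split=> //; exact: ball_dom h.
- by case=> [/IH|[Dx [y /IH]]]; [left|right; split=> //; exists y].
Qed.

Lemma ballU D B B' r : ball D (B `|` B') r = ball D B r `|` ball D B' r.
Proof.
apply/seteqP; split; last first.
  by move=> x [] h; apply: ball_sub h => y; [left|right].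
elim: r => [|r IH] x /=; first by case=> [[]]; [left|right].
case=> [/IH[]|[Dx [y /IH[] h yx]]].
- by left; left.
- by right; left.
- by left; right; split=> //; exists y.
- by right; right; split=> //; exists y.
Qed.

Lemma ball_restrict D D' B r : D' `<=` D -> ball D B r `<=` D' ->
  ball D B r = ball D' B r.
Proof.
move=> DD' h; apply/seteqP; split; last exact: ball_domS.
elim: r h => [|r IH] h x /=.
  by move=> [Bx Dx]; split=> //; apply: h; split.
have h' : ball D B r `<=` D' by move=> y ry; apply: h; left.
case=> [/(IH h')|[Dx [y ry yx]]]; first by left.
right; split; first by apply: h; right; split=> //; exists y.
by exists y => //; apply: IH.
Qed.

Lemma ball_sym D x y r : ball D [set x] r y -> ball D [set y] r x.
Proof.
elim: r x y => [|r IH] x y /=; first by case=> -> ?; split.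
case=> [/IH|[Dy [z xz zy]]]; first by left.
have zx := IH _ _ xz; have Dz := ball_dom xz.
suff : ball D (ball D [set y] 1) r x by rewrite ball_add add1n.
apply: ball_sub zx => w ->; right; split; first exact: Dz.
by exists y; [split|exact: ad_sym].
Qed.

(** Both neighbours may lie in level [d.+1], so this excludes edges inside a level as well as a
    second parent. For all [d] together it says that the graph around [B] branches like a forest. *)
Definition unique_parent (D B : set V) d := forall u v v',
  ball D B d.+1 u -> ~ ball D B d u -> ball D B d.+1 v -> ball D B d.+1 v' ->
  ad u v -> ad u v' -> v = v'.

End Balls.

Section Density.
Context {V : eqType} (ad : V -> V -> Prop).
Hypothesis ad_sym : forall x y, ad x y -> ad y x.
Hypothesis ad_irr : forall x, ~ ad x x.

Definition adb x y : bool := `[< ad x y >].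

Let adbC x y : adb x y = adb y x.
Proof. by apply/asboolP/asboolP; apply: ad_sym. Qed.

Fixpoint ecount (s : seq V) : nat :=
  if s is x :: s' then count (adb x) s' + ecount s' else 0.

Definition ecross (s t : seq V) := \sum_(x <- s) count (adb x) t.

Lemma ecount_cat s t : ecount (s ++ t) = ecount s + ecount t + ecross s t.
Proof.
elim: s => [|x s IH]; rewrite /ecross ?big_nil ?addn0 //= big_cons.
by rewrite IH count_cat /ecross; lia.
Qed.

Lemma ecount_perm s t : perm_eq s t -> ecount s = ecount t.
Proof.
elim: s t => [|x s IH] t; first by rewrite perm_sym => /perm_nilP->.
move=> pst; have xt : x \in t by rewrite -(perm_mem pst) mem_head.
case/splitPr: xt pst => t1 t2 pst.
have pst' : perm_eq s (t1 ++ t2).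
  by rewrite -(perm_cons x) (permPl pst) perm_catC /= perm_cons perm_catC.
rewrite /= (IH _ pst') (permP pst') !ecount_cat count_cat /=.
suff -> : ecross t1 (x :: t2) = count (adb x) t1 + ecross t1 t2 by lia.
elim: (t1) => [|y t1' IH1]; rewrite /ecross ?big_nil // !big_cons /=.
by move: IH1; rewrite /ecross => ->; rewrite (adbC y x); lia.
Qed.

(** Supermodularity of the edge count, with [K] split into its parts inside and outside [s]: the
    edges between these two parts also join [s] to the outside part. *)
Lemma ecount_union s K : uniq s -> uniq K ->
  ecount s + ecount K <=
    ecount (s ++ [seq z <- K | z \notin s]) + ecount [seq z <- K | z \in s].
Proof.
move=> us uK; set X := [seq z <- K | z \in s]; set Z := [seq z <- K | z \notin s].
have /ecount_perm -> : perm_eq K (X ++ Z) by rewrite perm_sym perm_filterC.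
rewrite !ecount_cat.
suff : ecross X Z <= ecross s Z by lia.
have /(perm_big _) /= hX : perm_eq X [seq z <- s | z \in K].
  apply: uniq_perm; rewrite ?filter_uniq // => z.
  by rewrite !mem_filter andbC.
rewrite /ecross hX big_filter big_mkcond /=; apply: leq_sum => x _; by case: ifP.
Qed.

Definition dense (s : seq V) : Prop := [/\ uniq s, 0 < size s & size s <= ecount s].

(** In a sparse graph these are the vertex sets of the cycles of length at most [L]; edge counts
    make them accessible without handling cyclic sequences. *)
Definition min_dense L (s : seq V) : Prop :=
  [/\ dense s, size s <= L & forall t, dense t -> {subset t <= s} -> size s <= size t].

Definition sparse : Prop := forall s, uniq s -> ecount s <= size s.

Lemma dense_min L s : dense s -> size s <= L ->
  exists2 t, min_dense L t & {subset t <= s}.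
Proof.
elim: {s}(size s) {-2}s (leqnn (size s)) => [|n IH] s sn ds sL.
  by case: ds; rewrite lt0n -leqn0 sn.
have [[t [dt ts st]]|h] := pselect (exists t, [/\ dense t, {subset t <= s} & size t < size s]).
  have [||t' mt' t't] := IH t _ dt.
  - by rewrite -ltnS (leq_trans st).
  - exact: leq_trans (ltnW st) sL.
  by exists t' => // x /t't/ts.
exists s => //; split=> // t dt ts; rewrite leqNgt; apply/negP => st.
by apply: h; exists t.
Qed.

Lemma min_dense_sub L s t : min_dense L s -> uniq t -> {subset t <= s} ->
  0 < size t < size s -> ecount t < size t.
Proof.
move=> [_ _ h] ut ts /andP[t0 st]; rewrite ltnNge; apply/negP => te.
by have := h t (And3 ut t0 te) ts; rewrite leqNgt st.
Qed.

Lemma min_dense_eq L L' s t : min_dense L s -> min_dense L' t ->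
  {subset s <= t} -> s =i t.
Proof.
move=> [[us s0 se] _ _] [[ut _ _] _ h] st.
have ts : size t <= size s by apply: h.
exact: (uniq_min_size us st ts).2.
Qed.

(** If the two sets met without being equal, their intersection would have fewer edges than
    vertices, and by supermodularity the union would have more edges than vertices. If they were
    disjoint, the joining edge would be the surplus one. *)
Lemma min_dense_disjoint L L' s t x y : sparse ->
  min_dense L s -> min_dense L' t -> x \in s -> y \in t -> x = y \/ ad x y ->
  s =i t.
Proof.
move=> sp ms mt xs yt xy.
have [[us s0 se] _ _] := ms; have [[ut t0 te] _ _] := mt.
set X := [seq z <- t | z \in s]; set Z := [seq z <- t | z \notin s].
have sXZ : size X + size Z = size t by rewrite !size_filter count_predC.
have uU : uniq (s ++ Z).
  rewrite cat_uniq us filter_uniq // andbT; apply/hasPn => z.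
  by rewrite mem_filter => /andP[].
have eU := sp _ uU.
have eun := ecount_union us ut; rewrite -/X -/Z in eun.
rewrite size_cat in eU.
have ht : {subset t <= s} -> s =i t.
  by move=> ts z; rewrite (min_dense_eq mt ms ts).
have [X0|X0] := posnP (size X).
  have ys : y \notin s.
    apply/negP => ys; have : y \in X by rewrite mem_filter ys yt.
    by move/size0nil: X0 => ->.
  have axy : ad x y by case: xy => // exy; move: ys; rewrite -exy xs.
  exfalso; have Zt : Z = t.
    apply/all_filterP/allP => z zt; apply/negP => zs.
    have : z \in X by rewrite mem_filter zs zt.
    by move/size0nil: X0 => ->.
  rewrite Zt ecount_cat in eU.
  have : 0 < ecross s t.
    rewrite /ecross (big_rem x) //= addn_gt0 -has_count; apply/orP; left.
    by apply/hasP; exists y => //; apply/asboolP.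
  lia.
have [Xt|Xt] := ltnP (size X) (size t).
  have : ecount X < size X.
    apply: min_dense_sub mt _ _ _; rewrite ?filter_uniq ?X0 // => z.
    by rewrite mem_filter => /andP[].
  lia.
apply: ht => z zt.
have Z0 : Z = [::] by apply: size0nil; lia.
apply/negPn/negP => zs; have : z \in Z by rewrite mem_filter zs.
by rewrite Z0.
Qed.

Lemma ecross0 s t : (forall x y, x \in s -> y \in t -> ~ ad x y) -> ecross s t = 0.
Proof.
move=> h; rewrite /ecross big_seq big1 // => x xs; apply/eqP.
rewrite -leqn0 leqNgt -has_count; apply/hasPn => y yt; apply/asboolP; exact: h.
Qed.

(** Otherwise [C] splits [s] into two parts without edges between them, each with fewer edges than
    vertices by minimality. *)
Lemma min_dense_closed L s (C : set V) x : min_dense L s ->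
  (forall y z, C y -> ad y z -> C z) -> x \in s -> C x ->
  forall y, y \in s -> C y.
Proof.
move=> ms cC xs Cx y ys; apply: contrapT => nCy.
have [[us s0 se] _ _] := ms.
set X := [seq z <- s | `[< C z >]]; set Y := [seq z <- s | ~~ `[< C z >]].
have sXY : size X + size Y = size s by rewrite !size_filter count_predC.
have xX : x \in X by rewrite mem_filter xs andbT; apply/asboolP.
have yY : y \in Y by rewrite mem_filter ys andbT; apply/asboolP.
have X0 : 0 < size X by case: (X) xX.
have Y0 : 0 < size Y by case: (Y) yY.
have eX : ecount X < size X.
  apply: min_dense_sub ms _ _ _; rewrite ?filter_uniq //; last lia.
  by move=> z; rewrite mem_filter => /andP[].
have eY : ecount Y < size Y.
  apply: min_dense_sub ms _ _ _; rewrite ?filter_uniq //; last lia.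
  by move=> z; rewrite mem_filter => /andP[].
have es : ecount s = ecount (X ++ Y).
  by apply: ecount_perm; rewrite perm_sym perm_filterC.
rewrite ecount_cat ecross0 in es; first lia.
move=> a b; rewrite !mem_filter => /andP[/asboolP Ca _] /andP[/asboolP nCb _] ab.
exact/nCb/(cC a).
Qed.

(** Deleting a vertex of degree at most 1 would leave a smaller dense set. *)
Lemma min_dense_deg L s x : min_dense L s -> x \in s -> 1 < count (adb x) s.
Proof.
move=> ms xs; have [[us s0 se] _ _] := ms; rewrite ltnNge; apply/negP => h.
have ps := perm_to_rem xs.
have cs : count (adb x) s = count (adb x) (rem x s).
  rewrite (permP ps) /= (_ : adb x x = false) //.
  by apply/asboolP => /ad_irr.
have es := ecount_perm ps; rewrite /= -cs in es.
have ss := perm_size ps; rewrite /= in ss.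
have [r0|r0] := posnP (size (rem x s)).
  by move/size0nil: r0 => r0; rewrite r0 /= in es ss cs; lia.
have : ecount (rem x s) < size (rem x s).
  apply: min_dense_sub ms _ _ _; rewrite ?rem_uniq //; last lia.
  by move=> z; apply: mem_rem.
lia.
Qed.

Section Hull.
Variables (D B : set V) (P : seq V -> Prop) (c : nat).
Hypothesis P_uniq : forall s, P s -> uniq s.
Hypothesis P_add : forall s v w, P s -> v \notin s -> w \in s -> ad v w -> P (v :: s).
Hypothesis P_base : forall s b, P s -> B b -> exists s',
  [/\ P s', b \in s', {subset s <= s'}, size s' <= size s + c &
    forall z, z \in s' -> z \in s \/ (B `&` D) z].

(** [P] is an invariant of finite vertex lists, in the applications a lower bound on the number of
    edges: it survives the addition of a vertex with a neighbour in the list, because such a vertex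
    brings an edge. Walking from [B] to [v] costs at most [c] vertices at the base and [d] on the
    way. *)
Lemma hull_ball d s v : P s -> ball ad D B d v -> exists s',
  [/\ P s', v \in s', {subset s <= s'}, size s' <= size s + (c + d) &
    forall z, z \in s' -> z \in s \/ ball ad D B d z].
Proof.
elim: d s v => [|d IH] s v Ps /=.
  by case=> Bv Dv; rewrite addn0; exact: P_base.
case=> [/(IH _ _ Ps)[s' [h1 h2 h3 h4 h5]]|[Dv [w wd wv]]].
  exists s'; split=> //; first by lia.
  by move=> z /h5[]; [left|right; left].
have [s' [h1 h2 h3 h4 h5]] := IH _ _ Ps wd.
have [vs|vs] := boolP (v \in s').
  exists s'; split=> //; first by lia.
  by move=> z /h5[]; [left|right; left].
exists (v :: s'); split.
- by apply: P_add vs h2 _ => //; apply: ad_sym.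
- exact: mem_head.
- by move=> z /h3; rewrite inE orbC => ->.
- by rewrite /=; lia.
- move=> z; rewrite inE => /orP[/eqP->|/h5[]]; [|by left|by right; left].
  by right; right; split=> //; exists w.
Qed.

(** The walk to [v] runs in the ball of radius [d] until its last vertex, so it cannot pass through
    [u]. *)
Lemma hull_avoid d s u v : P s -> u \notin s -> ~ ball ad D B d u -> u <> v ->
  ball ad D B d.+1 v -> exists s',
  [/\ P s', v \in s', {subset s <= s'}, size s' <= size s + (c + d.+1) & u \notin s'] /\
    forall z, z \in s' -> z \in s \/ ball ad D B d.+1 z.
Proof.
move=> Ps us nu uv.
case=> [/(hull_ball Ps)[s' [h1 h2 h3 h4 h5]]|[Dv [w wd wv]]].
  exists s'; split; last by move=> z /h5[]; [left|right; left].
  split=> //; first by lia.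
  by apply/negP => /h5[]; [apply/negP|].
have [s' [h1 h2 h3 h4 h5]] := hull_ball Ps wd.
have us' : u \notin s' by apply/negP => /h5[]; [apply/negP|].
have [vs|vs] := boolP (v \in s').
  exists s'; split; last by move=> z /h5[]; [left|right; left].
  by split=> //; lia.
exists (v :: s'); split; first split.
- by apply: P_add vs h2 _ => //; apply: ad_sym.
- exact: mem_head.
- by move=> z /h3; rewrite inE orbC => ->.
- by rewrite /=; lia.
- by rewrite inE negb_or us' andbT; apply/eqP.
move=> z; rewrite inE => /orP[/eqP->|/h5[]]; [|by left|by right; left].
by right; right; split=> //; exists w.
Qed.

(** A vertex with two parents, added to a hull containing both, brings two edges; this surplus edge
    yields a dense set around a vertex and contradicts sparsity around the core. *)
Lemma hull_two d s u v v' : P s -> u \notin s -> ~ ball ad D B d u ->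
  ball ad D B d.+1 v -> ball ad D B d.+1 v' -> ad u v -> ad u v' -> v <> v' ->
  exists s',
  [/\ P s', uniq (u :: s'), size s' <= size s + (c + d.+1).*2,
    1 < count (adb u) s' & forall z, z \in s' -> z \in s \/ ball ad D B d.+1 z].
Proof.
move=> Ps us nu dv dv' uv uv' vv'.
have ne w : ad u w -> u <> w by move=> h e; move: h; rewrite e => /ad_irr.
have [s1 [[h1 h2 h3 h4 h5] h6]] := hull_avoid Ps us nu (ne _ uv) dv.
have [s2 [[g1 g2 g3 g4 g5] g6]] := hull_avoid h1 h5 nu (ne _ uv') dv'.
exists s2; split=> //.
- by rewrite /= g5 P_uniq.
- by rewrite -addnn; lia.
- have vs2 := perm_to_rem (g3 _ h2).
  rewrite (permP vs2) /= (_ : adb u v = true); last exact/asboolP.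
  rewrite add1n ltnS -has_count; apply/hasP; exists v'; last exact/asboolP.
  have : v' \in v :: rem v s2 by rewrite -(perm_mem vs2).
  by rewrite inE => /orP[/eqP e|//]; case: vv'.
- by move=> z /g6[/h6|]; [|right].
Qed.

End Hull.

(** The number of edges in the hull of [x] is at least the number of vertices minus one, and [u]
    adds two edges, so [u :: s] would be dense. Its size is at most 1 for [x], [d.+1] for each of
    the two walks and 1 for [u], whence [d.*2 + 4]. *)
Lemma unique_parent_root (D : set V) x d : D x ->
  (forall s, dense s -> size s <= d.*2 + 4 ->
     ~ (forall z, z \in s -> ball ad D [set x] d.+1 z)) ->
  unique_parent ad D [set x] d.
Proof.
move=> Dx nd u v v' du ndu dv dv' uv uv'; apply: contrapT => vv'.
pose P s := [/\ uniq s, x \in s & size s <= (ecount s).+1].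
have [|||||s [[us xs es] uus ss cs bs]] := @hull_two D [set x] P 0 _ _ _ d [:: x] u v v' _ _ ndu dv dv' uv uv' vv'.
- by move=> s [].
- move=> s a w [us xs es] as_ ws aw; split; rewrite /= ?as_ // ?inE ?xs ?orbT //.
  have : 0 < count (adb a) s by rewrite -has_count; apply/hasP; exists w => //; apply/asboolP.
  lia.
- move=> s b [us xs es] ->; exists s; split=> //; first by rewrite addn0.
  by move=> z; left.
- by split; rewrite ?mem_head.
- rewrite inE; apply/negP => /eqP e; apply: ndu; rewrite e; exact: ball_base.
apply: (nd (u :: s)); first by split=> //=; lia.
  by move: ss => /=; lia.
move=> z; rewrite inE => /orP[/eqP->//|/bs[|//]].
by rewrite inE => /eqP->; apply: ball_base.
Qed.

Definition core L : set V := [set x | exists2 s, min_dense L s & x \in s].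

(** Here the hull starts empty and absorbs whole minimal dense sets, so it has at least as many
    edges as vertices; the two edges at [u] would break sparsity. *)
Lemma unique_parent_core L d : sparse -> unique_parent ad setT (core L) d.
Proof.
move=> sp u v v' du ndu dv dv' uv uv'; apply: contrapT => vv'.
pose P s := uniq s /\ size s <= ecount s.
have [|||||s [[us es] uus ss cs bs]] := @hull_two setT (core L) P L _ _ _ d [::] u v v' _ _ ndu dv dv' uv uv' vv'.
- by move=> s [].
- move=> s a w [us es] as_ ws aw; split; rewrite /= ?as_ //.
  have : 0 < count (adb a) s by rewrite -has_count; apply/hasP; exists w => //; apply/asboolP.
  lia.
(* Adding [K] keeps the invariant by supermodularity together with [ecount X <= size X], which is
   sparsity of the intersection. *)
- move=> s b [us es] [K mK bK]; have [[uK K0 eK] KL _] := mK.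
  set X := [seq z <- K | z \in s]; set Z := [seq z <- K | z \notin s].
  have sXZ : size X + size Z = size K by rewrite !size_filter count_predC.
  have eun := ecount_union us uK; rewrite -/X -/Z in eun.
  have eX : ecount X <= size X by apply: sp; rewrite filter_uniq.
  exists (s ++ Z); split.
  + split; last by rewrite size_cat; lia.
    rewrite cat_uniq us filter_uniq // andbT; apply/hasPn => z.
    by rewrite mem_filter => /andP[].
  + by rewrite mem_cat mem_filter bK andbT orbN.
  + by move=> z zs; rewrite mem_cat zs.
  + by rewrite size_cat; lia.
  + move=> z; rewrite mem_cat mem_filter => /orP[|/andP[_ zK]]; first by left.
    by right; split=> //; exists K.
- by [].
- by [].
by have := sp _ uus; rewrite /=; lia.
Qed.

End Density.

(** * Finite approximation of the neighbourhood of the core *)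

Section Pruning.
Context {V : eqType} (ad : V -> V -> Prop).
Hypothesis ad_sym : forall x y, ad x y -> ad y x.
Hypothesis ad_irr : forall x, ~ ad x x.
Hypothesis sp : sparse ad.
Variables (f L : nat).

Let S := core ad L.
Let BR := ball ad setT S.

(** Guarantees that a core vertex kept in [J] is still a core vertex of the graph induced on [J]. *)
Definition core_closed (J : seq V) := forall x, x \in J -> S x ->
  exists K, [/\ min_dense ad L K, x \in K & {subset K <= J}].

(** The core is a union of finite pieces with no edges between them, so the game sees only the
    number of pieces of each game type, up to [f]. The colouring is arbitrary because the induction
    in [prune] arrives here with colours of its own. *)
Lemma prune_core (K : finType) (c : V -> K) : exists J : seq V,
  [/\ forall x, x \in J -> S x, core_closed J &
      EF f (@pos0 (CStruct S ad c) (CStruct [set` J] ad c))].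
Proof.
pose I : set {classic set V} := [set A | exists2 s, min_dense ad L s & A = [set` s]].
pose t (A : {classic set V}) := EF_type f (CStruct (A : set V) ad c).
have [JA [JI cnt]] := select_colors t f I.
pose lst (A : {classic set V}) : seq V :=
  if pselect (exists s : seq V, min_dense ad L s /\ A = [set` s]) is left h
  then sval (cid h) else [::].
have lstP A : I A -> min_dense ad L (lst A) /\ A = [set` lst A].
  move=> [s ms As]; rewrite /lst; case: pselect; last by case; exists s.
  by move=> h; case: cid.
pose J := flatten [seq lst A | A <- JA].
have JP x : x \in J <-> exists2 A, A \in JA & x \in lst A.
  by split=> [/flatten_mapP|h]; last exact/flatten_mapP.
have disj A A' x y : I A -> I A' -> A x -> A' y -> x = y \/ ad x y -> A = A'.
  move=> /lstP[mA eA] /lstP[mA' eA']; rewrite eA eA' => /= xA yA' xy.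
  have e := min_dense_disjoint ad_sym sp mA mA' xA yA' xy.
  by apply/seteqP; split=> z /=; rewrite e.
exists J; split.
- move=> x /JP[A /JI/lstP[mA eA] xA]; by exists (lst A).
- move=> x /JP[A AJ xA] _; have [mA eA] := lstP _ (JI _ AJ).
  by exists (lst A); split=> // y yA; apply/JP; exists A.
pose XI := @CStruct _ {classic set V} I (fun _ _ => False) t.
pose XJ := @CStruct _ {classic set V} [set` JA] (fun _ _ => False) t.
apply: EF_sub (@EF_glue _ _ (fun _ => True) f (CStruct S ad c) (CStruct [set` J] ad c)
   XI XJ (fun A => A) (fun A => A) (@pos0 XI XJ) (fun _ _ => @pos0 V V) _ _ _ _ _) => //.
- split=> /=.
  + move=> x; split; last by case=> A /lstP[mA eA]; rewrite eA; exists (lst A).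
    by case=> s ms xs; exists [set` s] => //; exists s.
  + by move=> A A' x IA IA' Ax A'x; apply: disj IA IA' Ax A'x _; left.
  + move=> A A' x y IA IA' AA' Ax A'y; split; last by case.
    by move=> h; case: AA'; apply: disj IA IA' Ax A'y _; right.
- split=> /=.
  + move=> x; split=> [/JP[A AJ xA]|[A AJ Ax]].
      by exists A => //; have [_ eA] := lstP _ (JI _ AJ); have -> : A x = (x \in lst A) by rewrite {1}eA.
    by apply/JP; exists A => //; have [_ eA] := lstP _ (JI _ AJ); move: Ax; rewrite {1}eA.
  + by move=> A A' x /JI IA /JI IA' Ax A'x; apply: disj IA IA' Ax A'x _; left.
  + move=> A A' x y /JI IA /JI IA' AA' Ax A'y; split; last by case.
    by move=> h; case: AA'; apply: disj IA IA' Ax A'y _; right.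
- by move=> A A' _ _ /EF_typeP.
- apply: (@EF_counts _ (fun _ _ => False)) => [x y|x y|s j jf]; try by split=> // -[].
  exact: cnt.
Qed.

(** Induction on [R]. By [unique_parent_core] the ball of radius [R.+1] is the ball of radius [R]
    with leaves attached to its vertices. The game type of the star at a vertex becomes its colour
    for the smaller radius; then every kept vertex retains at most [f] leaves of each colour. The
    third conclusion lets [J] be recovered as a ball around its core vertices. *)
Lemma prune R (K : finType) (c : V -> K) : exists J : seq V,
  [/\ forall x, x \in J -> BR R x, core_closed J,
      forall x, x \in J -> ball ad [set` J] S R x &
      EF f (@pos0 (CStruct (BR R) ad c) (CStruct [set` J] ad c))].
Proof.
elim: R K c => [|R IH] K c.
  have [J [h1 h2 h3]] := prune_core c; exists J; split=> //.
  - by move=> x /h1.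
  - by move=> x xJ; split=> //; exact: h1.
  - by rewrite /BR /= setIT.
(* [flag] marks the centres of the stars: all edges between different stars join centres. *)
pose flag z : bool := `[< BR R z >].
have flagF z : ~ BR R z -> flag z = false by move=> h; exact: asboolF.
have flagT z : BR R z -> flag z = true by move=> h; exact: asboolT.
pose c2 z := (c z, flag z).
pose lf y : set V := [set z | [/\ BR R.+1 z, ~ BR R z & ad y z]].
pose D y : set V := [set z | z = y \/ lf y z].
have up := @unique_parent_core V ad ad_sym ad_irr L R sp.
have lf_par y y' z : BR R.+1 y -> BR R.+1 y' -> lf y z -> ad y' z -> y = y'.
  move=> By By' [Bz nBz yz] y'z; apply: (up z) => //; exact: ad_sym.
pose t y := EF_type f (CStruct (D y) ad c2).
have [J [JB Jc Jb JE]] := IH _ t.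
pose Jl y := sval (cid (select_colors c f (lf y))).
have JlP y : (forall z, z \in Jl y -> lf y z) /\
    forall s j, j <= f -> at_least j [set x | lf y x /\ c x = s] <->
      at_least j [set x | x \in Jl y /\ c x = s].
  by rewrite /Jl; case: cid.
pose D' y : set V := [set z | z \in y :: Jl y].
have D'D y : D' y `<=` D y.
  move=> z; rewrite /D' /= inE => /orP[/eqP|/(JlP y).1]; by [left|right].
pose J' := flatten [seq y :: Jl y | y <- J].
have J'P x : x \in J' <-> exists2 y, y \in J & D' y x.
  split=> [/flatten_mapP[y yJ yx]|[y yJ yx]]; first by exists y.
  by apply/flatten_mapP; exists y.
have D_flag y z : BR R y -> D y z -> (flag z <-> z = y).
  move=> By Dz; split=> [/asboolP Bz|->]; last exact/asboolP.
  by case: Dz => // -[].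
have D_ball y z : BR R y -> D y z -> BR R.+1 z.
  by move=> By [->|[]] //; left.
have D_disj i j x : BR R i -> BR R j -> D i x -> D j x -> i = j.
  move=> Bi Bj [->|[Bx nBx ix]].
    by case=> // -[].
  case=> [e|[_ _ jx]]; first by case: nBx; rewrite e.
  by apply: (lf_par i j x); [left|left| |].
have D_cross i j x y : BR R i -> BR R j -> i <> j -> D i x -> D j y ->
    (ad x y <-> [/\ ad i j, flag x & flag y]).
  move=> Bi Bj ij Dx Dy; split; last first.
    by case=> ? /(D_flag _ _ Bi Dx)-> /(D_flag _ _ Bj Dy)->.
  move=> xy; case: Dx => [xi|lx].
    case: Dy => [yj|ly]; subst.
      by split=> //; apply/asboolP.
    by case: ij; apply/esym/(lf_par j i y) => //; left.
  exfalso; have iy : i = y.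
    apply: (lf_par i y x) => //; [by left| exact: D_ball Dy|exact: ad_sym].
  case: Dy => [yj|[_ nBy _]]; first by apply: ij; rewrite iy.
  by apply: nBy; rewrite -iy.
exists J'; split.
- move=> x /J'P[y yJ /D'D Dx]; apply: D_ball Dx; exact: JB.
- move=> x /J'P[y yJ /D'D Dx] Sx.
  have Bx : BR R x by apply: ball_base.
  have xy : x = y by apply/(D_flag y x (JB _ yJ) Dx)/asboolP.
  have [s [ms ys sJ]] := Jc y yJ (eq_ind _ _ Sx _ xy).
  exists s; split=> //; first by rewrite xy.
  by move=> z /sJ zJ; apply/J'P; exists z => //; rewrite /D' /= mem_head.
- have JJ' : [set` J] `<=` [set` J'].
    by move=> z zJ; apply/J'P; exists z => //; rewrite /D' /= mem_head.
  move=> x xJ'; have [y yJ D'x] := (J'P x).1 xJ'.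
  have yb : ball ad [set` J'] S R y by apply: ball_domS JJ' _ (Jb y yJ).
  by case: (D'D _ _ D'x) => [->|[_ _ yx]]; [left|exact: ballS yb _ yx].
pose X := CStruct (BR R.+1) ad c2; pose X' := CStruct [set` J'] ad c2.
pose XI := CStruct (BR R) ad t; pose XJ := CStruct [set` J] ad t.
apply: (@EF_recolor _ _ _ _ _ _ _ _ c2 c2) => [x x' _ _ []//|].
have glue := @EF_glue _ _ (fun k : K * bool => is_true k.2) f X X' XI XJ D D'
   (@pos0 XI XJ) (fun _ _ => @pos0 V V).
apply: EF_sub (glue _ _ _ _ _) => //.
- split=> //=.
  move=> x; split; last by case=> y By Dx; apply: D_ball Dx.
  have [Bx _|nBx Bx] := pselect (BR R x); first by exists x => //; left.
  case: (Bx) => [//|[_ [y By xy]]]; by exists y => //; right; split.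
- split=> //=.
  + move=> i j x /JB Bi /JB Bj /D'D Dx /D'D Dy; exact: D_disj Bi Bj Dx Dy.
  + by move=> i j x y /JB Bi /JB Bj ij /D'D Dx /D'D Dy; apply: D_cross.
- move=> i i' Bi i'J /EF_typeP ti.
  have Bi' := JB _ i'J.
  have ca (E : set V) : E `<=` D i' ->
      color_adjacent (fun k k' : K * bool => k.2 != k'.2) (CStruct E ad c2).
    move=> ED x y /ED Dx /ED Dy /=; split.
      move=> xy; split; first by move=> exy; apply: (@ad_irr x); rewrite {2}exy.
      case: Dx xy => [->|lx]; case: Dy => [ey|ly] xy.
      + by move: xy; rewrite ey => /ad_irr.
      + rewrite (flagT _ Bi').
        by have [_ /flagF-> _] := ly.
      + rewrite ey (flagT _ Bi').
        by have [_ /flagF-> _] := lx.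
      + exfalso; have [Bx nBx ix] := lx; have [By nBy iy] := ly.
        apply: nBy; rewrite -(lf_par i' y x) //; [by left|exact: ad_sym].
    case=> xy fxy; case: Dx => [ex|lx]; case: Dy => [ey|ly].
    + by case: xy; rewrite ex ey.
    + by rewrite ex; case: ly.
    + by rewrite ey; apply: ad_sym; case: lx.
    + have [_ /flagF fx _] := lx; have [_ /flagF fy _] := ly.
      by move: fxy; rewrite fx fy.
  (* Inside a star, adjacency means one centre and one leaf, a condition on the flags; so counting
     leaves per colour compares the full star with the kept one. *)
  have h2 : EF f (@pos0 (CStruct (D i') ad c2) (CStruct (D' i') ad c2)).
    apply: (@EF_counts _ (fun k k' : K * bool => k.2 != k'.2)); [exact: ca|exact: ca|].
    move=> [k b] j jf /=; split; last by apply: at_least_sub => x [/D'D].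
    case: b.
      apply: at_least_sub => x [Dx [cx fx]]; split; last by rewrite /c2 cx fx.
      by rewrite ((D_flag _ _ Bi' Dx).1 fx) /D' /= mem_head.
    move=> h; have /((JlP i').2 _ _ jf) h2 : at_least j [set x | lf i' x /\ c x = k].
      apply: at_least_sub h => x [[->|lx] [cx fx]]; split=> //.
      by move: fx; rewrite (flagT _ Bi').
    apply: at_least_sub h2 => x [xJ cx]; split.
      by rewrite /D' /= inE xJ orbT.
    by rewrite /c2 cx; have [_ /flagF-> _] := (JlP i').1 _ xJ.
  by apply: EF_sub (EF_trans ti h2).
Qed.

End Pruning.

(** * Locality *)

Section BallGames.
Context {K : Type} (c0 : K -> Prop).
Implicit Types A B : cstruct K.

Definition played A B (P : A -> B -> Prop) : set A :=
  [set x | (exists x', P x x') \/ c0 (scol x)].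

Definition played' A B (P : A -> B -> Prop) : set B :=
  [set x' | (exists x, P x x') \/ c0 (scol x')].

(** The spoiler can trace a path of length [r] back to a centre, one round per step. The centres are
    fixed by the earlier position [P0], while [P] grows along the path. *)
Lemma EF_ball_transfer r n A B (P0 P : A -> B -> Prop) x y :
  (forall a b, P0 a b -> P a b) -> EF (r + n) P -> P x y ->
  ball (@srel _ A) (@sdom _ A) (played P0) r x -> ball (@srel _ B) (@sdom _ B) (played' P0) r y.
Proof.
elim: r n P x y => [|r IH] n P x y PP EP Pxy /=.
  have [dx dy cxy H] := EF_piso EP Pxy.
  case=> [[[x' Px]|cx] _]; split=> //.
    by left; exists x; rewrite ((H _ _ (PP _ _ Px)).1.1 erefl).
  by right; rewrite -cxy.
case=> [h|[dx [x' h rx]]].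
  by left; apply: (IH n.+1 P x y) => //; rewrite addnS.
rewrite addSn in EP; have [pP [F _]] := EP.
have [y' EP'] := F _ (ball_dom h).
have [_ dy _ _] := pP _ _ Pxy.
right; split=> //; exists y'.
  apply: (IH n _ x' y' _ EP') h; first by move=> a b /PP; left.
  by right.
have [_ _ _ /(_ x y (or_introl Pxy))[_ h1]] :=
  EF_piso EP' (or_intror (conj erefl erefl)).
exact/h1.
Qed.

(** With [r] rounds in reserve, an answer outside the ball would be exposed by
    [EF_ball_transfer]. *)
Lemma EF_ball_restrict r n A B (P0 P : A -> B -> Prop) :
  (forall a b, P0 a b -> P a b) -> EF (n + r) P ->
  (forall a b, P a b -> ball (@srel _ A) (@sdom _ A) (played P0) r a) ->
  @EF _ n (piece (ball (@srel _ A) (@sdom _ A) (played P0) r))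
          (piece (ball (@srel _ B) (@sdom _ B) (played' P0) r)) P.
Proof.
have pi n0 P1 : (forall a b, P0 a b -> P1 a b) -> EF (n0 + r) P1 ->
  (forall a b, P1 a b -> ball (@srel _ A) (@sdom _ A) (played P0) r a) ->
  @partial_iso _ (piece (ball (@srel _ A) (@sdom _ A) (played P0) r))
          (piece (ball (@srel _ B) (@sdom _ B) (played' P0) r)) P1.
  move=> PP EP Pb x x' Px; have [dx dx' cx H] := EF_piso EP Px.
  split=> //; first exact: Pb Px.
  by apply: (EF_ball_transfer (n := n0) PP _ Px (Pb _ _ Px)); rewrite addnC.
elim: n P => [|n IH] P PP EP Pb; first by split=> //; exact: (pi 0).
split; first exact: (pi n.+1).
rewrite addSn in EP; have [pP [F G]] := EP.
split=> [x bx|y b_y].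
  have [y EP'] := F _ (ball_dom bx); exists y; apply: IH EP' _.
    by move=> a b /PP; left.
  by move=> a b [/Pb|[-> _]].
have [x EP'] := G _ (ball_dom b_y); exists x; apply: IH (EP') _.
  by move=> a b /PP; left.
move=> a b [/Pb//|[-> _]].
have EP'' : EF (r + n) (fun b a => pos_add P x y a b) by rewrite addnC; exact: EF_sym.
have := @EF_ball_transfer r n B A (fun b a => P0 a b) _ y x _ EP''.
by apply=> //; [move=> ? ? /PP; left|right].
Qed.

End BallGames.

(** With [r] the old value, [3 * r + 1 = (2 * r + 1) + r]: a new vertex within [2 * r + 1] of the
    centres has its ball of radius [r] inside the larger ball, and otherwise the balls of radius [r]
    around it and around the centres are disjoint and non-adjacent. *)
Fixpoint radius j := if j is j'.+1 then 3 * radius j' + 1 else 0.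

(** One round is spent on the move itself, [2 * radius j' + 1] on showing that the answer is as
    close to the centres, and [radius j'] on restricting the game to the smaller balls. *)
Fixpoint rounds j :=
  if j is j'.+1 then (rounds j' + radius j' + (2 * radius j' + 1)).+1 else 0.

Arguments radius : simpl never.
Arguments rounds : simpl never.

Definition ball_struct V (ad : V -> V -> Prop) (S B : set V) r : cstruct bool :=
  CStruct (ball ad setT (B `|` S) r) ad (fun x => `[< S x >]).

(* A vertex far from the core can be answered by the root of a closed set [C]
   which avoids the core and finitely many prescribed vertices. *)
Definition far_answer (V V' : eqType) (ad : V -> V -> Prop) (ad' : V' -> V' -> Prop)
    (S : set V) (S' : set V') r n q :=
  forall x, ~ ball ad setT S (2 * r + 1) x ->
  forall bs : seq V', size bs <= q -> exists y (C : set V'),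
  [/\ C y, forall a b, C a -> ad' a b -> C b, forall b, b \in bs -> ~ C b,
      forall b, S' b -> ~ C b &
      @EF _ n (CStruct (ball ad setT [set x] r) ad (fun _ => tt))
              (CStruct (ball ad' setT [set y] r) ad' (fun _ => tt))
              (fun a b => a = x /\ b = y)].

Section Locality.
Variables (V V' : eqType) (ad : V -> V -> Prop) (ad' : V' -> V' -> Prop).
Variables (S : set V) (S' : set V').
Hypothesis ad_sym : forall x y, ad x y -> ad y x.
Hypothesis ad'_sym : forall x y, ad' x y -> ad' y x.

Lemma EF_local_forth q j (L : seq (V * V')) x :
  far_answer ad ad' S S' (radius j) (rounds j) q -> size L <= q ->
  @EF _ (rounds j.+1) (ball_struct ad S [set` unzip1 L] (radius j.+1))
    (ball_struct ad' S' [set` unzip2 L] (radius j.+1)) (fun a b => (a, b) \in L) ->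
  exists y,
  @EF _ (rounds j) (ball_struct ad S [set` x :: unzip1 L] (radius j))
    (ball_struct ad' S' [set` y :: unzip2 L] (radius j))
    (fun a b => (a, b) \in (x, y) :: L).
Proof.
move=> far sL; set r := radius j => EL.
set B := [set` unzip1 L] `|` S; set B' := [set` unzip2 L] `|` S'.
pose A := ball_struct ad S [set` unzip1 L] (radius j.+1).
pose A' := ball_struct ad' S' [set` unzip2 L] (radius j.+1).
have r3 : radius j.+1 = (2 * r + 1) + r.
  by rewrite -[radius j.+1]/(3 * r + 1); lia.
have r4 : rounds j.+1 = (rounds j + r + (2 * r + 1)).+1 by [].
pose P0 (a : A) (b : A') : Prop := (a, b) \in L.
have pB : played is_true P0 = B.
  apply/seteqP; split=> a /=.
    by case=> [[b ab]|/asboolP]; [left; apply/mapP; exists (a, b)|right].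
  case=> [/mapP[[a1 b1] h /= ->]|Sa]; [left; by exists b1|by right; apply/asboolP].
have pB' : played' is_true P0 = B'.
  apply/seteqP; split=> a /=.
    by case=> [[b ab]|/asboolP]; [left; apply/mapP; exists (b, a)|right].
  case=> [/mapP[[a1 b1] h /= ->]|Sa]; [left; by exists a1|by right; apply/asboolP].
have consB (T : eqType) (x0 : T) (s : seq T) (S0 : set T) :
    [set` x0 :: s] `|` S0 = [set x0] `|` ([set` s] `|` S0).
  apply/seteqP; split=> a /=; rewrite inE.
    by case=> [/orP[/eqP->|]|]; [left|right; left|right; right].
  by case=> [->|[->|]]; [left; rewrite eqxx|left; rewrite orbT|right].
have [xB|xB] := pselect (ball ad setT B (2 * r + 1) x).
  have xA : sdom (x : A) by rewrite /= -/B; apply: ball_le xB; rewrite r3; lia.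
  have [_ [/(_ x xA)[y EP] _]] := EL; exists y.
  have [_ yA _ _] := EF_piso EP (or_intror (conj erefl erefl)).
  have yB : ball ad' setT B' (2 * r + 1) y.
    have h : forall a b, P0 a b -> pos_add P0 x y a b by left.
    have EP' : @EF _ ((2 * r + 1) + (rounds j + r)) A A' (pos_add P0 x y).
      by rewrite addnC.
    have := EF_ball_transfer (c0 := is_true) h EP' (or_intror (conj erefl erefl)).
    rewrite pB pB' /= => h2; apply: ball_domS (h2 _) => //.
    rewrite -(@ball_restrict _ ad setT) // => z; apply: ball_le; rewrite r3; lia.
  pose P1 : A -> A' -> Prop := pos_add P0 x y.
  have EP1 : @EF _ (rounds j + r) A A' P1 by apply: EF_le EP; rewrite leq_addr.
  have p1 : played is_true P1 = [set` x :: unzip1 L] `|` S.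
    rewrite consB -/B -pB; apply/seteqP; split=> a /=.
      by case=> [[b [ab|[-> _]]]|h]; [right; left; exists b|left|right; right].
    case=> [->|[[b ab]|h]]; [left; exists y; by right|left; exists b; by left|by right].
  have p1' : played' is_true P1 = [set` y :: unzip2 L] `|` S'.
    rewrite consB -/B' -pB'; apply/seteqP; split=> a /=.
      by case=> [[b [ab|[_ ->]]]|h]; [right; left; exists b|left|right; right].
    case=> [->|[[b ab]|h]]; [left; exists x; by right|left; exists b; by left|by right].
  have sub1 : ball ad setT ([set` x :: unzip1 L] `|` S) r `<=` sdom (c := A).
    rewrite consB ballU => z [zx|zB] /=; last by apply: ball_le zB; rewrite r3; lia.
    rewrite -/B r3 -ball_add; apply: ball_sub zx => _ -> //.
  have sub1' : ball ad' setT ([set` y :: unzip2 L] `|` S') r `<=` sdom (c := A').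
    rewrite consB ballU => z [zx|zB] /=; last by apply: ball_le zB; rewrite r3; lia.
    rewrite -/B' r3 -ball_add; apply: ball_sub zx => _ -> //.
  have := @EF_ball_restrict _ is_true r (rounds j) A A' P1 P1 (fun _ _ h => h) EP1 _.
  rewrite p1 p1' -(ball_restrict _ sub1) // -(ball_restrict _ sub1') // => h.
  apply: EF_sub (h _) => [a b|a b P1ab].
    by rewrite inE => /orP[/eqP[-> ->]|]; [right|left].
  apply: ball_base => //; left; rewrite /= inE.
  case: P1ab => [ab|[-> _]]; rewrite ?eqxx //.
  by apply/orP; right; apply/mapP; exists (a, b).
have xS : ~ ball ad setT S (2 * r + 1) x.
  by move=> h; apply: xB; apply: ball_sub h; right.
have [|y [C [Cy cC bsC S'C ET]]] := far x xS (unzip2 L); first by rewrite size_map.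
exists y.
have yC z : ball ad' setT [set y] r z -> C z.
  elim: (r) z => [|r' IH] z /=; first by case=> ->.
  by case=> [/IH//|[_ [w /IH Cw zw]]]; apply: cC Cw zw.
have B'C z : ball ad' setT B' r z -> ~ C z.
  elim: (r) z => [|r' IH] z /=; first by case=> -[/bsC|/S'C].
  by case=> [/IH//|[_ [w /IH Cw zw]] Cz]; apply: Cw; apply: cC Cz _; apply: ad'_sym.
(* A common vertex or a joining edge would give a path of length at most [r + 1 + r] from the
   centres to [x]. *)
have xBr z w : ball ad setT B r z -> ball ad setT [set x] r w -> z = w \/ ad z w -> False.
  move=> Bz /(ball_sym ad_sym) wx zw; apply: xB.
  rewrite (_ : 2 * r + 1 = (r + 1) + r); last by lia.
  rewrite -ball_add -ball_add; apply: ball_sub wx => _ ->.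
  case: zw => [<-|zw]; first by left.
  by right; split=> //; exists z.
(* The index structure has two unrelated points: [true] for the balls around the old centres and
   [false] for the ball around the new vertex. *)
pose II : cstruct bool := @CStruct bool bool setT (fun _ _ => False) id.
pose D (b : II) := if b then ball ad setT B r else ball ad setT [set x] r.
pose D' (b : II) := if b then ball ad' setT B' r else ball ad' setT [set y] r.
pose X := ball_struct ad S [set` x :: unzip1 L] r.
pose X' := ball_struct ad' S' [set` y :: unzip2 L] r.
pose Q (b b' : II) : V -> V' -> Prop :=
  if b then fun a c => is_true ((a, c) \in L) else fun a c => a = x /\ c = y.
have EL1 : @EF _ (rounds j) (piece (X := X) (D true)) (piece (X := X') (D' true))
    (fun a b => (a, b) \in L).
  have EL2 : @EF _ (rounds j + r) A A' P0.
    by apply: EF_le EL; rewrite r4; lia.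
  have := EF_ball_restrict (c0 := is_true) (fun _ _ h => h) EL2.
  have rr : r <= radius j.+1 by rewrite r3; lia.
  have sub z : ball ad setT B r z -> sdom (z : A) by exact: ball_le.
  have sub' z : ball ad' setT B' r z -> sdom (z : A') by exact: ball_le.
  rewrite pB pB' -(@ball_restrict _ ad setT) // -(@ball_restrict _ ad' setT) //.
  apply=> a b ab; apply: ball_base => //; left.
  by apply/mapP; exists (a, b).
have EL0 : @EF _ (rounds j) (piece (X := X) (D false)) (piece (X := X') (D' false))
    (fun a b => a = x /\ b = y).
  apply: EF_recolor ET => a b /= xa yb _.
  have -> : `[< S a >] = false.
    by apply: asboolF => Sa; apply: (xBr a a) => //; [apply: ball_base => //; right|left].
  by symmetry; apply: asboolF => /S'C; apply; apply: yC.
have ELb b : @EF _ (rounds j) (piece (X := X) (D b)) (piece (X := X') (D' b)) (Q b b).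
  by case: b.
have glue := @EF_glue bool bool (fun _ => True) (rounds j) X X' II II D D' (fun a b => a = b) Q.
apply: EF_sub (glue _ _ _ _ _).
- move=> a b; rewrite inE => /orP[/eqP[-> ->]|ab].
    by exists false, false.
  by exists true, true.
- split=> /=.
  + move=> z; rewrite consB ballU; split.
      by case=> h; [exists false|exists true].
    by case=> -[] _ h; [right|left].
  + move=> [] [] z _ _ // z1 z2; exfalso; first by apply: (xBr z z) => //; left.
    by apply: (xBr z z) => //; left.
  + move=> [] [] z w _ _ // _ z1 z2; split=> [zw|[]//]; exfalso.
      by apply: (xBr z w) => //; right.
    by apply: (xBr w z) => //; right; apply: ad_sym.
- split=> /=.
  + move=> z; rewrite consB ballU; split.
      by case=> h; [exists false|exists true].
    by case=> -[] _ h; [right|left].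
  + by move=> [] [] z _ _ // z1 z2; exfalso; [apply: (B'C z) z1 (yC _ z2)|apply: (B'C z) z2 (yC _ z1)].
  + move=> [] [] z w _ _ // _ z1 z2; split=> [zw|[]//]; exfalso.
      by apply: (B'C z) z1 (cC _ _ (yC _ z2) (ad'_sym zw)).
    by apply: (B'C w) z2 (cC _ _ (yC _ z1) zw).
- move=> b b' _ _ /= bb'; rewrite -bb'; apply: EF_sub (ELb b) => //.
- by apply: (@EF_iso _ _ _ _ id) => // b _; exists b.
- by move=> b b' bb'; rewrite -bb'; exact: ELb.
Qed.

End Locality.

(** The back move is the forth move of the position with its pairs swapped, which is why
    [far_answer] is assumed in both directions. *)
Lemma EF_local (V V' : eqType) (ad : V -> V -> Prop) (ad' : V' -> V' -> Prop)
    (S : set V) (S' : set V') q :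
  (forall x y, ad x y -> ad y x) -> (forall x y, ad' x y -> ad' y x) ->
  (forall j, j < q -> far_answer ad ad' S S' (radius j) (rounds j) q) ->
  (forall j, j < q -> far_answer ad' ad S' S (radius j) (rounds j) q) ->
  forall j (L : seq (V * V')), size L + j <= q ->
  @EF _ (rounds j) (ball_struct ad S [set` unzip1 L] (radius j))
    (ball_struct ad' S' [set` unzip2 L] (radius j)) (fun a b => (a, b) \in L) ->
  @EF _ j (CStruct setT ad (fun _ => tt)) (CStruct setT ad' (fun _ => tt))
    (fun a b => (a, b) \in L).
Proof.
move=> sy sy' far far'; elim=> [|j IH] L sL EL.
  by case: EL => pL _; split=> // a b /pL[_ _ _ H].
have jq : j < q by apply: leq_trans sL; exact: leq_addl.
have sLq : size L <= q by apply: leq_trans sL; exact: leq_addr.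
split; first by move=> a b /(EF_piso EL)[_ _ _ H].
split=> [x _|y _].
  have [y Ey] := EF_local_forth sy sy' x (far j jq) sLq EL; exists y.
  apply: EF_sub (IH ((x, y) :: L) _ Ey); last by rewrite /= addSnnS.
  by move=> a b [ab|[-> ->]]; rewrite inE ?eqxx ?ab ?orbT.
pose L' := [seq (p.2, p.1) | p <- L].
have L'1 : unzip1 L' = unzip2 L by rewrite /unzip1 -map_comp.
have L'2 : unzip2 L' = unzip1 L by rewrite /unzip2 -map_comp.
have L'P a b : ((b, a) \in L') = ((a, b) \in L).
  by apply/mapP/idP => [[[a' b'] h [-> ->]]//|h]; exists (a, b).
have [||x Ex] := @EF_local_forth _ _ ad' ad S' S sy' sy q j L' y (far' j jq).
- by rewrite size_map.
- rewrite L'1 L'2; apply: EF_sub (EF_sym EL) => a b; by rewrite L'P.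
exists x; rewrite L'1 L'2 in Ex.
apply: EF_sub (IH ((x, y) :: L) _ _); last 2 first.
- by rewrite /= addSnnS.
- apply: EF_sub (EF_sym Ex) => a b; rewrite !inE L'P => /orP[/eqP[-> ->]|->].
    by rewrite eqxx.
  by rewrite orbT.
by move=> a b [ab|[-> ->]]; rewrite inE ?eqxx ?ab ?orbT.
Qed.

(** * Tree types and games *)

Section Walks.
Context {G : graph}.
Implicit Types (t : set G) (r u v w : G).

Lemma walk_ball t d r v : walk t d r v -> ball (@adj G) t [set r] d v.
Proof.
by elim=> [x tx|e x y z _ IH tz yz]; [split|right; split=> //; exists y].
Qed.

Lemma ball_walk t d r v : ball (@adj G) t [set r] d v ->
  exists2 e, e <= d & walk t e r v.
Proof.
elim: d v => [|d IH] v /=; first by case=> -> tr; exists 0 => //; exact: walk0.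
case=> [/IH[e ed h]|[tv [w /IH[e ed h] wv]]].
  by exists e => //; exact: ltnW.
by exists e.+1 => //; exact: walkS h tv wv.
Qed.

Lemma depthP t r v d : depth t r v d <->
  ball (@adj G) t [set r] d v /\ forall e, e < d -> ~ ball (@adj G) t [set r] e v.
Proof.
split=> [[h1 h2]|[/ball_walk[e ed h1] h2]].
  split=> [|e ed /ball_walk[e' ee' /h2]]; first exact: walk_ball.
  by rewrite leqNgt (leq_ltn_trans ee' ed).
have ed' : e = d.
  apply/eqP; rewrite eqn_leq ed leqNgt; apply/negP => /h2; apply; exact: walk_ball.
split=> [|e' /walk_ball h]; first by rewrite -ed'.
by rewrite leqNgt; apply/negP => /h2.
Qed.

Lemma ball_depth t r v d : ball (@adj G) t [set r] d v ->
  exists2 e, e <= d & depth t r v e.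
Proof.
elim: d => [|d IH] h; first by exists 0 => //; apply/depthP; split.
have [/IH[e ed he]|n] := pselect (ball (@adj G) t [set r] d v).
  by exists e => //; exact: ltnW.
exists d.+1 => //; apply/depthP; split=> // e ed he; apply: n.
by apply: ball_le he.
Qed.

Lemma depth_inj t r v d e : depth t r v d -> depth t r v e -> d = e.
Proof. by move=> [h1 h2] [h3 h4]; apply/eqP; rewrite eqn_leq h2 ?h4. Qed.

Lemma depthS t r v d : depth t r v d.+1 ->
  exists u, depth t r u d /\ child t r u v.
Proof.
move=> /[dup] dv /depthP[h hm].
have [/(hm _ (ltnSn d))//|[tv [u du uv]]] := h.
have [e ed de] := ball_depth du; have [h1 _] := (depthP _ _ _ _).1 de.
have ee : e = d.
  apply/eqP; rewrite eqn_leq ed /= leqNgt; apply/negP => lt.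
  by apply: (hm e.+1); [rewrite ltnS|exact: ballS h1 tv uv].
by exists u; rewrite -ee; split=> //; split=> //; exists e => //; rewrite ee.
Qed.

Lemma truncation_ball t r m : truncation t r m = ball (@adj G) t [set r] m.
Proof.
apply/seteqP; split=> v; last by move/ball_depth=> [d dm h]; exists d.
by case=> d /depthP[h _] dm; apply: ball_le h.
Qed.

End Walks.

(** Acyclicity of the part reachable from [r], level by level: this form follows from edge counts
    and is what the decomposition into branches uses. *)
Definition tree_like (G : graph) (t : set G) (r : G) :=
  t r /\ forall d, unique_parent (@adj G) t [set r] d.

Section Branches.
Context {G : graph} (B : set G) (r : G).
Hypothesis Br : B r.
Hypothesis Btree : forall d, unique_parent (@adj G) B [set r] d.
Implicit Types u v w : G.

Let bl := ball (@adj G) B [set r].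
Let br v := branch B r v.

Lemma depth_root : depth B r r 0.
Proof. by apply/depthP; split=> //; split. Qed.

Lemma child_rootP v : child B r r v <-> B v /\ adj r v.
Proof.
split=> [[rv [d _ /depthP[h _]]]|[Bv rv]]; first by split=> //; exact: ball_dom h.
split=> //; exists 0; first exact: depth_root.
apply/depthP; split; first by right; split=> //; exists r => //; split.
move=> [|//] _ [vr _]; by move: rv; rewrite vr => /adj_irrefl.
Qed.

Lemma child_unique u u' w : child B r u w -> child B r u' w -> u = u'.
Proof.
move=> [uw [d du dw]] [u'w [e du' dw']].
have de : d = e by have := depth_inj dw dw'; case.
rewrite -de in du' {dw'}.
have /depthP[hu _] := du; have /depthP[hu' _] := du'; have /depthP[hw hw'] := dw.
apply: (Btree (d := d) hw) => //; try by left.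
- exact: hw'.
- exact: adj_sym.
- exact: adj_sym.
Qed.

Lemma edge_child u w d e : depth B r u d -> depth B r w e -> adj u w ->
  child B r u w \/ child B r w u.
Proof.
wlog de : u w d e / d <= e.
  move=> H du dw uw; have [de|de] := leqP d e; first exact: H du dw uw.
  by apply/or_comm; apply: (H w u e d) => //; [exact: ltnW|exact: adj_sym].
move=> du dw uw; left; split=> //.
have [hu _] := (depthP _ _ _ _).1 du; have [hw hw'] := (depthP _ _ _ _).1 dw.
have Bw := ball_dom hw.
have [ed|ed] := eqVneq e d.
  exfalso; case: d => [|d] in de du hu ed *.
    by move: hu hw; rewrite ed => -[ur _] [wr _]; move: uw; rewrite ur wr => /adj_irrefl.
  subst e; have [p [dp [pw _]]] := depthS dw.
  have [hp _] := (depthP _ _ _ _).1 dp.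
  have up : u = p.
    apply: (Btree (d := d) hw) => //.
    - exact: hw'.
    - by left.
    - exact: adj_sym.
    - exact: adj_sym.
  by subst p; have := depth_inj du dp; lia.
exists d => //; suff -> : d.+1 = e by [].
apply/eqP; rewrite eqn_leq ltn_neqAle eq_sym ed de /= leqNgt; apply/negP => lt.
apply: (hw' d.+1) => //; exact: ballS hu Bw uw.
Qed.

Lemma branch_ind v (P : G -> Prop) : P v ->
  (forall u w, br v u -> P u -> child B r u w -> P w) -> forall w, br v w -> P w.
Proof.
move=> Pv PS w h.
have := Operators_Properties.clos_rt_rtn1 _ _ _ _ h.
elim=> // y z yz hy Py; apply: (PS y z) => //.
exact: Operators_Properties.clos_rtn1_rt.
Qed.

Lemma branch_child v u w : br v u -> child B r u w -> br v w.
Proof. by move=> h c; apply: rt_trans h (rt_step _ _ _ _ c). Qed.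

Lemma branch_depth v w : child B r r v -> br v w ->
  exists d, depth B r w d.+1 /\ ball (@adj G) (br v) [set v] d w.
Proof.
move=> cv; elim/branch_ind=> [|u w' bu [d [du hu]] c].
  have [_ [d dr dv]] := cv; have d0 := depth_inj dr depth_root; subst d.
  by exists 0; split=> //; split=> //; exact: rt_refl.
have [uw [e du' dw]] := c; have := depth_inj du du' => ?; subst e.
exists d.+1; split=> //; apply: ballS hu _ uw; exact: branch_child c.
Qed.

Lemma branch_cover w d : depth B r w d.+1 -> exists2 v, child B r r v & br v w.
Proof.
elim: d w => [|d IH] w dw; have [u [du c]] := depthS dw.
  have [[ur _] _] := (depthP _ _ _ _).1 du; have e : u = r := ur.
  by subst u; exists w => //; exact: rt_refl.
by have [v cv bu] := IH _ du; exists v => //; exact: branch_child c.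
Qed.

Lemma branch_last v w : br v w -> w = v \/ exists2 u, br v u & child B r u w.
Proof. by elim/branch_ind=> [|u w' bu _ c]; [left|right; exists u]. Qed.

Lemma child_root_depth v : child B r r v -> depth B r v 1.
Proof.
by move=> [_ [d dr dv]]; have d0 := depth_inj dr depth_root; subst d.
Qed.

Lemma branch_top v w : child B r r v -> br v w -> depth B r w 1 -> w = v.
Proof.
move=> cv /branch_last[//|[u /(branch_depth cv)[d [du _]] [uw [e du' dw']]]] dw.
by have := depth_inj du du'; have := depth_inj dw dw'; lia.
Qed.

Lemma branch_disjoint v v' w : child B r r v -> child B r r v' ->
  br v w -> br v' w -> v = v'.
Proof.
move=> cv cv' bw bw'.
have [d [dw _]] := branch_depth cv bw.
elim: d w bw bw' dw => [|d IH] w bw bw' dw.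
  by rewrite -(branch_top cv bw dw) -(branch_top cv' bw' dw).
have [e|[u bu cu]] := branch_last bw.
  by have := child_root_depth cv; rewrite -e => h; have := depth_inj dw h; lia.
have [e|[u' bu' cu']] := branch_last bw'.
  by have := child_root_depth cv'; rewrite -e => h; have := depth_inj dw h; lia.
have uu' := child_unique cu cu'; subst u'.
apply: (IH u) => //; have [_ [e du dw']] := cu.
by have := depth_inj dw dw' => -[->].
Qed.

Lemma branch_cross v v' w w' : child B r r v -> child B r r v' ->
  br v w -> br v' w' -> adj w w' -> v = v'.
Proof.
move=> cv cv' bw bw' ww'.
have [d [dw _]] := branch_depth cv bw; have [e [dw' _]] := branch_depth cv' bw'.
case: (edge_child dw dw' ww') => c.
  exact: (branch_disjoint cv cv' (branch_child bw c) bw').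
exact: (branch_disjoint cv cv' bw (branch_child bw' c)).
Qed.

Lemma branch_not_root v : child B r r v -> ~ br v r.
Proof.
move=> cv /(branch_depth cv)[d [h _]]; have := depth_inj h depth_root; lia.
Qed.

Lemma branch_adj_root v w : child B r r v -> br v w -> adj r w -> w = v.
Proof.
move=> cv bw rw; have [d [dw _]] := branch_depth cv bw.
have [hw _] := (depthP _ _ _ _).1 dw.
have /child_root_depth h : child B r r w.
  by apply/child_rootP; split=> //; exact: ball_dom hw.
exact: (branch_top cv bw h).
Qed.

Lemma branch_sub v : child B r r v -> br v `<=` B.
Proof.
move=> cv w /(branch_depth cv)[d [/depthP[h _] _]]; exact: ball_dom h.
Qed.

(** Depth in a branch is depth in the tree minus one; through this the branches inherit unique
    parents. *)
Lemma branch_ball v d : child B r r v ->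
  ball (@adj G) (br v) [set v] d = br v `&` bl d.+1.
Proof.
move=> cv; apply/seteqP; split=> w.
  move=> h; split; first exact: ball_dom h.
  have [Bv rv] := (child_rootP _).1 cv.
  rewrite /bl -add1n -ball_add.
  apply: ball_domS (branch_sub cv) _ _; apply: ball_sub h => _ ->.
  by right; split=> //; exists r => //; split.
move=> [bw hw]; have [e [dw h]] := branch_depth cv bw.
apply: ball_le h; rewrite leqNgt; apply/negP => lt.
by have [_ /(_ d.+1)] := (depthP _ _ _ _).1 dw; apply.
Qed.

Lemma branch_tree v : child B r r v -> tree_like (br v) v.
Proof.
move=> cv; split; first exact: rt_refl.
move=> d u a b; rewrite !branch_ball //.
move=> [bu hu] nu [ba ha] [bb hb] ua ub.
by apply: (Btree (d := d.+1) hu) => // h; apply: nu.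
Qed.

End Branches.

Lemma unique_parent_truncation (G : graph) (t : set G) (r : G) m :
  tree_like t r -> tree_like (truncation t r m) r.
Proof.
move=> [tr ut]; rewrite truncation_ball; set B := ball _ _ _ _.
have Bt : B `<=` t by move=> x; exact: ball_dom.
have bE d : d <= m -> ball (@adj G) B [set r] d = ball (@adj G) t [set r] d.
  by move=> dm; symmetry; apply: ball_restrict => // x; exact: ball_le.
split; first exact: ball_base.
move=> d u v v' hu nu hv hv' uv uv'.
have [dm|dm] := ltnP d m; last first.
  by case: nu; have Bu : B u := ball_dom hu; apply: (ball_le dm); rewrite bE.
by apply: (ut d u) => //; rewrite -bE // ltnW.
Qed.

Definition root_col (T : Type) (r x : T) : bool := `[< x = r >].

Lemma root_colT (T : Type) (r : T) : root_col r r = true.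
Proof. exact: asboolT. Qed.

Lemma root_colF (T : Type) (r x : T) : x <> r -> root_col r x = false.
Proof. exact: asboolF. Qed.

Section TreeTypes.
Variables (n k : nat) (nk : n <= k).

Definition rooted (G : graph) (t : set G) (r : G) : cstruct bool :=
  CStruct t (@adj G) (root_col r).

Section Decomposition.
Variables (G : graph) (B : set G) (r : G) (m : nat).
Hypothesis tB : tree_like B r.

(** The tree is glued along a star: the centre, coloured [None], stands for the root alone, and each
    leaf for the branch at that child. *)
Definition top_index : cstruct (option (Sigma m k)) :=
  CStruct [set v : G | v = r \/ child B r r v]
    (fun v v' => root_col r v != root_col r v')
    (fun v => if root_col r v then None else Some (tree_type m k (branch B r v) v)).

Definition top_piece (v : top_index) : set G :=
  if root_col r v then [set r] else branch B r v.

(** Edges between different pieces join the root to its children, so these two colours describe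
    them. *)
Definition top_struct : cstruct (bool * bool) :=
  CStruct B (@adj G) (fun x => (root_col r x, `[< child B r r x >])).

Let Br : B r := tB.1.
Let ut := tB.2.

Lemma child_ne_root v : child B r r v -> v <> r.
Proof. by move=> cv e; have [_ rv] := (child_rootP Br _).1 cv; move: rv; rewrite e => /adj_irrefl. Qed.

Lemma glued_top : (forall v, B v -> exists d, depth B r v d) ->
  glued (X := top_struct) (I := top_index) (fun c => c.1 || c.2) top_piece.
Proof.
move=> reach.
have pr : top_piece r = [set r] by rewrite /top_piece root_colT.
have pc v : child B r r v -> top_piece v = branch B r v.
  by move=> cv; rewrite /top_piece root_colF //; exact: child_ne_root.
split=> /=.
- move=> x; split.
    move=> /reach[[|d] dx].
      have [[xr _] _] := (depthP _ _ _ _).1 dx.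
      by exists r; [left|rewrite pr].
    have [v cv bx] := branch_cover dx.
    by exists v; [right|rewrite pc].
  case=> v [->|cv]; first by rewrite pr => ->.
  by rewrite pc // => /(branch_sub Br cv).
- move=> i j x [->|ci] [->|cj]; rewrite ?pr ?pc //.
  + by move=> -> /(branch_not_root Br cj).
  + by move=> bx xr; move: bx; rewrite xr => /(branch_not_root Br ci).
  + exact: branch_disjoint.
- move=> i j x y hi hj ij; have nr v : child B r r v -> root_col r v = false.
    by move=> /child_ne_root; exact: root_colF.
  case: hi hj => [ei|ci] [ej|cj].
  + by case: ij; rewrite ei ej.
  + subst i; rewrite pr pc // => -> yb; rewrite root_colT (nr _ cj); split.
      move=> ry; have -> := branch_adj_root Br cj yb ry.
      by split=> //; rewrite (asboolT cj) orbT.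
    case=> _ _ /orP[/asboolP e|/asboolP cy].
      by move: yb; rewrite e => /(branch_not_root Br cj).
    by have [] := (child_rootP Br y).1 cy.
  + subst j; rewrite pr pc // => xb ->; rewrite root_colT (nr _ ci); split.
      move=> /adj_sym rx; have -> := branch_adj_root Br ci xb rx.
      by split=> //; rewrite (asboolT ci) orbT.
    case=> _ /orP[/asboolP e|/asboolP cx] _.
      by move: xb; rewrite e => /(branch_not_root Br ci).
    by apply: adj_sym; have [] := (child_rootP Br x).1 cx.
  + rewrite !pc // => xb yb; rewrite (nr _ ci) (nr _ cj); split=> [xy|[]//].
    by case: ij; exact: branch_cross ci cj xb yb xy.
Qed.

End Decomposition.

(** Equal types mean equal numbers of branches of each type up to [k], and as [n <= k] a game of [n]
    rounds on the index stars sees no more. Branches of equal type are equivalent by induction on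
    [m]. *)
Lemma EF_tree_type m : forall (G G' : graph) (t : set G) (t' : set G') r r',
  tree_like t r -> tree_like t' r' -> tree_type m k t r = tree_type m k t' r' ->
  EF n (@pos0 (rooted (truncation t r m) r) (rooted (truncation t' r' m) r')).
Proof.
elim: m => [|m IH] G G' t t' r r' tt tt'.
  move=> _; apply: (@EF_iso bool n (rooted (truncation t r 0) r)
    (rooted (truncation t' r' 0) r') (fun _ => r')) => //=.
  - move=> x; rewrite !truncation_ball => -[-> _]; split; last by rewrite /= !root_colT.
    by split=> //; exact: tt'.1.
  - move=> x; rewrite !truncation_ball => -[-> _]; exists r => //.
    by split=> //; exact: tt.1.
  - move=> x y; rewrite !truncation_ball => -[-> _] [-> _]; split=> //.
    by split=> /adj_irrefl.
move=> /= /ffunP types.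
set B := truncation t r m.+1; set B' := truncation t' r' m.+1.
have tB : tree_like B r by exact: unique_parent_truncation.
have tB' : tree_like B' r' by exact: unique_parent_truncation.
have reach (H : graph) (s : set H) q : tree_like s q ->
    forall v, truncation s q m.+1 v -> exists d, d <= m.+1 /\ depth (truncation s q m.+1) q v d.
  move=> [sq _] v h; have : ball (@adj H) (truncation s q m.+1) [set q] m.+1 v.
    move: (h); rewrite {1}truncation_ball (@ball_restrict _ _ _ (truncation s q m.+1)) //.
      by rewrite truncation_ball => w; exact: ball_dom.
    by rewrite truncation_ball.
  by move=> /ball_depth[d dm hd]; exists d.
(* A branch of a tree of depth at most [m.+1] has depth at most [m], so the truncation in the
   induction hypothesis changes nothing. *)
have br_trunc (H : graph) (s : set H) q v : tree_like s q ->
    child (truncation s q m.+1) q q v ->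
    truncation (branch (truncation s q m.+1) q v) v m = branch (truncation s q m.+1) q v.
  move=> ts cv; have [sq us] := unique_parent_truncation m.+1 ts.
  rewrite truncation_ball (branch_ball sq _ cv); apply/seteqP; split=> w; first by case.
  move=> bw; split=> //.
  have [d [dm /depthP[h _]]] := reach _ _ _ ts _ (branch_sub sq cv bw).
  exact: ball_le h.
pose X := top_struct B r; pose X' := top_struct B' r'.
pose I := top_index B r m; pose I' := top_index B' r' m.
have cnt s j : j <= n ->
   at_least j [set v | child B r r v /\ tree_type m k (branch B r v) v = s] <->
   at_least j [set v | child B' r' r' v /\ tree_type m k (branch B' r' v) v = s].
  move=> jn; have jk := leq_trans jn nk; have := types s; rewrite !ffunE => E.
  by rewrite (at_least_capped _ jk) E -(at_least_capped _ jk).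
apply: (@EF_recolor _ _ _ _ _ _ _ _ (@scol _ X) (@scol _ X')) => [x x' _ _ []//|].
have glue := @EF_glue (bool * bool) (option (Sigma m k)) (fun c => is_true (c.1 || c.2))
  n X X' I I' (@top_piece G B r m) (@top_piece G' B' r' m)
  (@pos0 I I') (fun _ _ => @pos0 X X').
apply: EF_sub (glue _ _ _ _ _) => //.
- by apply: glued_top => // v /(reach _ _ _ tt)[d [_ h]]; exists d.
- by apply: glued_top => // v /(reach _ _ _ tt')[d [_ h]]; exists d.
- have const (H : graph) (s : set H) q v : tree_like s q ->
      sdom (v : top_index s q m) ->
      (root_col q v = true /\ v = q) \/ (root_col q v = false /\ child s q q v).
    move=> ts [->|cv]; [left|right]; first by rewrite root_colT.
    by rewrite root_colF //; exact: child_ne_root cv.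
  move=> i i' hi hi' /=; rewrite /top_piece.
  case: (const _ _ _ _ tB hi) => -[-> ei]; case: (const _ _ _ _ tB' hi') => -[-> ei'] //.
    move=> _; apply: (@EF_iso _ n (piece (X := X) [set r])
      (piece (X := X') [set r']) (fun _ => r')) => //=.
    + move=> x ->; split=> //; rewrite !root_colT; congr (_, _).
      by rewrite !asboolF // => h; first [exact: (child_ne_root tB' h erefl)|exact: (child_ne_root tB h erefl)].
    + by move=> x' ->; exists r.
    + by move=> x y -> ->; split=> //; split=> /adj_irrefl.
  case=> /(IH _ _ _ _ _ _ (branch_tree tB.1 tB.2 ei) (branch_tree tB'.1 tB'.2 ei')).
  rewrite !br_trunc // => h; apply: EF_recolor h => x x' bx bx' /= e.
  (* Within the branch at [v] the only child of the root [q] is [v], so the pair of colours reduces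
     to [root_col v]. *)
  have bc (H : graph) (s : set H) q v w : tree_like s q -> child s q q v ->
      branch s q v w -> (root_col q w, `[< child s q q w >]) = (false, root_col v w).
    move=> ts cv bw; rewrite root_colF; last first.
      by move=> e'; move: bw; rewrite e'; apply: branch_not_root cv; exact: ts.1.
    congr (_, _); apply/asboolP/asboolP => [cw|->//].
    by apply: (branch_adj_root ts.1 cv bw); have [] := (child_rootP ts.1 w).1 cw.
  by rewrite !(bc _ _ _ _ _ tB ei bx, bc _ _ _ _ _ tB' ei' bx') e.
- have ca (H : graph) (s : set H) q : tree_like s q ->
      color_adjacent (fun c c' : option (Sigma m k) => isSome c != isSome c') (top_index s q m).
    move=> ts x y _ _ /=; split.
      move=> h; split; first by move=> e; move: h; rewrite e eqxx.
      by case: (root_col q x) (root_col q y) h => [] [].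
    by case=> _; case: (root_col q x) (root_col q y) => [] [].
  apply: (EF_counts (ca _ _ _ tB) (ca _ _ _ tB')) => -[s|] j jn /=.
    have E (H : graph) (u : set H) q : tree_like u q ->
        [set x | (x = q \/ child u q q x) /\
          (if root_col q x then None else Some (tree_type m k (branch u q x) x)) = Some s] =
        [set v | child u q q v /\ tree_type m k (branch u q v) v = s].
      move=> tu; apply/seteqP; split=> x /=.
        by case=> -[->|cx]; [rewrite root_colT|rewrite root_colF; [case|exact: child_ne_root cx]].
      case=> cx <-; split; first by right.
      by rewrite root_colF //; exact: child_ne_root cx.
    by rewrite !E //; exact: cnt.
  have E (H : graph) (u : set H) q : tree_like u q ->
      [set x | (x = q \/ child u q q x) /\
        (if root_col q x then None else Some (tree_type m k (branch u q x) x)) = None] =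
      [set q].
    move=> tu; apply/seteqP; split=> x /=.
      by case=> -[->//|cx]; rewrite root_colF //; exact: child_ne_root cx.
    by move=> ->; split; [left|rewrite root_colT].
  rewrite !E //; split; apply: (@at_least_inj _ _ j _ _ (fun _ => _)) => //= x y -> ->//.
Qed.

End TreeTypes.

(** * Edge counts, cycles and tree components *)

Section EdgeLists.
Context {V : eqType} (ad : V -> V -> Prop).

(** Each edge is listed once, oriented by the order of [s]; this turns [ecount] into the size of a
    duplicate-free list of unordered pairs. *)
Fixpoint elist (s : seq V) : seq (V * V) :=
  if s is x :: s' then [seq (x, y) | y <- s' & adb ad x y] ++ elist s' else [::].

Lemma size_elist s : size (elist s) = ecount ad s.
Proof. by elim: s => //= x s <-; rewrite size_cat size_map size_filter. Qed.

Lemma elistP s x y : uniq s -> (x, y) \in elist s ->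
  [/\ x \in s, y \in s, ad x y & index x s < index y s].
Proof.
elim: s => //= z s IH /andP[zs us]; rewrite mem_cat => /orP[/mapP[w]|/(IH us)].
  rewrite mem_filter => /andP[/asboolP zw ws] [-> ->].
  rewrite mem_head inE ws orbT eqxx; split=> //.
  by case: eqP => // e; move: zs; rewrite e ws.
move=> [xs ys xy lt]; rewrite !inE xs ys !orbT; split=> //.
have zx : (z == x) = false by apply/eqP => e; move: zs; rewrite e xs.
have zy : (z == y) = false by apply/eqP => e; move: zs; rewrite e ys.
by rewrite zx zy.
Qed.

Lemma uniq_map_elist (T : eqType) (g : V -> V -> T) s :
  (forall x y x' y', g x y = g x' y' -> x = x' /\ y = y' \/ x = y' /\ y = x') ->
  uniq s -> uniq [seq g p.1 p.2 | p <- elist s].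
Proof.
move=> gi us; rewrite map_inj_in_uniq.
  elim: s us => //= x s IH /andP[xs us]; rewrite cat_uniq IH // andbT.
  rewrite map_inj_uniq ?filter_uniq //=; last by move=> ? ? [].
  apply/hasPn => -[a b] /(elistP us)[a_s _ _ _]; apply/mapP => -[w _ [e _]].
  by move: xs; rewrite -e a_s.
move=> [x y] [x' y'] /(elistP us)[_ _ _ lt] /(elistP us)[_ _ _ lt'] /= /gi[[-> ->]//|[ex ey]].
by move: lt lt'; rewrite ex ey => lt /ltnW; rewrite leqNgt lt.
Qed.

End EdgeLists.

Lemma set2_inj (T : Type) (x y x' y' : T) : [set x; y] = [set x'; y'] ->
  x = x' /\ y = y' \/ x = y' /\ y = x'.
Proof.
move=> /seteqP[h1 h2].
have h3 : x = x' \/ x = y' := h1 x (or_introl erefl).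
have h4 : y = x' \/ y = y' := h1 y (or_intror erefl).
have h5 : x' = x \/ x' = y := h2 x' (or_introl erefl).
have h6 : y' = x \/ y' = y := h2 y' (or_intror erefl).
by case: h3 => e3; case: h4 => e4; case: h5 => e5; case: h6 => e6; subst; tauto.
Qed.

Lemma card_set_seq (T : eqType) (s : seq T) : uniq s -> [set` s] #= `I_(size s).
Proof.
move=> us; rewrite card_eq_le; apply/andP; split; last by apply/at_least_seqP; exists s.
case: s us => [|x0 s] us; first by rewrite set_nil card_ge0.
set t := x0 :: s in us *.
have -> : [set` t] = [set nth x0 t i | i in `I_(size t)].
  apply/seteqP; split=> x /=.
    by move=> xt; exists (index x t); [by move: xt; rewrite -index_mem|exact: nth_index].
  by case=> i /= it <-; exact: mem_nth.
exact: card_image_le.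
Qed.

Lemma sparse_NO (G : graph) : (forall l, 0 < l -> NO l G) ->
  sparse (@adj G : {classic G} -> {classic G} -> Prop).
Proof.
move=> no s us; rewrite leqNgt; apply/negP => lt.
have s0 : 0 < size s by case: (s) lt.
apply: (no _ s0); exists [set` s]; split.
  exact: (@card_set_seq {classic G} s us).
apply: (at_least_le lt); apply/at_leastP.
pose g (x y : {classic G}) : {classic (set G)} := [set x; y].
exists [seq g p.1 p.2 | p <- elist (@adj G : {classic G} -> _) s]; split.
- by apply: uniq_map_elist => // x y x' y' e; exact: set2_inj e.
- by rewrite size_map size_elist.
- move=> _ /mapP[[x y] /(elistP us)[xs ys xy _] ->].
  by exists x, y.
Qed.


Section Cycles.
Context {G : graph}.
Notation V := {classic G}.
Notation ad := (@adj G : V -> V -> Prop).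

Lemma closed_path_cycle (C : set G) (x : V) (p : seq V) i :
  uniq (x :: p) -> (forall y, y \in x :: p -> C y) -> path (adb ad) x p ->
  0 < i < size p -> adb ad x (nth x p i) -> ~ acyclic_on C.
Proof.
move=> up pC pp /andP[i0 ip] xi ac; apply: ac.
exists i.+2, (fun j : 'I_i.+2 => nth x (x :: p) j); split=> //.
- move=> j j' e; apply/val_inj/eqP => /=; rewrite -(nth_uniq x _ _ up).
  + by apply/eqP; exact: e.
  + by apply: leq_trans (ltn_ord j) _.
  + by apply: leq_trans (ltn_ord j') _.
- by move=> j; apply/pC/mem_nth/(leq_trans (ltn_ord j)).
move=> j; rewrite /ordS /=; have [ji|ij] := ltnP j i.+1.
  rewrite modn_small // ; apply/asboolP.
  by apply: (pathP x pp); apply: leq_trans ip.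
have -> : j = i.+1 :> nat by apply/eqP; rewrite eqn_leq ij -ltnS ltn_ord.
by rewrite modnn /=; apply: adj_sym; apply/asboolP.
Qed.

(** A path in [s] that cannot be prolonged beyond its end [x] contains all neighbours of [x]; one of
    them is not the vertex next to [x] on the path and closes a cycle of length at least 3. *)
Lemma min_degree_cycle (C : set G) (s : seq V) :
  0 < size s -> (forall x, x \in s -> C x) ->
  (forall x, x \in s -> 1 < count (adb ad x) s) -> uniq s -> ~ acyclic_on C.
Proof.
move=> s0 sC deg us ac.
have main x p : uniq (x :: p) -> {subset x :: p <= s} -> path (adb ad) x p ->
    exists y, [/\ adb ad x y, y \in s & y \notin x :: p].
  move=> up ps pp; apply: contrapT => h.
  have hp y : y \in s -> adb ad x y -> y \in p.
    move=> ys xy; have : y \in x :: p by apply/negPn/negP => yp; apply: h; exists y.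
    by rewrite inE => /orP[/eqP e|//]; move/asboolP: xy; rewrite e => /adj_irrefl.
  have := deg x (ps _ (mem_head _ _)); rewrite -size_filter.
  set l := [seq y <- s | _] => l1.
  have [y yl yp] : exists2 y, y \in l & y != nth x p 0.
    apply: contrapT => hn.
    have /(uniq_leq_size (filter_uniq _ us)) : {subset l <= [:: nth x p 0]}.
      move=> y yl; rewrite inE; apply/negPn/negP => yn; apply: hn; exists y => //.
    by rewrite leqNgt l1.
  move: yl; rewrite mem_filter => /andP[xy ys].
  have yp' := hp _ ys xy.
  apply: (@closed_path_cycle C x p (index y p)) ac => //.
  - by move=> z /ps/sC.
  - rewrite index_mem yp' andbT lt0n; apply/negP => /eqP e.
    by move: yp; rewrite -(nth_index x yp') e eqxx.
  - by rewrite nth_index.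
have ext m x p : size s - size (x :: p) <= m -> uniq (x :: p) ->
    {subset x :: p <= s} -> path (adb ad) x p -> False.
  elim: m x p => [|m IH] x p sm up ps pp; have [y [xy ys yp]] := main x p up ps pp.
    have u2 : uniq (y :: x :: p) by rewrite cons_uniq yp.
    have p2 : {subset y :: x :: p <= s} by move=> z; rewrite inE => /orP[/eqP->|/ps].
    by have := uniq_leq_size u2 p2; move: sm; rewrite /=; lia.
  apply: (IH y (x :: p)).
  - by move: sm; rewrite /=; lia.
  - by rewrite cons_uniq yp.
  - by move=> z; rewrite inE => /orP[/eqP->|/ps].
  - by rewrite /= pp andbT; apply/asboolP/adj_sym; exact/asboolP.
case: s s0 {us} sC deg main ext => // x s _ sC deg main ext.
apply: (ext (size s) x [::]) => //=; first by lia.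
by move=> z; rewrite inE => /eqP->; exact: mem_head.
Qed.

Lemma acyclic_not_dense (C : set G) (s : seq V) :
  acyclic_on C -> (forall x, x \in s -> C x) -> ~ dense ad s.
Proof.
move=> ac sC ds; have [t mt ts] := dense_min (ds : dense ad s) (leqnn _).
have [[ut t0 te] _ _] := mt; apply: (min_degree_cycle t0 _ _ ut ac).
  by move=> x /ts/sC.
by move=> x xt; apply: min_dense_deg mt xt; [exact: adj_sym|exact: adj_irrefl].
Qed.

Lemma component_closed (x a b : G) : component x a -> adj a b -> component x b.
Proof. by move=> [d h] ab; exists d.+1; exact: walkS h I ab. Qed.

Lemma component_root (x : G) : component x x.
Proof. by exists 0; exact: walk0. Qed.

Lemma component_eq (x a : G) : component x a -> component x = component a.
Proof.
have tr (u v w : G) : component u v -> component v w -> component u w.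
  move=> uv [d h]; elim: h uv => // e p q z _ IH _ qz uv.
  exact: component_closed (IH uv) qz.
have sy (u v : G) : component u v -> component v u.
  move=> [d h]; elim: h => [p _|e p q z _ IH _ qz]; first exact: component_root.
  apply: tr IH; exists 1; apply: walkS (walk0 (D := setT) I) I _.
  exact: adj_sym.
move=> xa; apply/seteqP; split=> y h; first exact: tr (sy _ _ xa) h.
exact: tr xa h.
Qed.

Lemma tree_component_tree_like (C : set G) y :
  tree_component C -> C y -> tree_like C y.
Proof.
move=> [_ [_ ac]] Cy; split=> // d.
apply: (@unique_parent_root V ad _ _ C y d Cy); [exact: adj_sym|exact: adj_irrefl|].
move=> s ds _ sC; apply: (acyclic_not_dense ac _ ds) => z /sC; exact: ball_dom.
Qed.

(** A minimal dense set with a vertex in a component lies in it entirely, which an acyclic component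
    does not allow. *)
Lemma tree_component_core (C : set G) L z :
  tree_component C -> core ad L z -> ~ C z.
Proof.
move=> [[x ->] [_ ac]] [s ms zs] Cz; have [ds _ _] := ms.
apply: (acyclic_not_dense ac _ ds) => y ys.
apply: (min_dense_closed _ ms _ zs Cz ys); first exact: adj_sym.
by move=> a b; exact: component_closed.
Qed.

(** For [d < r] the dense sets to be excluded for [unique_parent_root] have at most
    [2 * d + 4 <= 2 * r + 2 <= L] vertices, so each would contain a core vertex within distance [r]
    of [x]. *)
Lemma far_tree_like L r (x : G) : 2 * r + 2 <= L ->
  ~ ball (@adj G) setT (core ad L) r x ->
  tree_like (ball (@adj G) setT [set x] r) x.
Proof.
move=> rL far; set t := ball _ _ _ _.
have tx : t x by exact: ball_base.
split=> // d; have [rd|dr] := leqP r d.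
  move=> u v v' hu nu; case: nu; apply: ball_le rd _ _.
  by rewrite -(@ball_restrict _ (@adj G) setT) //; exact: ball_dom hu.
apply: (@unique_parent_root V ad _ _ t x d tx); [exact: adj_sym|exact: adj_irrefl|].
move=> s ds sd st; have sL : size s <= L by lia.
have [u mu us] := dense_min ds sL; have [[_ u0 _] _ _] := mu.
case: u u0 mu us => // z u _ mu us; apply: far.
have tz : t z by apply: (ball_dom (st _ (us _ (mem_head _ _)))).
apply: ball_sub (ball_sym _ tz); last exact: adj_sym.
by move=> _ ->; exists (z :: u) => //; exact: mem_head.
Qed.

End Cycles.

(** The cap [(n + q).+1] serves twice: among that many tree components one avoids the at most [q]
    vertices in [bs], and types with this cap decide games of [n.+1] rounds, one of which [EF_step]
    spends on the roots. *)
Lemma YES_far_answer (M N : graph) L r n q : 2 * r + 2 <= L ->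
  (forall s : Sigma r (n + q).+1, YES s N) ->
  @far_answer {classic M} {classic N} (@adj M) (@adj N)
    (core (@adj M : {classic M} -> _) L) (core (@adj N : {classic N} -> _) L) r n q.
Proof.
move=> rL yes x xfar bs bq; set k := (n + q).+1.
have tx : tree_like (ball (@adj M) setT [set x] r) x.
  by apply: far_tree_like rL _ => h; apply: xfar; apply: ball_le h; lia.
set t := ball _ _ _ _ in tx.
have /at_leastP[Cs [uCs sCs CsP]] := yes (tree_type r k t x).
have [C CCs Cbs] : exists2 C, C \in Cs & forall b, b \in bs -> ~ C b.
  apply: contrapT => h.
  pose comp (b : {classic N}) : {classic (set N)} := component b.
  have /(uniq_leq_size uCs) : {subset Cs <= [seq comp b | b <- bs]}.
    move=> C CCs; have [b bb Cb] : exists2 b, b \in bs & C b.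
      apply: contrapT => h2; apply: h; exists C => // b bb Cb; apply: h2; by exists b.
    apply/mapP; exists b => //; have [[[z e] _] _] := CsP _ CCs.
    by rewrite /comp e; apply: component_eq; rewrite -e.
  by rewrite sCs size_map leqNgt /k ltnS (leq_trans bq) // leq_addl.
have [tC [y Cy ty]] := CsP _ CCs.
have [[z Cz] _] := tC.
have Ccl a b : C a -> adj a b -> C b by rewrite Cz; exact: component_closed.
exists y, C; split=> //; first by move=> b; exact: tree_component_core.
have tl := tree_component_tree_like tC Cy.
have := @EF_tree_type n.+1 k _ r _ _ t C x y tx tl (esym ty).
rewrite /k ltnS leq_addr => /(_ isT).
have -> : truncation t x r = t.
  rewrite truncation_ball /t -(@ball_restrict _ (@adj M) setT) //.
have -> : truncation C y r = ball (@adj N) setT [set y] r.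
  rewrite truncation_ball [RHS](@ball_restrict _ (@adj N) setT C) //.
  elim: r {rL yes xfar tx t ty tC Cs uCs sCs CsP CCs Cbs k} => [|r' IH] a /=; first by case=> ->.
  by case=> [/IH//|[_ [w /IH Cw wa]]]; exact: Ccl wa.
move=> E; have H := @EF_step _ n (rooted t x)
  (rooted (ball (@adj N) setT [set y] r) y) (@pos0 _ _) x y E tx.1.
apply: (@EF_recolor _ _ _ _ _ _ _ _ (root_col x) (root_col y)) => //.
apply: EF_sub (H _) => [a b [-> ->]|]; first by right.
by move=> y' _ /=; rewrite root_colT => /esym/asboolP.
Qed.

(** * Transfer of first order sentences *)

Fixpoint rank n (F : formula n) : nat :=
  match F with
  | FEq _ _ _ => 0
  | FAdj _ _ _ => 0
  | FNot _ f => rank f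
  | FAnd _ f g => maxn (rank f) (rank g)
  | FOr _ f g => maxn (rank f) (rank g)
  | FImp _ f g => maxn (rank f) (rank g)
  | FForall _ f => (rank f).+1
  | FExists _ f => (rank f).+1
  end.

Definition plain (G : graph) : cstruct unit := CStruct setT (@adj G) (fun _ => tt).

Lemma EF_holds (M N : graph) n (F : formula n) m (P : plain M -> plain N -> Prop)
    (s : 'I_n -> M) (s' : 'I_n -> N) :
  rank F <= m -> EF m P -> (forall i, P (s i) (s' i)) -> holds F s <-> holds F s'.
Proof.
elim: F m P s s' => {n} [n i j|n i j|n f IH|n f IHf g IHg|n f IHf g IHg|n f IHf g IHg|n f IH|n f IH]
  m P s s' /=.
- by move=> _ /EF_piso pP sP; have [_ _ _ /(_ _ _ (sP j))[]] := pP _ _ (sP i).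
- by move=> _ /EF_piso pP sP; have [_ _ _ /(_ _ _ (sP j))[]] := pP _ _ (sP i).
- by move=> rm EP sP; have := IH _ _ _ _ rm EP sP; tauto.
- by rewrite geq_max => /andP[r1 r2] EP sP; have := IHf _ _ _ _ r1 EP sP; have := IHg _ _ _ _ r2 EP sP; tauto.
- by rewrite geq_max => /andP[r1 r2] EP sP; have := IHf _ _ _ _ r1 EP sP; have := IHg _ _ _ _ r2 EP sP; tauto.
- by rewrite geq_max => /andP[r1 r2] EP sP; have := IHf _ _ _ _ r1 EP sP; have := IHg _ _ _ _ r2 EP sP; tauto.
all: case: m => // m; rewrite ltnS => rm [pP [F B]] sP.
all: have sP' x x' i : pos_add P x x' (env_cons x s i) (env_cons x' s' i)
  by rewrite /env_cons; case: unliftP => [j _|_]; [left|right].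
- split=> h x.
    by have [y EP] := B x I; apply/(IH _ _ _ _ rm EP (sP' y x))/h.
  by have [y EP] := F x I; apply/(IH _ _ _ _ rm EP (sP' x y))/h.
- split=> -[x h].
    by have [y EP] := F x I; exists y; apply/(IH _ _ _ _ rm EP (sP' x y)).
  by have [y EP] := B x I; exists y; apply/(IH _ _ _ _ rm EP (sP' y x)).
Qed.

Lemma EF_satisfies (M N : graph) (F : sentence) m :
  rank F <= m -> EF m (@pos0 (plain M) (plain N)) -> satisfies F M <-> satisfies F N.
Proof. by move=> rm E; apply: (EF_holds rm E) => -[]. Qed.

Section DenseMap.
Context {V W : eqType} (ad : V -> V -> Prop) (ad' : W -> W -> Prop).
Context (J : seq V) (phi : V -> W).
Hypothesis phi_inj : {in J &, injective phi}.
Hypothesis phi_ad : forall x y, x \in J -> y \in J -> ad' (phi x) (phi y) <-> ad x y.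

Lemma ecount_map s : {subset s <= J} -> ecount ad' (map phi s) = ecount ad s.
Proof.
elim: s => //= x s IH sJ; rewrite IH; last by move=> z zs; apply: sJ; rewrite inE zs orbT.
congr (_ + _); rewrite count_map; apply: eq_in_count => z zs /=.
by apply/asboolP/asboolP => /phi_ad; apply; apply: sJ; rewrite inE ?eqxx ?zs ?orbT.
Qed.

Lemma dense_map s : {subset s <= J} -> dense ad' (map phi s) <-> dense ad s.
Proof.
move=> sJ; rewrite /dense ecount_map // size_map map_inj_in_uniq //.
by move=> x y /sJ xJ /sJ yJ; exact: phi_inj.
Qed.

Lemma map_preimage t : (forall y, y \in t -> exists2 x, x \in J & y = phi x) ->
  exists2 s, {subset s <= J} & t = map phi s.
Proof.
elim: t => [|y t IH] h; first by exists [::].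
have [s sJ ->] : exists2 s, {subset s <= J} & t = map phi s.
  by apply: IH => z zt; apply: h; rewrite inE zt orbT.
have [x xJ ->] := h y (mem_head _ _).
by exists (x :: s) => // z; rewrite inE => /orP[/eqP->|/sJ].
Qed.

Lemma min_dense_map L s : {subset s <= J} -> min_dense ad' L (map phi s) <-> min_dense ad L s.
Proof.
move=> sJ; split=> -[ds sL hm]; split.
- exact/dense_map.
- by rewrite size_map in sL.
- move=> t dt ts; have tJ : {subset t <= J} by move=> z /ts/sJ.
  have := hm (map phi t); rewrite !size_map; apply; first exact/dense_map.
  by move=> _ /mapP[z /ts zs ->]; exact: map_f.
- exact/dense_map.
- by rewrite size_map.
- move=> t dt ts.
  have [u uJ tu] : exists2 u, {subset u <= J} & t = map phi u.
    by apply: map_preimage => y /ts/mapP[x /sJ xJ ->]; exists x.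
  subst t; rewrite !size_map; apply: hm; first exact/dense_map.
  move=> z zu; have /mapP[x xs e] := ts _ (map_f phi zu).
  by rewrite (phi_inj (uJ _ zu) (sJ _ xs) e).
Qed.

End DenseMap.

(** The last clause makes the image a union of components. *)
Definition isolated_copy (G : graph) h (e : 'I_h -> 'I_h -> Prop) (psi : 'I_h -> G) :=
  [/\ injective psi, forall i j, adj (psi i) (psi j) <-> e i j &
      forall i y, adj (psi i) y -> exists j, y = psi j].

(** [L], [R] and [J] depend on [M] and [q] only. The description of the ball around the core of [N]
    is stated ahead of the clause on sentences because it is used separately, to show that the
    vertex set of the copy is determined by [N]. *)
Lemma model_transfer (M : graph) q : model theoryT M ->
  exists L R (J : seq {classic M}),
    ecount (@adj M : {classic M} -> _) J <= size J /\
    forall (N : graph) (y0 : N) (psi : 'I_(size J) -> N),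
      isolated_copy (fun i j => @adj M (tnth (in_tuple J) i) (tnth (in_tuple J) j)) psi ->
      (forall s : seq {classic N}, dense (@adj N : {classic N} -> _) s ->
         size s <= L -> exists2 x, x \in s & exists i, x = psi i) ->
      (forall y, ball (@adj N) setT (core (@adj N : {classic N} -> _) L) R y <->
         exists i, y = psi i) /\
      ((forall j, j < q -> forall s : Sigma (radius j) (rounds j + q).+1, YES s N) ->
      forall F : sentence, rank F <= q -> satisfies F M <-> satisfies F N).
Proof.
move=> MT.
have symM := @adj_sym M; have irrM := @adj_irrefl M.
have sp : sparse (@adj M : {classic M} -> _).
  by apply: sparse_NO => l l0; apply: MT; left; exists l.
have yesM j (s : Sigma (radius j) (rounds j + q).+1) : YES s M.
  by apply: MT; right; exists (radius j), (rounds j + q).+1, s.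
(* This [L] is what [far_tree_like] asks for at radius [radius q], hence at all smaller radii. *)
pose L := 2 * radius q + 2; pose R := radius q.
have rad_mono i j : i <= j -> radius i <= radius j.
  move=> /subnK <-; elim: (j - i) => // d IH; rewrite addSn.
  by apply: leq_trans IH _; rewrite -[radius _.+1]/(3 * radius (d + i) + 1); lia.
pose S := core (@adj M : {classic M} -> _) L.
pose c (x : {classic M}) : bool := `[< S x >].
have [J0 [JB Jc Jb JE]] := prune (ad := @adj M : {classic M} -> _) symM irrM sp (rounds q) L R c.
pose J := undup J0.
have eJ : J =i J0 by exact: mem_undup.
have setJ : [set` J0] = [set` J] by apply/seteqP; split=> x /=; rewrite eJ.
rewrite setJ in Jb JE.
exists L, R, J; split; first by apply: sp; exact: undup_uniq.
move=> N y0 psi [psi_inj psi_ad psi_cl] nodense.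
have symN := @adj_sym N; have irrN := @adj_irrefl N.
pose V := {classic M}; pose W := {classic N}.
pose adM : V -> V -> Prop := @adj M; pose adN : W -> W -> Prop := @adj N.
pose S' := core adN L.
(* The [i]-th vertex of [J] goes to [psi i]; outside [J] the value [y0] is a mere default. *)
pose phi (x : V) : W :=
  if pselect (index x J < size J) is left h then psi (Ordinal h) else y0.
have phiJ x : x \in J -> exists2 i, x = tnth (in_tuple J) i & phi x = psi i.
  move=> xJ; have lt : index x J < size J by rewrite index_mem.
  exists (Ordinal lt); first by rewrite (tnth_nth x) /= nth_index.
  by rewrite /phi; case: pselect => // h; congr psi; apply: val_inj.
have phi_inj : {in J &, injective phi}.
  move=> x y /phiJ[i -> ->] /phiJ[j -> ->] /psi_inj -> //.
have phi_ad x y : x \in J -> y \in J -> adN (phi x) (phi y) <-> adM x y.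
  by move=> /phiJ[i -> ->] /phiJ[j -> ->]; exact: psi_ad.
pose A : set W := [set y | exists i, y = psi i].
have AP y : A y -> exists2 x, x \in J & y = phi x.
  case=> i ->; exists (tnth (in_tuple J) i); first exact: mem_tnth.
  have [j e ->] := phiJ _ (mem_tnth i (in_tuple J)).
  have uJ : uniq (in_tuple J) by exact: undup_uniq.
  by have /tuple_uniqP tinj := uJ; rewrite (tinj _ _ e).
have PA x : x \in J -> A (phi x) by move=> /phiJ[i _ ->]; exists i.
have Acl y z : A y -> adN y z -> A z by case=> i ->; exact: psi_cl.
(* A short minimal dense set of [N] meets the copy by assumption and, the copy being closed under
   adjacency, lies inside it. *)
have S'A s : min_dense adN L s -> forall y, y \in s -> A y.
  move=> ms y ys; have [ds sL _] := ms.
  have [x xs xA] := nodense s ds sL.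
  exact: (@min_dense_closed W adN symN L s A x ms Acl xs xA y ys).
have core_phi x : x \in J -> S x <-> S' (phi x).
  move=> xJ; split.
    have xJ0 : x \in J0 by rewrite -eJ.
    move=> Sx; have [K [mK xK KJ]] := Jc x xJ0 Sx.
    have KJ' : {subset K <= J} by move=> z /KJ; rewrite eJ.
    exists (map phi K); last exact: map_f.
    exact/(min_dense_map phi_inj phi_ad L KJ').
  case=> t mt xt; have [K KJ tK] : exists2 K, {subset K <= J} & t = map phi K.
    by apply: map_preimage => y yt; apply: AP; exact: S'A mt y yt.
  subst t; exists K; first exact/(min_dense_map phi_inj phi_ad L KJ).
  by move/mapP: xt => [z zK e]; rewrite (phi_inj _ _ xJ (KJ _ zK) e).
(* The ball cannot leave the closed copy, and it fills the copy because every vertex of [J] is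
   reached from the core inside [J]. *)
have ballA : ball adN setT S' R = A.
  apply/seteqP; split.
    suff h r : ball adN setT S' r `<=` A by exact: h.
    elim: r => [|r IH] y /=; first by case=> -[s ms ys] _; exact: S'A ms y ys.
    by case=> [/IH//|[_ [z /IH Az zy]]]; exact: Acl Az zy.
  move=> y /AP[x xJ ->]; have := Jb x; rewrite -eJ => /(_ xJ).
  suff h r z : ball adM [set` J] S r z -> ball adN setT S' r (phi z) by exact: h.
  elim: r z => [|r IH] z /=; first by case=> Sz zJ; split=> //; exact/core_phi.
  case=> [/IH|[zJ [w wr wz]]]; first by left.
  right; split=> //; exists (phi w); first exact: IH.
  by apply/phi_ad => //; exact: ball_dom wr.
split; first by move=> y; rewrite -/adN -/S' ballA.
move=> yesN F rF; apply: (EF_satisfies rF).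
have E1 : @EF _ (rounds q) (ball_struct adM S [set` unzip1 ([::] : seq (V * W))] (radius q))
   (ball_struct adN S' [set` unzip2 ([::] : seq (V * W))] (radius q)) (@pos0 _ _).
  rewrite /ball_struct /= !set_nil !set0U -/R ballA.
  apply: EF_sub (EF_trans JE (@EF_iso _ _ (CStruct [set` J] adM c)
     (CStruct A adN (fun x => `[< S' x >])) phi _ _ _ (@pos0 _ _) _)) => //=.
  - move=> x xJ; split; first exact: PA.
    by apply/asboolP/asboolP => /core_phi; exact.
  - by move=> y /AP[x xJ ->]; exists x.
  - by move=> x y xJ yJ; split; [exact: phi_inj|split=> /phi_ad; exact].
have far j : j < q -> 2 * radius j + 2 <= L.
  by move=> jq; rewrite /L leq_add2r leq_mul2l /= rad_mono // ltnW.
apply: EF_sub (@EF_local V W adM adN S S' q symM symN _ _ q [::] _ (EF_sub _ E1)) => //.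
- by move=> j jq; apply: YES_far_answer (far j jq) (yesN j jq).
- by move=> j jq; apply: YES_far_answer (far j jq) (yesM j).
Qed.

(** * The edge measure *)

Section ProductMeasure.
Local Open Scope ring_scope.
Local Close Scope classical_set_scope.
Context {R : realType} {T : finType} (p : R).
Implicit Types (D E F : {set T}) (g : {set T} -> R) (B : pred {set T}).

(** The measure lives on the subsets of an arbitrary [D], so that part of the pairs can be split off
    by [Ex_split]. *)
Definition weight D E : R := \prod_(e in D) (if e \in E then p else 1 - p).

Definition Ex D g : R := \sum_(E : {set T} | E \subset D) weight D E * g E.

Definition Pr D B : R := Ex D (fun E => (B E)%:R).

Lemma Ex_split D1 D2 g : [disjoint D1 & D2] ->
  Ex (D1 :|: D2) g = Ex D1 (fun E1 => Ex D2 (fun E2 => g (E1 :|: E2)%SET)).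
Proof.
move=> dis; rewrite /Ex.
under [RHS]eq_bigr do rewrite big_distrr /=.
rewrite pair_big_dep /=.
have capU (E1 E2 : {set T}) : E1 \subset D1 -> E2 \subset D2 ->
    ((E1 :|: E2) :&: D1 = E1)%SET /\ ((E1 :|: E2) :&: D2 = E2)%SET.
  move=> s1 s2; rewrite !finset.setIUl (finset.setIidPl s1) (finset.setIidPl s2).
  have -> : (E2 :&: D1 = finset.set0)%SET.
    by apply/disjoint_setI0; rewrite disjoint_sym; apply: disjointWr s2 dis.
  have -> : (E1 :&: D2 = finset.set0)%SET.
    by apply/disjoint_setI0; apply: disjointWl s1 dis.
  by rewrite finset.setU0 finset.set0U.
rewrite (reindex_onto (fun q : {set T} * {set T} => (q.1 :|: q.2)%SET)
   (fun E => (E :&: D1, E :&: D2)%SET)) /=; last first.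
  by move=> E ED; rewrite -finset.setIUr; apply/finset.setIidPl.
apply: eq_big => [[E1 E2]|[E1 E2]] /=.
  apply/andP/andP => [[_ /eqP[<- <-]]|[s1 s2]].
    by rewrite !subsetIr.
  have [-> ->] := capU _ _ s1 s2; rewrite eqxx; split=> //.
  exact: finset.setUSS.
case/andP=> _ /eqP e; have [e1 e2] : ((E1 :|: E2) :&: D1 = E1)%SET /\ ((E1 :|: E2) :&: D2 = E2)%SET by case: e => -> ->.
rewrite mulrA; congr (_ * _); rewrite /weight.
rewrite (eq_bigl (fun x => x \in [predU D1 & D2])); last by move=> x; rewrite !inE.
rewrite bigU //=; congr (_ * _).
  by apply: eq_bigr => x xD; rewrite -{2}e1 finset.in_setI xD andbT.
by apply: eq_bigr => x xD; rewrite -{2}e2 finset.in_setI xD andbT.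
Qed.

Lemma eq_Ex D g g' : (forall E, E \subset D -> g E = g' E) -> Ex D g = Ex D g'.
Proof. by move=> h; apply: eq_bigr => E ED; rewrite h. Qed.

Lemma Ex_set0 g : Ex finset.set0 g = g finset.set0.
Proof.
rewrite /Ex (big_pred1 finset.set0) => [|E]; last by rewrite finset.subset0.
by rewrite /weight big_set0 mul1r.
Qed.

Lemma Ex_cst D a : Ex D (fun=> a) = a.
Proof.
elim: {D}#|D| {-2}D (erefl #|D|) => [|m IH] D.
  by move/eqP; rewrite finset.cards_eq0 => /eqP ->; exact: Ex_set0.
move=> sD; have /finset.set0Pn[x xD] : D != finset.set0.
  by rewrite -finset.card_gt0 sD.
rewrite -(finset.setD1K xD) Ex_split; last first.
  by rewrite finset.disjoints1 !inE eqxx.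
have sub1 (E : {set T}) : (E \subset [set x]%SET) = (E \in [set finset.set0; [set x]]%SET).
  by rewrite finset.subset1 !inE orbC.
rewrite {1}/Ex (eq_bigl _ _ sub1) big_setU1 ?big_set1 /=; last first.
  by rewrite !inE eq_sym; apply/finset.set0Pn; exists x; rewrite inE.
rewrite !IH; try by move: sD; rewrite (finset.cardsD1 x) xD => -[].
by rewrite /weight !big_set1 !inE eqxx; lra.
Qed.

Lemma ExD D g g' : Ex D (fun E => g E + g' E) = Ex D g + Ex D g'.
Proof. by rewrite -big_split; apply: eq_bigr => E _; rewrite /= mulrDr. Qed.

Lemma ExZ D a g : Ex D (fun E => a * g E) = a * Ex D g.
Proof. by rewrite /Ex big_distrr; apply: eq_bigr => E _; rewrite /= mulrCA. Qed.

Lemma Ex_sum D (I : finType) (P : pred I) (g : I -> {set T} -> R) :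
  Ex D (fun E => \sum_(i | P i) g i E) = \sum_(i | P i) Ex D (g i).
Proof.
rewrite exchange_big; apply: eq_bigr => E _; by rewrite big_distrr.
Qed.

Hypothesis p01 : 0 <= p <= 1.

Lemma weight_ge0 D E : 0 <= weight D E.
Proof. by apply: prodr_ge0 => e _; case: ifP => _; case/andP: p01 => *; lra. Qed.

Lemma le_Ex D g g' : (forall E, E \subset D -> g E <= g' E) -> Ex D g <= Ex D g'.
Proof. by move=> h; apply: ler_sum => E ED; rewrite ler_wpM2l ?weight_ge0 ?h. Qed.

Lemma Ex_ge0 D g : (forall E, E \subset D -> 0 <= g E) -> 0 <= Ex D g.
Proof. by move=> h; rewrite -(Ex_cst D 0); apply: le_Ex. Qed.

Lemma Ex_pick D F a g : F \subset D ->
  Ex D (fun E => (E == F)%:R * a) = p ^+ #|F| * (1 - p) ^+ (#|D| - #|F|) * a.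
Proof.
move=> FD; rewrite /Ex (bigD1 F) //= eqxx mul1r big1 ?addr0; last first.
  by move=> E /andP[_ /negbTE->]; rewrite mul0r mulr0.
congr (_ * _); rewrite /weight (big_setID F) /= (finset.setIidPr FD); congr (_ * _).
  by rewrite (eq_bigr (fun=> p)) ?prodr_const // => e ->.
rewrite (eq_bigr (fun=> 1 - p)); last by move=> e; rewrite inE => /andP[/negbTE-> _].
by rewrite prodr_const cardsD (finset.setIidPr FD).
Qed.

(** Independence of disjoint sets of pairs: the trace on [D1] is fixed to [F], and [g] sees only the
    rest. *)
Lemma Ex_restrict D D1 F g : D1 \subset D -> F \subset D1 ->
  Ex D (fun E => (E :&: D1 == F)%SET%:R * g (E :\: D1)%SET) =
  p ^+ #|F| * (1 - p) ^+ (#|D1| - #|F|) * Ex (D :\: D1)%SET g.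
Proof.
move=> DD FD; have {1}-> : D = (D1 :|: D :\: D1)%SET.
  by rewrite -{1}(finset.setIidPr DD) finset.setID.
have dis : [disjoint D1 & D :\: D1].
  by rewrite -finset.setI_eq0; apply/eqP/finset.setP => x; rewrite !inE; case: (x \in D1).
rewrite Ex_split // -(@Ex_pick D1 F _ g) //; apply: eq_Ex => E1 E1D.
rewrite -ExZ; apply: eq_Ex => E2 E2D.
have E20 : (E2 :&: D1 = finset.set0)%SET.
  apply/disjoint_setI0; rewrite disjoint_sym; apply: disjointWr E2D dis.
rewrite finset.setIUl E20 finset.setU0 (finset.setIidPl E1D) finset.setDUl.
have -> : (E1 :\: D1 = finset.set0)%SET by apply/eqP; rewrite finset.setD_eq0.
rewrite finset.set0U; suff -> : (E2 :\: D1 = E2)%SET by [].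
apply/finset.setDidPl; rewrite disjoint_sym; exact: disjointWr E2D dis.
Qed.

Definition decreasing B := forall E E', E' \subset E -> B E -> B E'.

(* A special case of Harris' inequality. *)
Lemma Pr_sub_decreasing D F B : F \subset D -> decreasing B ->
  Pr D (fun E => (F \subset E) && B E) <= p ^+ #|F| * Pr D B.
Proof.
move=> FD dB; have DE : D = (F :|: D :\: F)%SET.
  by rewrite -{1}(finset.setIidPr FD) finset.setID.
have dis : [disjoint F & D :\: F].
  by rewrite -finset.setI_eq0; apply/eqP/finset.setP => x; rewrite !inE; case: (x \in F).
rewrite /Pr DE !Ex_split //.
pose c := Ex (D :\: F)%SET (fun E2 => (B (F :|: E2)%SET)%:R).
have -> : Ex F (fun E1 => Ex (D :\: F)%SET (fun E2 => ((F \subset E1 :|: E2) && B (E1 :|: E2)%SET)%:R)) =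
    Ex F (fun E1 => (E1 == F)%:R * c).
  apply: eq_Ex => E1 E1F; rewrite -ExZ; apply: eq_Ex => E2 E2D.
  have [->|ne] := eqVneq E1 F; first by rewrite finset.subsetUl mul1r.
  rewrite mul0r; case: (boolP (F \subset _)) => //= /fintype.subsetP FE.
  case/eqP: ne; apply/eqP; rewrite finset.eqEsubset E1F; apply/fintype.subsetP => x xF.
  have := FE x xF; rewrite inE => /orP[//|/(fintype.subsetP E2D)].
  by rewrite inE xF.
rewrite Ex_pick // subnn expr0 mulr1 ler_wpM2l ?exprn_ge0 //; first by case/andP: p01.
rewrite -{1}(Ex_cst F c); apply: le_Ex => E1 E1F; apply: le_Ex => E2 E2D.
rewrite ler_nat; case: (boolP (B (F :|: E2)%SET)) => //= BF.
by rewrite (dB _ _ _ BF) // finset.setSU.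
Qed.

(** Avoiding the remaining sets is a decreasing event, so jointly with it [F] is contained with
    probability at most [p ^+ #|F|] times that of the event; each set thus costs one factor. *)
Lemma Pr_avoid D (Fs : seq {set T}) : (forall F, F \in Fs -> F \subset D) ->
  \prod_(F <- Fs) (1 - p ^+ #|F|) <= Pr D (fun E => all (fun F => ~~ (F \subset E)) Fs).
Proof.
elim: Fs => [|F Fs IH] FD; first by rewrite big_nil /Pr Ex_cst.
have FsD F' : F' \in Fs -> F' \subset D by move=> h; apply: FD; rewrite inE h orbT.
rewrite big_cons; set B := fun E : {set T} => all _ Fs in IH *.
have dB : decreasing B.
  move=> E E' EE' /allP h; apply/allP => F' /h; apply: contra => h'.
  exact: fintype.subset_trans h' EE'.
have h1 := Pr_sub_decreasing (FD F (mem_head _ _)) dB.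
have -> : Pr D (fun E => all (fun F => ~~ (F \subset E)) (F :: Fs)) =
    Pr D B - Pr D (fun E => (F \subset E) && B E).
  rewrite -[X in _ - X]mul1r -mulNr /Pr -ExZ -ExD; apply: eq_Ex => E _.
  by rewrite /= -/(B E); case: (F \subset E); case: (B E); rewrite /=; lra.
have h2 : 0 <= 1 - p ^+ #|F|.
  by rewrite subr_ge0; case/andP: p01 => p0 p1; exact: exprn_ile1.
have := ler_wpM2l h2 (IH FsD); lra.
Qed.

Lemma Pr_sub D F : F \subset D -> Pr D (fun E => F \subset E) = p ^+ #|F|.
Proof.
move=> FD; have DE : D = (F :|: D :\: F)%SET.
  by rewrite -{1}(finset.setIidPr FD) finset.setID.
have dis : [disjoint F & D :\: F].
  by rewrite -finset.setI_eq0; apply/eqP/finset.setP => x; rewrite !inE; case: (x \in F).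
rewrite /Pr DE Ex_split //.
rewrite (@eq_Ex _ _ (fun E1 => (E1 == F)%:R * 1)) => [|E1 E1F].
  by rewrite Ex_pick // subnn expr0 !mulr1.
rewrite mulr1 -[RHS](Ex_cst (D :\: F)%SET); apply: eq_Ex => E2 E2D.
congr (nat_of_bool _)%:R; apply/idP/eqP => [|->]; last exact: finset.subsetUl.
move/fintype.subsetP=> FE; apply/eqP; rewrite finset.eqEsubset E1F; apply/fintype.subsetP => x xF.
by have := FE x xF; rewrite inE => /orP[//|/(fintype.subsetP E2D)]; rewrite inE xF.
Qed.

Lemma le_Pr D B B' : (forall E, E \subset D -> B E -> B' E) -> Pr D B <= Pr D B'.
Proof.
move=> h; apply: le_Ex => E ED; rewrite ler_nat.
by case: (boolP (B E)) => // /(h _ ED) ->.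
Qed.

Lemma Pr_ge0 D B : 0 <= Pr D B.
Proof. by apply: Ex_ge0 => E _; exact: ler0n. Qed.

Lemma Pr_le1 D B : Pr D B <= 1.
Proof. by rewrite -(Ex_cst D 1); apply: le_Ex => E _; rewrite -[leRHS]/(1%:R) ler_nat leq_b1. Qed.

Lemma Pr_compl D B : Pr D (fun E => ~~ B E) = 1 - Pr D B.
Proof.
rewrite -{1}(Ex_cst D 1) -[X in _ - X]mul1r -mulNr /Pr -ExZ -ExD; apply: eq_Ex => E _.
by case: (B E); rewrite /=; lra.
Qed.

Lemma Pr_union D (I : finType) (P : pred I) (B : I -> pred {set T}) :
  Pr D (fun E => [exists i, P i && B i E]) <= \sum_(i | P i) Pr D (B i).
Proof.
rewrite /Pr -Ex_sum; apply: le_Ex => E _.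
case: existsP => [[i /andP[Pi Bi]]|_]; last by apply: sumr_ge0 => i _; exact: ler0n.
by rewrite (bigD1 i) //= Bi lerDl; apply: sumr_ge0 => j _; exact: ler0n.
Qed.

End ProductMeasure.

(** * Realization of tree types *)

Section Transport.
Context {G G' : graph} (phi : G -> G') (D : set G).
Hypothesis phi_inj : forall x y, D x -> D y -> phi x = phi y -> x = y.
Hypothesis phi_adj : forall x y, D x -> D y -> adj (phi x) (phi y) <-> adj x y.

Lemma ball_image t r d : t `<=` D -> t r ->
  ball (@adj G') (phi @` t) [set phi r] d = phi @` ball (@adj G) t [set r] d.
Proof.
move=> tD tr; elim: d => [|d IH] /=; apply/seteqP; split=> y /=.
- by move=> [-> _]; exists r.
- by case=> x [-> _] <-; split=> //; exists r.
- rewrite IH => -[[x hx <-]|[[x tx <-] [_ [z hz <-] zx]]].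
    by exists x => //; left.
  exists x => //; right; split=> //; exists z => //.
  by apply/phi_adj => //; apply: tD => //; exact: ball_dom hz.
- case=> x [hx|[tx [z hz zx]]] <-; first by left; rewrite IH; exists x.
  right; split; first by exists x.
  exists (phi z); first by rewrite IH; exists z.
  by apply/phi_adj => //; apply: tD => //; exact: ball_dom hz.
Qed.

Lemma image_mem (A : set G) x : A `<=` D -> D x -> (phi @` A) (phi x) <-> A x.
Proof.
move=> AD Dx; split=> [[y Ay /phi_inj <-//]|Ax]; first exact: AD.
by exists x.
Qed.

Lemma depth_image t r v d : t `<=` D -> t r -> t v ->
  depth (phi @` t) (phi r) (phi v) d <-> depth t r v d.
Proof.
move=> tD tr tv.
have E e : ball (@adj G') (phi @` t) [set phi r] e (phi v) <-> ball (@adj G) t [set r] e v.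
  rewrite ball_image //; apply: image_mem; last exact: tD.
  by move=> x h; apply: tD; exact: ball_dom h.
by split=> /depthP[h1 h2]; apply/depthP; split; try exact/E; move=> e ed /E; exact: h2.
Qed.

Lemma depth_dom (H : graph) (t : set H) r v d : depth t r v d -> t v.
Proof. by move=> /depthP[h _]; exact: ball_dom h. Qed.

Lemma child_image t r u v : t `<=` D -> t r -> t u -> t v ->
  child (phi @` t) (phi r) (phi u) (phi v) <-> child t r u v.
Proof.
move=> tD tr tu tv; split=> -[uv [d du dv]]; split.
- by apply/phi_adj => //; exact: tD.
- by exists d; apply/(depth_image _ tD tr).
- by apply/phi_adj => //; exact: tD.
- by exists d; apply/(depth_image _ tD tr).
Qed.

Lemma child_dom (H : graph) (t : set H) r u v : child t r u v -> t u /\ t v.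
Proof. by move=> [_ [d /depth_dom ? /depth_dom]]. Qed.

Lemma branch_image t r v : t `<=` D -> t r -> t v ->
  branch (phi @` t) (phi r) (phi v) = phi @` branch t r v /\ branch t r v `<=` t.
Proof.
move=> tD tr tv.
have bt : branch t r v `<=` t.
  move=> w h; have := Operators_Properties.clos_rt_rtn1 _ _ _ _ h.
  by case=> // y z c _; have [] := child_dom c.
split=> //; apply/seteqP; split=> [y h|_ [w h <-]].
  have := Operators_Properties.clos_rt_rtn1 _ _ _ _ h.
  elim=> [|y' z c _ [w hw e]]; first by exists v => //; exact: rt_refl.
  have [_ [x tx xz]] := child_dom c; subst y' z.
  have tw := bt _ hw; exists x => //; apply: rt_trans hw (rt_step _ _ _ _ _).
  exact/(child_image tD tr tw tx).
have := Operators_Properties.clos_rt_rtn1 _ _ _ _ h.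
elim=> [|y z c _ h']; first exact: rt_refl.
apply: rt_trans h' (rt_step _ _ _ _ _).
have [ty tz] := child_dom c; exact/(child_image tD tr).
Qed.

Lemma capped_card_image k (A : set G) : A `<=` D ->
  capped_card k (phi @` A) = capped_card k A.
Proof.
move=> AD; apply/val_inj/eqP; rewrite eqn_leq; apply/andP; split.
  apply/(at_least_capped _ (leq_ord _)); have [h _] := capped_cardP k (phi @` A).
  apply: card_le_trans h _; exact: card_image_le.
apply/(at_least_capped _ (leq_ord _)); have [h _] := capped_cardP k A.
apply: (at_least_inj (f := phi)) h => [x Ax|x y /AD Dx /AD Dy]; first by exists x.
exact: phi_inj.
Qed.

Lemma tree_type_image m k t r : t `<=` D -> t r ->
  tree_type m k (phi @` t) (phi r) = tree_type m k t r.
Proof.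
elim: m t r => //= m IH t r tD tr; apply/ffunP => s; rewrite !ffunE.
have trunc : truncation (phi @` t) (phi r) m.+1 = phi @` truncation t r m.+1.
  by rewrite !truncation_ball ball_image.
rewrite trunc; set B := truncation t r m.+1.
have Bt : B `<=` t by rewrite /B truncation_ball => x; exact: ball_dom.
have BD : B `<=` D by move=> x /Bt; exact: tD.
have Br : B r by rewrite /B truncation_ball; exact: ball_base.
rewrite -capped_card_image; last by move=> v [c _]; apply: BD; have [] := child_dom c.
congr capped_card; apply/seteqP; split=> y /=.
  case=> c; have [_ [v Bv vy]] := child_dom c; subst y.
  have [-> bB] := branch_image BD Br Bv.
  rewrite IH; [|by move=> x /bB/BD|exact: rt_refl].
  by move=> ty; exists v => //; split=> //; exact/(child_image BD Br).
case=> v [c tv] <-; have [_ Bv] := child_dom c.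
split; first exact/(child_image BD Br).
have [-> bB] := branch_image BD Br Bv.
by rewrite IH //; [move=> x /bB/BD|exact: rt_refl].
Qed.

Lemma walk_image t d x y : t `<=` D -> walk t d x y -> walk (phi @` t) d (phi x) (phi y).
Proof.
move=> tD; have wt e a b : walk t e a b -> t b by case.
elim=> [a ta|e a b z h IH tz bz]; first by apply: walk0; exists a.
by apply: walkS IH _ _; [exists z|apply/phi_adj => //; apply: tD => //; exact: wt h].
Qed.

Lemma is_tree_image t : t `<=` D -> is_tree t -> is_tree (phi @` t).
Proof.
move=> tD [[[x tx] conn] ac]; split.
  split; first by exists (phi x), x.
  move=> _ _ [a ta <-] [b tb <-]; have [d h] := conn a b ta tb.
  by exists d; exact: walk_image.
case=> n [z [n2 zi zt za]]; apply: ac.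
have pre i : exists2 a, t a & phi a = z i by exact: zt.
pose y i := s2val (cid2 (pre i)).
have yP i : t (y i) /\ phi (y i) = z i by rewrite /y; case: cid2.
exists n, y; split=> //.
- by move=> i j e; apply: zi; rewrite -(yP i).2 -(yP j).2 e.
- by move=> i; case: (yP i).
- move=> i; apply/phi_adj; [by apply: tD; case: (yP i)|by apply: tD; case: (yP (ordS i))|].
  by rewrite (yP i).2 (yP (ordS i)).2.
Qed.

End Transport.

Lemma connected_from (G : graph) (t : set G) (r : G) : t r ->
  (forall x, t x -> exists d, walk t d r x) -> connected_on t.
Proof.
move=> tr h; split; first by exists r.
have tr' x y z : (exists d, walk t d x y) -> (exists d, walk t d y z) ->
    exists d, walk t d x z.
  move=> xy [d w]; elim: w xy => // e a b c _ IH tc bc /IH[d' w].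
  by exists d'.+1; exact: walkS w tc bc.
have sy x y : (exists d, walk t d x y) -> exists d, walk t d y x.
  case=> d w; elim: w => [a ta|e a b c w IH tc bc]; first by exists 0; exact: walk0.
  have tb : t b by case: w.
  apply: tr' IH; exists 1; apply: walkS (walk0 tc) tb _; exact: adj_sym.
by move=> x y /h rx /h ry; apply: tr' ry; exact: sy.
Qed.

(* The tree of words: the parent of [a :: u] is [u]. *)
Definition word_adj (u v : seq nat) : Prop := exists a, v = a :: u \/ u = a :: v.

Lemma word_adj_sym u v : word_adj u v -> word_adj v u.
Proof. by case=> a [->|->]; exists a; [right|left]. Qed.

Lemma word_adj_irrefl u : ~ word_adj u u.
Proof. by case=> a [] /(congr1 size) /=; lia. Qed.

Definition word_tree : graph := Graph word_adj_sym word_adj_irrefl.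

Section Words.
Variable t : set word_tree.
Hypothesis t_nil : t [::].
Hypothesis t_suffix : forall a u, t (a :: u) -> t u.

Lemma word_ball d (w : seq nat) :
  ball (@adj word_tree) t [set [::]] d w <-> t w /\ size w <= d.
Proof.
elim: d w => [|d IH] w /=.
  split=> [[-> _]//|[tw]]; by rewrite leqn0 => /eqP/size0nil ->; split.
split=> [[/IH[tw sw]|[tw [u /IH[tu su] uw]]]|[tw sw]].
- by split=> //; exact: ltnW.
- by split=> //; case: uw => a [e|e]; move: su; rewrite e /=; lia.
case: w tw sw => [|a u] tw sw; first by left; apply/IH.
right; split=> //; exists u; last by exists a; left.
by apply/IH; split=> //; exact: t_suffix tw.
Qed.

Lemma word_depth (w : word_tree) d : depth t [::] w d <-> t w /\ d = size (w : seq nat).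
Proof.
split=> [/depthP[/word_ball[tw sw] h]|[tw ->]].
  split=> //; apply/eqP; rewrite eqn_leq sw andbT leqNgt; apply/negP => lt.
  by apply: (h _ lt); apply/word_ball.
apply/depthP; split; first exact/word_ball.
by move=> e ew /word_ball[_]; rewrite leqNgt ew.
Qed.

Lemma word_child (u v : word_tree) : child t [::] u v <->
  t v /\ exists a, (v : seq nat) = a :: u.
Proof.
split=> [[[a [->|e]] [d /word_depth[tu du] /word_depth[tv dv]]]|[tv [a e]]].
- by split=> //; exists a.
- by exfalso; move: du dv; rewrite e /=; lia.
have tu : t u by move: tv; rewrite e; exact: t_suffix.
split; first by exists a; left.
by exists (size (u : seq nat)); apply/word_depth; split=> //; rewrite e.
Qed.

Lemma word_branch (v : word_tree) : t v -> branch t [::] v =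
  [set w : word_tree | t w /\ exists u : seq nat, (w : seq nat) = u ++ v].
Proof.
move=> tv; apply/seteqP; split=> w.
  move=> h; have := Operators_Properties.clos_rt_rtn1 _ _ _ _ h.
  elim=> [|y z /word_child[tz [a e]] _ [ty [u yu]]]; first by split=> //; exists [::].
  by split=> //; exists (a :: u); rewrite e yu.
case=> tw [u e]; rewrite e in tw *; elim: u tw {e} => [|a u IH] tw /=; first exact: rt_refl.
apply: rt_trans (IH _) (rt_step _ _ _ _ _); first exact: t_suffix tw.
by apply/word_child; split=> //; exists a.
Qed.

(** A longest word on a cycle can be adjacent only to its parent there, so its two neighbours on the
    cycle would coincide. *)
Lemma word_is_tree : (exists m, forall w : seq nat, t w -> size w <= m) -> is_tree t.
Proof.
move=> [m tm]; split.
  apply: (connected_from (r := [::] : word_tree)) => // w tw.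
  have /ball_walk[e _ h] := (word_ball (size (w : seq nat)) w).2 (conj tw (leqnn _)).
  by exists e.
move=> [n [z [n2 zi zt za]]].
case: n n2 z zi zt za => // n n2 z zi zt za.
pose sz i := size (z i : seq nat).
have [i0 imax] : exists i0, forall i, sz i <= sz i0.
  by exists [arg max_(i > ord0) sz i]; case: arg_maxnP => // i _ h j; exact: h.
have parent i : word_adj (z i0) (z i) -> z i = behead (z i0 : seq nat).
  case=> a [e|->] //; have := imax i; rewrite /sz e /=; lia.
have [j ji] : exists j, ordS j = i0.
  by have [f fK Kf] := ordS_bij n.+1; exists (f i0).
have e1 := parent _ (za i0).
have e2 : z j = behead (z i0 : seq nat).
  by apply/parent/word_adj_sym; rewrite -ji; exact: za.
(* [z] takes the same value at [j] and [ordS (ordS j)]; in a cycle of length at least 3 these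
   indices differ. *)
have := zi _ _ (etrans e2 (esym e1)); rewrite -ji => ejs.
have /(congr1 val) /= := ejs.
have jn := ltn_ord j.
have [l1|l1] := ltnP j.+1 n.+1; last first.
  have -> : (j : nat) = n by lia.
  rewrite modnn modn_small //; lia.
rewrite (modn_small l1); have [l2|l2] := ltnP j.+2 n.+1.
  by rewrite modn_small //; lia.
have -> : j.+2 = n.+1 by lia.
by rewrite modnn; lia.
Qed.

End Words.

(** Join [s t] copies of a realization of each type [t] to a root. Words grow at the front, so the
    last letter names the child of the root; there the [i]-th copy for type [t] carries the code of
    the pair of [t] and [i]. *)
Lemma type_realization m k (s : Sigma m k) : exists J : seq (seq nat),
  [/\ uniq J, [::] \in J, forall a u, a :: u \in J -> u \in J,
      forall w, w \in J -> size w <= m &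
      tree_type m k ([set` J] : set word_tree) [::] = s].
Proof.
elim: m s => [|m IH] s.
  exists [:: [::]]; split=> //; last by case: s.
  by move=> w; rewrite inE => /eqP->.
pose Jt t := sval (cid (IH t)).
have JtP t := svalP (cid (IH t)); rewrite -/(Jt _) in JtP.
pose code (t : Sigma m k) (i : nat) : nat := pickle (t, i).
have code_inj t i t' i' : code t i = code t' i' -> t = t' /\ i = i'.
  by rewrite /code => /(pcan_inj pickleK) [-> ->].
pose J := [::] :: flatten [seq flatten [seq [seq rcons w (code t i) | w <- Jt t]
   | i <- iota 0 (s t)] | t <- enum (Sigma m k)].
have JP w : w \in J <-> w = [::] \/ exists t i u,
    [/\ i < s t, u \in Jt t & w = rcons u (code t i)].
  rewrite inE; split.
    case/orP=> [/eqP|/flatten_mapP[t _ /flatten_mapP[i]]]; first by left.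
    rewrite mem_iota add0n /= => is_ /mapP[u uJ ->].
    by right; exists t, i, u.
  case=> [->|[t [i [u [is_ uJ ->]]]]]; first by rewrite eqxx.
  apply/orP; right; apply/flatten_mapP; exists t; first by rewrite mem_enum.
  apply/flatten_mapP; exists i; first by rewrite mem_iota add0n.
  exact: map_f.
have J_nil : [::] \in J by apply/JP; left.
have J_suf a u : a :: u \in J -> u \in J.
  move/JP=> [//|[t [i [[|b v] [is_ vJ /=]]]]].
    by case=> _ ->; exact: J_nil.
  case=> ea ->; apply/JP; right; exists t, i, v; split=> //.
  by have [_ _ h _ _] := JtP t; exact: h vJ.
have J_size w : w \in J -> size w <= m.+1.
  move/JP=> [->//|[t [i [u [is_ uJ ->]]]]]; rewrite size_rcons ltnS.
  by have [_ _ _ h _] := JtP t; exact: h.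
exists (undup J); split.
- exact: undup_uniq.
- by rewrite mem_undup.
- by move=> a u; rewrite !mem_undup; exact: J_suf.
- by move=> w; rewrite mem_undup; exact: J_size.
have mu (w : seq nat) : (w \in undup J) = (w \in J) := mem_undup J w.
pose t : set word_tree := [set` J].
have -> : ([set` undup J] : set word_tree) = t := funext (fun w => congr1 is_true (mu w)).
rewrite /=; apply/ffunP => q; rewrite ffunE.
have -> : truncation t ([::] : word_tree) m.+1 = t.
  rewrite truncation_ball; apply/seteqP; split=> w; first exact: ball_dom.
  by move=> tw; apply/(word_ball J_nil J_suf); split=> //; exact: J_size.
have br u i : i < s u -> branch t ([::] : word_tree) [:: code u i] =
    (rcons^~ (code u i) : word_tree -> word_tree) @` [set` Jt u].
  move=> is_; have [_ nJ _ _ _] := JtP u.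
  have tc : t [:: code u i] by apply/JP; right; exists u, i, [::].
  rewrite (word_branch J_nil J_suf) //; apply/seteqP; split=> w /=.
    case=> /JP[->|[u' [i' [v [is' vJ ->]]]]] [x].
      by case: x.
    rewrite cats1 => /rcons_inj[_ /code_inj[eu ei]]; subst.
    by exists v.
  case=> v vJ <-; split; last by exists v; rewrite cats1.
  by apply/JP; right; exists u, i, v.
have ty u i : i < s u -> tree_type m k (branch t ([::] : word_tree) [:: code u i])
    ([:: code u i] : word_tree) = u.
  move=> is_; rewrite br //; have [_ nJ _ _ tu] := JtP u; rewrite -[RHS]tu.
  apply: (@tree_type_image word_tree word_tree _ setT _ _ m k [set` Jt u] [::]) => //.
    by move=> x y _ _ /rcons_inj[].
  move=> x y _ _; split=> -[a [e|e]]; exists a.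
  - by left; move: e; rewrite -rcons_cons => /rcons_inj[].
  - by right; move: e; rewrite -rcons_cons => /rcons_inj[].
  - by left; rewrite e.
  - by right; rewrite e.
have -> : [set v : word_tree | child t ([::] : word_tree) [::] v /\
     tree_type m k (branch t ([::] : word_tree) v) v = q] =
   (fun i => [:: code q i] : word_tree) @` `I_(s q).
  apply/seteqP; split=> v /=.
    case=> /(word_child J_nil J_suf)[tv [a e]]; move: tv; rewrite e => /JP[//|].
    case=> u [i [[|b w] [is_ wJ /= []]]]; last by case: w {wJ}.
    move=> -> {a e}; rewrite ty // => <-; by exists i.
  case=> i is_ <-; split; last exact: ty.
  apply/(word_child J_nil J_suf); split; last by exists (code q i).
  apply/JP; right; exists q, i, [::]; split=> //.
  by have [] := JtP q.
apply/val_inj/eqP; rewrite eqn_leq; apply/andP; split.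
  have [h _] := capped_cardP k ((fun i => [:: code q i] : word_tree) @` `I_(s q)).
  have := card_le_trans h (card_image_le _ _); by rewrite card_le_II.
apply/(at_least_capped _ (leq_ord _)).
apply: (at_least_inj (f := fun i => [:: code q i] : word_tree) (A := `I_(s q))).
- by move=> i is_; exists i.
- by move=> i j _ _ [] /(pcan_inj pickleK)[].
- exact: card_lexx.
Qed.

(** * Isolated copies of a template *)

Section Copies.
Local Close Scope classical_set_scope.
Variables (h : nat) (e : rel 'I_h).
Hypothesis e_sym : symmetric e.
Hypothesis e_irr : irreflexive e.
Variables (n : nat) (x0 : 'I_n).
Implicit Types (A : {set 'I_n}) (E : {set {set 'I_n}}).

Definition template : {set {set 'I_h}} :=
  [set [set ij.1; ij.2]%SET | ij in [set ij : 'I_h * 'I_h | e ij.1 ij.2]%SET]%SET.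

(** The labelling is fixed by the order of [enum A]. One labelled copy per vertex set loses only a
    constant factor, and vertex sets can index the events; [x0] is the default of [nth]. *)
Definition embed A (i : 'I_h) : 'I_n := nth x0 (enum A) i.

Definition copy A : {set {set 'I_n}} := [set (embed A @: f)%SET | f : {set 'I_h} in template]%SET.

Definition meeting A : {set {set 'I_n}} := [set f in pairs n | (f :&: A)%SET != finset.set0]%SET.

(** Fixes the state of exactly the pairs that meet [A]: the copy is induced and isolated, and the
    event is independent of all other pairs. *)
Definition is_copy A E : bool := (E :&: meeting A == copy A)%SET.

Lemma finset2_inj (T : finType) (x y x' y' : T) : [set x; y]%SET = [set x'; y']%SET ->
  x = x' /\ y = y' \/ x = y' /\ y = x'.
Proof.
move=> /finset.setP s; have := s x; have := s y; have := s x'; have := s y'.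
rewrite !inE !eqxx !orbT /= => /orP h1 /orP h2 /esym/orP h3 /esym/orP h4.
by case: h1 => /eqP h1; case: h2 => /eqP h2; case: h3 => /eqP h3; case: h4 => /eqP h4;
  subst; tauto.
Qed.

Lemma mem_template i j : ([set i; j]%SET \in template) = e i j.
Proof.
apply/imsetP/idP => [[[i' j']]|eij]; last by exists (i, j) => //; rewrite inE.
by rewrite inE /= => eij /finset2_inj[] [-> ->] //; rewrite e_sym.
Qed.

Variables (A : {set 'I_n}) (hA : #|A| = h).

Lemma embed_inj : injective (embed A).
Proof.
move=> i j; rewrite /embed => /eqP; rewrite nth_uniq ?enum_uniq -?cardE ?hA //.
by move=> /eqP/val_inj.
Qed.

Lemma embed_in i : embed A i \in A.
Proof. by rewrite -mem_enum mem_nth // -cardE hA. Qed.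

Lemma embed_surj x : x \in A -> exists i, x = embed A i.
Proof.
rewrite -mem_enum => xA; have lt : index x (enum A) < h by rewrite -hA cardE index_mem.
by exists (Ordinal lt); rewrite /embed /= nth_index.
Qed.

Lemma imset_embed i j : (embed A @: [set i; j] = [set embed A i; embed A j])%SET.
Proof. by rewrite imsetU1 imset_set1. Qed.

Lemma mem_copy i j : ([set embed A i; embed A j]%SET \in copy A) = e i j.
Proof. by rewrite -imset_embed mem_imset ?mem_template //; exact/imset_inj/embed_inj. Qed.

Lemma card_copy : #|copy A| = #|template|.
Proof. by rewrite card_imset //; exact/imset_inj/embed_inj. Qed.

Lemma templateP f : f \in template -> exists i j, f = [set i; j]%SET /\ e i j.
Proof. by case/imsetP => -[i j]; rewrite inE => eij ->; exists i, j. Qed.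

Lemma copyP f : f \in copy A -> exists i j, f = [set embed A i; embed A j]%SET /\ e i j.
Proof.
by case/imsetP => g /templateP[i [j [-> eij]]] ->; exists i, j; rewrite imset_embed.
Qed.

Lemma copy_sub_meeting : copy A \subset meeting A.
Proof.
apply/fintype.subsetP => f /copyP[i [j [-> eij]]]; rewrite !inE cards2.
have -> : embed A i != embed A j.
  by apply/eqP => /embed_inj ij; move: eij; rewrite ij e_irr.
by apply/finset.set0Pn; exists (embed A i); rewrite !inE eqxx embed_in.
Qed.

Lemma copy_sub f : f \in copy A -> f \subset A.
Proof.
by move=> /copyP[i [j [-> _]]]; apply/fintype.subsetP => x; rewrite !inE => /orP[] /eqP ->;
  exact: embed_in.
Qed.

Lemma meeting_sub : meeting A \subset pairs n.
Proof. by apply/fintype.subsetP => f; rewrite inE => /andP[]. Qed.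

Lemma mem_meeting x y : ([set x; y]%SET \in meeting A) = (x != y) && ((x \in A) || (y \in A)).
Proof.
rewrite !inE cards2; case: (x != y) => //=; apply/finset.set0Pn/orP.
  by case=> z; rewrite !inE => /andP[/orP[] /eqP-> ?]; [left|right].
by case=> zA; [exists x|exists y]; rewrite !inE zA eqxx ?orbT.
Qed.

Lemma card_meeting : #|meeting A| <= h * n.
Proof.
rewrite -hA -[X in _ * X]card_ord -finset.cardsT -finset.cardsX.
have /subset_leq_card/leq_trans : meeting A \subset
    [set [set q.1; q.2]%SET | q in finset.setX A [set: 'I_n]%SET]%SET.
  apply/fintype.subsetP => f; rewrite !inE => /andP[/cards2P[x [y [xy ->]]]].
  case/finset.set0Pn => z; rewrite !inE => /andP[/orP[] /eqP-> zA].
    by apply/imsetP; exists (x, y); rewrite // finset.in_setX zA finset.in_setT.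
  apply/imsetP; exists (y, x); first by rewrite finset.in_setX zA finset.in_setT.
  exact: finset.setUC.
by apply; exact: leq_imset_card.
Qed.

Lemma is_copy_isolated E : is_copy A E ->
  @isolated_copy (graph_of_edges E) h (fun i j => e i j) (embed A).
Proof.
move=> /eqP cE.
have memE x y : x != y -> (x \in A) || (y \in A) ->
    ([set x; y]%SET \in E) = ([set x; y]%SET \in copy A).
  by move=> xy xyA; rewrite -cE finset.in_setI mem_meeting xy xyA !andbT.
split; first exact: embed_inj.
  move=> i j; rewrite /= /edge_adj; split.
    by case=> ij; rewrite memE ?embed_in // mem_copy.
  move=> eij; have ij : embed A i != embed A j.
    by apply/eqP => /embed_inj ij; move: eij; rewrite ij e_irr.
  by split=> //; rewrite memE ?embed_in // mem_copy.
move=> i y [iy]; rewrite memE ?embed_in // => /copyP[a [b [/finset2_inj[] [_ ->] _]]].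
  by exists b.
by exists a.
Qed.

End Copies.

(** A pair meeting two disjoint sets has one end in each. *)
Lemma card_meeting2 n (A A' : {set 'I_n}) : [disjoint A & A']%bool ->
  #|meeting A :&: meeting A'|%SET <= #|A| * #|A'|.
Proof.
move=> dis; rewrite -finset.cardsX.
have /subset_leq_card/leq_trans : (meeting A :&: meeting A')%SET \subset
    [set [set q.1; q.2]%SET | q in finset.setX A A']%SET.
  apply/fintype.subsetP => f; rewrite !inE => /andP[/andP[/cards2P[x [y [xy ->]]]]].
  case/finset.set0Pn => z; rewrite !inE => /andP[zxy zA] /andP[_].
  case/finset.set0Pn => z'; rewrite !inE => /andP[zxy' zA'].
  have zz' : z != z'.
    by apply/eqP => e; move: zA; rewrite e => zA; rewrite (disjointFr dis zA) in zA'.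
  apply/imsetP; exists (z, z'); first by rewrite finset.in_setX zA.
  apply/finset.setP => w; rewrite !inE.
  by case/orP: zxy zz' => /eqP ->; case/orP: zxy' => /eqP ->; rewrite ?eqxx // orbC.
by apply; exact: leq_imset_card.
Qed.

(** * Elementary inequalities and counting bounds *)

Section Estimates.
Local Open Scope ring_scope.
Local Close Scope classical_set_scope.
Context {R : realType}.
Implicit Types (p x : R).

Lemma GnpE n p (A : property) :
  Gnp n p A = Pr p (pairs n) (fun E => `[< A (graph_of_edges E) >]).
Proof.
rewrite /Gnp /Pr /Ex big_mkcondr; apply: eq_bigr => E _.
by case: asboolP => _; rewrite ?mulr1 ?mulr0.
Qed.

(** Taking reciprocals, 1/(1-x) is at most 1+2x, as x is at most 1/2, and 1+2x is at most
    [expR (2 * x)]. *)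
Lemma expR_le_onem x : 0 <= x <= 2^-1 -> expR (- 2 * x) <= 1 - x.
Proof.
move=> /andP[x0 x1]; rewrite mulNr expRN -[leRHS]invrK lef_pV2 ?posrE ?expR_gt0 //; last first.
  by rewrite invr_gt0; lra.
apply: le_trans (expR_ge1Dx _); rewrite -[leLHS]mul1r ler_pdivrMr; last by lra.
nra.
Qed.

Lemma bernoulli_ineq p N : 0 <= p <= 1 -> 1 - N%:R * p <= (1 - p) ^+ N.
Proof.
move=> /andP[p0 p1]; elim: N => [|N IH]; first by rewrite mul0r subr0 expr0.
rewrite exprS -natr1.
have h : (1 - p) * (1 - N%:R * p) <= (1 - p) * (1 - p) ^+ N.
  by rewrite ler_wpM2l // subr_ge0.
apply: le_trans h; have : 0 <= N%:R :> R by exact: ler0n.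
move: (N%:R) => y y0; nra.
Qed.

Lemma ffact_le_expn n k : (n ^_ k <= n ^ k)%N.
Proof.
have -> : (n ^ k = \prod_(i < k) n)%N by rewrite prod_nat_const card_ord.
rewrite ffact_prod; by apply: leq_prod => i _; exact: leq_subr.
Qed.

Lemma bin_le_expn n k : ('C(n, k) <= n ^ k)%N.
Proof.
apply: leq_trans (ffact_le_expn n k).
by rewrite -bin_ffact leq_pmulr // fact_gt0.
Qed.

(** Each factor of the falling factorial is at least [n - k], hence at least half of [n]. *)
Lemma expn_le_bin n k : (2 * k <= n)%N -> (n ^ k <= 2 ^ k * k`! * 'C(n, k))%N.
Proof.
move=> kn; rewrite -mulnA [(k`! * _)%N]mulnC bin_ffact ffact_prod.
apply: (@leq_trans (2 ^ k * (n - k) ^ k)%N).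
  by rewrite -expnMn; case: k kn => // k kn; rewrite leq_exp2r //; lia.
rewrite leq_mul2l; apply/orP; right.
have -> : ((n - k) ^ k = \prod_(i < k) (n - k))%N by rewrite prod_nat_const card_ord.
by apply: leq_prod => i _; have := ltn_ord i; lia.
Qed.

Lemma sum_card_expr n L x : 0 <= x ->
  \sum_(K : {set 'I_n} | (#|K| <= L)%N) x ^+ #|K| <= \sum_(l < L.+1) (n%:R * x) ^+ l.
Proof.
move=> x0; rewrite (partition_big (fun K : {set 'I_n} => inord #|K| : 'I_L.+1) xpredT) //=.
apply: ler_sum => l _.
rewrite (eq_bigr (fun=> x ^+ l)); last by move=> K /andP[KL /eqP <-]; rewrite inordK.
rewrite sumr_const -[leLHS]mulr_natl exprMn ler_wpM2r ?exprn_ge0 // -natrX ler_nat.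
apply: leq_trans (bin_le_expn n l).
have := cards_draws [set: 'I_n]%SET l; rewrite finset.cardsT card_ord => <-.
apply: subset_leq_card; apply/fintype.subsetP => K; rewrite !inE => /andP[KL /eqP <-].
by rewrite finset.subsetT inordK //=.
Qed.

Definition pairs_in n (K : {set 'I_n}) : {set {set 'I_n}} := [set f in pairs n | f \subset K]%SET.

Lemma card_pairs_in n (K : {set 'I_n}) : (#|pairs_in K| <= #|K| ^ 2)%N.
Proof.
rewrite -[X in (_ <= X)%N]mulnn -finset.cardsX.
have /subset_leq_card/leq_trans : pairs_in K \subset
    [set [set q.1; q.2]%SET | q in finset.setX K K]%SET.
  apply/fintype.subsetP => f; rewrite !inE => /andP[/cards2P[x [y [xy ->]]] fK].
  apply/imsetP; exists (x, y) => //; rewrite finset.in_setX.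
  by rewrite !(fintype.subsetP fK) // !inE eqxx ?orbT.
by apply; exact: leq_imset_card.
Qed.

Lemma pairs_in_sub n (K : {set 'I_n}) : pairs_in K \subset pairs n.
Proof. by apply/fintype.subsetP => f; rewrite inE => /andP[]. Qed.

Lemma sum_edge_sets n (K : {set 'I_n}) L j x : 0 <= x -> (#|K| <= L)%N ->
  \sum_(F : {set {set 'I_n}} | (F \subset pairs_in K) && (#|F| == j)) x ^+ #|F| <=
  (2 ^ (L ^ 2))%:R * x ^+ j.
Proof.
move=> x0 KL.
rewrite (eq_bigr (fun=> x ^+ j)); last by move=> F /andP[_ /eqP ->].
rewrite sumr_const -[leLHS]mulr_natl ler_wpM2r ?exprn_ge0 // ler_nat.
apply: (@leq_trans #|powerset (pairs_in K)|).
  by apply: subset_leq_card; apply/fintype.subsetP => F; rewrite inE => /andP[].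
rewrite card_powerset leq_exp2l //; apply: leq_trans (card_pairs_in K) _.
by rewrite leq_sqr.
Qed.

(* [dense_edges L] lists the edge sets that turn some set of at most [L]
   vertices into a dense one. *)
Definition dense_edges n L (F : {set {set 'I_n}}) : bool :=
  [exists K : {set 'I_n}, (0 < #|K| <= L)%N && ((F \subset pairs_in K) && (#|F| == #|K|))].

(** Each set of [l] vertices is charged with sets of exactly [l] edges, so the bound is a polynomial
    in [n%:R * x], which is constant for the edge probability in question. *)
Lemma sum_dense_edges n L x : 0 <= x ->
  \sum_(F : {set {set 'I_n}} | dense_edges L F) x ^+ #|F| <=
  (2 ^ (L ^ 2))%:R * \sum_(l < L.+1) (n%:R * x) ^+ l.
Proof.
move=> x0.
apply: (@le_trans _ _ (\sum_(K : {set 'I_n} | (#|K| <= L)%N) (2 ^ (L ^ 2))%:R * x ^+ #|K|)).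
  apply: (@le_trans _ _ (\sum_(K : {set 'I_n} | (#|K| <= L)%N)
     \sum_(F : {set {set 'I_n}} | (F \subset pairs_in K) && (#|F| == #|K|)) x ^+ #|F|)).
    rewrite (exchange_big_dep xpredT) //= [leRHS](bigID (@dense_edges n L)) /=.
    rewrite -[leLHS]addr0 lerD //; last first.
      by apply: sumr_ge0 => F _; apply: sumr_ge0 => K _; exact: exprn_ge0.
    apply: ler_sum => F /existsP[K /andP[/andP[K0 KL] FK]].
    rewrite (bigD1 K) /= ?KL ?FK // lerDl.
    by apply: sumr_ge0 => K' _; exact: exprn_ge0.
  by apply: ler_sum => K KL; exact: sum_edge_sets.
rewrite -big_distrr /= ler_wpM2l ?ler0n //; exact: sum_card_expr.
Qed.

Lemma prod_onem_ge (T : eqType) (s : seq T) (f : T -> R) :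
  (forall t, t \in s -> 0 <= f t <= 2^-1) ->
  expR (- 2 * \sum_(t <- s) f t) <= \prod_(t <- s) (1 - f t).
Proof.
elim: s => [|t s IH] f01; first by rewrite !big_nil mulr0 expR0.
rewrite !big_cons mulrDr expRD ler_pM ?expR_ge0 //.
  by apply: expR_le_onem; apply: f01; exact: mem_head.
by apply: IH => u us; apply: f01; rewrite inE us orbT.
Qed.

Lemma onem_expn_ge p N : 0 <= p <= 2^-1 -> expR (- 2 * (N%:R * p)) <= (1 - p) ^+ N.
Proof.
move=> p01; have := prod_onem_ge (s := enum 'I_N) (f := fun=> p) (fun _ _ => p01).
by rewrite !big_enum /= sumr_const prodr_const card_ord [N%:R * p]mulr_natl.
Qed.

End Estimates.

(** * First and second moment of the number of isolated copies *)

Section CopyProbability.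
Local Open Scope ring_scope.
Local Close Scope classical_set_scope.
Context {R : realType}.
Variables (h : nat) (e : ssrbool.rel 'I_h).
Hypothesis e_sym : symmetric e.
Hypothesis e_irr : irreflexive e.
Variables (n : nat) (x0 : 'I_n) (p : R).
Hypothesis p01 : 0 <= p <= 2^-1.
Implicit Types (A : {set 'I_n}) (E : {set {set 'I_n}}).

Let m := #|template e|.

Let p0 : 0 <= p. Proof. by case/andP: p01. Qed.
Let p1 : 0 <= p <= 1. Proof. by case/andP: p01 => ? ?; apply/andP; split; lra. Qed.
Let q0 : 0 <= 1 - p <= 1. Proof. by case/andP: p01 => ? ?; apply/andP; split; lra. Qed.

Let q_gt0 : 0 < 1 - p. Proof. by case/andP: p01 => ? ?; lra. Qed.

Definition copy_prob A : R := p ^+ m * (1 - p) ^+ (#|meeting A| - m).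

Definition copy_mean : R := \sum_(A : {set 'I_n} | #|A| == h) copy_prob A.

Lemma copy_prob_ge0 A : 0 <= copy_prob A.
Proof. by rewrite mulr_ge0 ?exprn_ge0 // ltW. Qed.

Lemma Pr_is_copy_indep A (B : pred {set {set 'I_n}}) : #|A| = h ->
  Pr p (pairs n) (fun E => is_copy e x0 A E && B (E :\: meeting A)%SET) =
  copy_prob A * Pr p (pairs n :\: meeting A)%SET B.
Proof.
move=> hA; rewrite /copy_prob /m -(card_copy e x0 hA).
rewrite -(Ex_restrict p _ (meeting_sub A) (copy_sub_meeting e_irr x0 hA)).
apply: eq_Ex => E _; rewrite /is_copy.
by case: (_ == _); case: (B _); rewrite /= ?mulr1 ?mul0r ?mulr0.
Qed.

Lemma Pr_is_copy A : #|A| = h -> Pr p (pairs n) (is_copy e x0 A) = copy_prob A.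
Proof.
move=> hA; have := Pr_is_copy_indep (fun=> true) hA.
rewrite {2}/Pr Ex_cst mulr1 => <-.
by apply: eq_Ex => E _; rewrite andbT.
Qed.

Lemma copy_mean_ge : (2 * h <= n)%N -> (m <= h)%N ->
  p ^+ m * n%:R ^+ h * (expR (- 2 * ((h * n)%:R * p)) / (2 ^ h * h`!)%:R) <= copy_mean.
Proof.
move=> hn mh.
have low A : #|A| = h -> p ^+ m * expR (- 2 * ((h * n)%:R * p)) <= copy_prob A.
  move=> hA; rewrite /copy_prob ler_wpM2l ?exprn_ge0 //.
  apply: le_trans (onem_expn_ge (h * n) p01) _.
  apply: ler_wiXn2l; [exact: ltW|by case/andP: q0|].
  by apply: leq_trans (leq_subr _ _) _; rewrite card_meeting.
have : \sum_(A : {set 'I_n} | #|A| == h) p ^+ m * expR (- 2 * ((h * n)%:R * p)) <= copy_mean.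
  by apply: ler_sum => A /eqP; exact: low.
apply: le_trans.
have -> : \sum_(A : {set 'I_n} | #|A| == h) p ^+ m * expR (- 2 * ((h * n)%:R * p)) =
    'C(n, h)%:R * (p ^+ m * expR (- 2 * ((h * n)%:R * p))).
  rewrite sumr_const -[LHS]mulr_natl; congr (_%:R * _).
  have := cards_draws [set: 'I_n]%SET h; rewrite finset.cardsT card_ord => <-.
  by rewrite cardsE; apply: eq_card => K; rewrite /in_mem /= finset.subsetT.
rewrite mulrACA [leRHS]mulrC ler_wpM2l ?mulr_ge0 ?exprn_ge0 ?expR_ge0 //.
rewrite ler_pdivrMr ?ltr0n ?muln_gt0 ?expn_gt0 ?fact_gt0 // -natrX -natrM ler_nat.
by rewrite mulnC; exact: expn_le_bin.
Qed.

Definition copies E : nat := #|[set A : {set 'I_n} | (#|A| == h) && is_copy e x0 A E]%SET|.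

Let copiesE E : (copies E)%:R = \sum_(A : {set 'I_n} | #|A| == h) (is_copy e x0 A E)%:R :> R.
Proof.
rewrite -natr_sum /copies; congr _%:R; rewrite -sum1_card big_mkcond [RHS]big_mkcond /=.
by apply: eq_bigr => A _; rewrite inE; case: (#|A| == h); case: (is_copy _ _ _ _).
Qed.

(** Connectivity through closed vertex sets, the form in which overlapping copies are compared. *)
Definition connected_rel := forall P : pred 'I_h, (exists i, P i) ->
  (forall i j, e i j -> P i -> P j) -> forall j, P j.

Hypothesis e_conn : connected_rel.

(** The part of the copy on [A] that lies in [A'] is closed under adjacency, because the copy on
    [A'] is isolated; connectivity makes it everything. *)
Lemma copy_overlap A A' E : #|A| = h -> #|A'| = h ->
  is_copy e x0 A E -> is_copy e x0 A' E -> ~~ [disjoint A & A'] -> A = A'.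
Proof.
move=> hA hA' cA cA' /pred0Pn[x /andP[xA xA']].
have [_ adA _] := is_copy_isolated e_sym e_irr hA cA.
have all_in : forall j, embed (h := h) x0 A j \in A'.
  apply: (e_conn (P := fun j => embed x0 A j \in A')).
    by have [i xi] := embed_surj x0 hA xA; exists i; rewrite -xi.
  move=> i j eij iA'.
  have [i' xi'] := embed_surj x0 hA' iA'.
  have [_ _ /(_ i' (embed x0 A j))] := is_copy_isolated e_sym e_irr hA' cA'.
  by rewrite -xi' adA => /(_ eij)[j' ->]; exact: embed_in.
apply/eqP; rewrite eqEcard hA hA' leqnn andbT; apply/fintype.subsetP => y yA.
by have [j ->] := embed_surj x0 hA yA.
Qed.

(** Distinct overlapping copies are impossible, and two disjoint ones fix the union of their pairs.
    At most [h ^ 2] pairs meet both vertex sets; their factor [1 - p] occurs twice in the product of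
    probabilities, which the denominator corrects. *)
Lemma Ex_two_copies A A' : #|A| = h -> #|A'| = h ->
  Pr p (pairs n) (fun E => is_copy e x0 A E && is_copy e x0 A' E) <=
  (A == A')%:R * copy_prob A + copy_prob A * copy_prob A' / (1 - p) ^+ (h ^ 2).
Proof.
move=> hA hA'; have b0 : 0 < (1 - p) ^+ (h ^ 2) by exact: exprn_gt0.
have r0 : 0 <= copy_prob A * copy_prob A' / (1 - p) ^+ (h ^ 2).
  by apply: divr_ge0; [apply: mulr_ge0; exact: copy_prob_ge0|exact: ltW].
move: r0; have [<-|ne] := eqVneq A A' => r0.
  rewrite mul1r -[leLHS]addr0 lerD //.
  by rewrite -(Pr_is_copy hA); apply: le_Pr => // E _ /andP[].
rewrite mulr0n mul0r add0r; case: (boolP [disjoint A & A']) => [dis|ndis]; last first.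
  rewrite (_ : Pr _ _ _ = 0) //.
  rewrite -(Ex_cst p (pairs n) 0); apply: eq_Ex => E _.
  case: (boolP (_ && _)) => // /andP[cA cA'].
  by case/eqP: ne; exact: copy_overlap cA cA' ndis.
pose D := (meeting A :|: meeting A')%SET; pose F := (copy e x0 A :|: copy e x0 A')%SET.
have sA := copy_sub_meeting e_irr x0 hA; have sA' := copy_sub_meeting e_irr x0 hA'.
have FD : F \subset D by exact: finset.setUSS.
have DP : D \subset pairs n by rewrite finset.subUset !meeting_sub.
have cF : #|F| = (m + m)%N.
  rewrite cardsU !(card_copy e x0) //.
  suff -> : (copy e x0 A :&: copy e x0 A' = finset.set0)%SET by rewrite finset.cards0 subn0.
  apply/finset.setP => f; rewrite !inE; apply/negP => /andP[fA fA'].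
  have := fintype.subsetP sA f fA; rewrite inE => /andP[_ /finset.set0Pn[x]].
  rewrite inE => /andP[xf xA].
  have := fintype.subsetP (copy_sub hA' fA') x xf.
  by rewrite (disjointFr dis xA).
have cD : (#|meeting A| + #|meeting A'| <= #|D| + h ^ 2)%N.
  rewrite -cardsUI leq_add2l; apply: leq_trans (card_meeting2 dis) _.
  by rewrite hA hA' mulnn.
have mA : (m <= #|meeting A|)%N by rewrite /m -(card_copy e x0 hA) subset_leq_card.
have mA' : (m <= #|meeting A'|)%N by rewrite /m -(card_copy e x0 hA') subset_leq_card.
apply: (@le_trans _ _ (p ^+ #|F| * (1 - p) ^+ (#|D| - #|F|))).
  rewrite -[leRHS]mulr1 -[X in _ <= _ * X](Ex_cst p (pairs n :\: D)%SET).
  rewrite -(Ex_restrict p _ DP FD); apply: le_Ex => // E _.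
  rewrite mulr1 ler_nat; case: (boolP (_ && _)) => // /andP[/eqP cA /eqP cA'].
  by rewrite finset.setIUr cA cA' eqxx.
rewrite ler_pdivlMr // cF exprD /copy_prob -!mulrA ler_wpM2l ?exprn_ge0 //.
rewrite [leRHS]mulrCA ler_wpM2l ?exprn_ge0 // -!exprD.
apply: ler_wiXn2l; [exact: ltW|by case/andP: q0|].
have arith (a b d k l : nat) : (l <= a)%N -> (l <= b)%N -> (l + l <= d)%N ->
    (a + b <= d + k)%N -> (a - l + (b - l) <= d - (l + l) + k)%N by clear; lia.
by apply: arith => //; rewrite -cF subset_leq_card.
Qed.

Lemma Ex_copies_sqr : Ex p (pairs n) (fun E => (copies E)%:R ^+ 2) <=
  copy_mean + copy_mean ^+ 2 / (1 - p) ^+ (h ^ 2).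
Proof.
have -> : Ex p (pairs n) (fun E => (copies E)%:R ^+ 2) =
  \sum_(A : {set 'I_n} | #|A| == h) \sum_(A' : {set 'I_n} | #|A'| == h)
    Pr p (pairs n) (fun E => is_copy e x0 A E && is_copy e x0 A' E).
  rewrite -(eq_bigr _ (fun A _ => Ex_sum _ _ _ _)) -Ex_sum; apply: eq_Ex => E _.
  rewrite expr2 copiesE big_distrl; apply: eq_bigr => A _ /=.
  rewrite big_distrr; apply: eq_bigr => A' _ /=.
  by case: (is_copy _ _ _ _); rewrite /= ?mul1r ?mul0r.
apply: (@le_trans _ _ (\sum_(A : {set 'I_n} | #|A| == h) \sum_(A' : {set 'I_n} | #|A'| == h)
   ((A == A')%:R * copy_prob A + copy_prob A * copy_prob A' / (1 - p) ^+ (h ^ 2)))).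
  by apply: ler_sum => A /eqP hA; apply: ler_sum => A' /eqP hA'; exact: Ex_two_copies.
rewrite (eq_bigr (fun A => copy_prob A + copy_prob A * copy_mean / (1 - p) ^+ (h ^ 2))).
  by rewrite big_split /= -big_distrl -big_distrl /= expr2.
move=> A hA; rewrite big_split /=; congr (_ + _); last first.
  by rewrite -big_distrl -big_distrr.
by rewrite (bigD1 A) //= eqxx mul1r big1 ?addr0 // => A' /andP[_ /negbTE]; rewrite eq_sym => ->; rewrite mulr0n mul0r.
Qed.

Lemma Ex_copies : Ex p (pairs n) (fun E => (copies E)%:R) = copy_mean.
Proof.
rewrite (eq_Ex _ (fun E _ => copiesE E)) Ex_sum; apply: eq_bigr => A /eqP hA.
exact: Pr_is_copy.
Qed.

(** The right side bounds the variance: the mean comes from the diagonal, and the other term from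
    the slight correlation of disjoint copies. *)
Lemma chebyshev_copies (k : nat) : k%:R <= copy_mean ->
  (copy_mean - k%:R) ^+ 2 * Pr p (pairs n) (fun E => (copies E < k)%N) <=
  copy_mean + copy_mean ^+ 2 * ((1 - p) ^- (h ^ 2) - 1).
Proof.
move=> km; apply: (@le_trans _ _ (Ex p (pairs n) (fun E => (copies E)%:R ^+ 2) +
   ((- 2 * copy_mean) * copy_mean + copy_mean ^+ 2))).
  have <- : Ex p (pairs n) (fun E => (copies E)%:R ^+ 2 +
      ((- 2 * copy_mean) * (copies E)%:R + copy_mean ^+ 2)) =
      Ex p (pairs n) (fun E => (copies E)%:R ^+ 2) +
      ((- 2 * copy_mean) * copy_mean + copy_mean ^+ 2).
    by rewrite !ExD ExZ Ex_copies Ex_cst.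
  rewrite -ExZ; apply: le_Ex => // E _; have [lt|le] := ltnP (copies E) k; last first.
    rewrite mulr0; have := sqr_ge0 ((copies E)%:R - copy_mean); move: (_%:R) => X; nra.
  have {}lt : (copies E)%:R <= k%:R :> R by rewrite ler_nat ltnW.
  rewrite mulr1.
  move: lt km; move: (copies E)%:R k%:R copy_mean => X K M; nra.
have := Ex_copies_sqr; move: (Ex _ _ _) ((1 - p) ^- _) copy_mean => X b M; nra.
Qed.

(** With [k] at most half the mean, the squared deviation is at least a quarter of the squared mean,
    which gives the 4. The 8 is 4 times the 2 in [(1 - p) ^- (h ^ 2) - 1 <= 2 * ((h ^ 2)%:R * p)], a
    consequence of Bernoulli's inequality. *)
Lemma Pr_few_copies (k : nat) : 0 < copy_mean -> 2 * k%:R <= copy_mean ->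
  (h ^ 2)%:R * p <= 2^-1 ->
  Pr p (pairs n) (fun E => (copies E < k)%N) <= 4 / copy_mean + 8 * ((h ^ 2)%:R * p).
Proof.
move=> M0 kM hp; have km : k%:R <= copy_mean.
  by apply: le_trans kM; have := ler0n R k; lra.
have := chebyshev_copies km.
set b := (1 - p) ^- (h ^ 2).
have b1 : b - 1 <= 2 * ((h ^ 2)%:R * p).
  have hb := bernoulli_ineq (h ^ 2) p1.
  have hp0 : 0 <= (h ^ 2)%:R * p by rewrite mulr_ge0 ?ler0n.
  rewrite lerBlDr /b -[leLHS]mul1r ler_pdivrMr ?exprn_gt0 //.
  move: hb hp hp0; move: ((1 - p) ^+ _) ((h ^ 2)%:R * p) => y z; nra.
have P0 : 0 <= Pr p (pairs n) (fun E => (copies E < k)%N) by exact: Pr_ge0.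
move: (Pr _ _ _) P0 b1 M0 kM km; move: (b) ((h ^ 2)%:R * p) copy_mean (k%:R) => B z M K P P0 b1 M0 kM km ineq.
have h1 : M ^+ 2 / 4 * P <= (M - K) ^+ 2 * P by rewrite ler_wpM2r //; nra.
have h2 : M ^+ 2 * P <= 4 * M + 8 * z * M ^+ 2 by nra.
have : P <= (4 * M + 8 * z * M ^+ 2) / M ^+ 2.
  by rewrite ler_pdivlMr ?exprn_gt0 // mulrC.
move=> h3; apply: le_trans h3 _.
by rewrite le_eqVlt; apply/orP; left; apply/eqP; field; rewrite gt_eqF.
Qed.

End CopyProbability.

(** * Copies without other short dense sets *)

Section GoodCopies.
Local Open Scope ring_scope.
Local Close Scope classical_set_scope.
Context {R : realType}.
Variables (h : nat) (e : ssrbool.rel 'I_h).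
Hypothesis e_sym : symmetric e.
Hypothesis e_irr : irreflexive e.
Variables (n : nat) (x0 : 'I_n) (L : nat).
Implicit Types (A : {set 'I_n}) (E : {set {set 'I_n}}).

(** Only pairs outside [meeting A] are concerned, so that the condition is independent of [is_copy];
    dense sets inside the copy are allowed. *)
Definition avoids A E : bool :=
  [forall F : {set {set 'I_n}}, (dense_edges L F && (F \subset pairs n :\: meeting A)%SET)
     ==> ~~ (F \subset E)].

Definition good_copy A E : bool :=
  (is_copy e x0 A E) && avoids A (E :\: meeting A)%SET.

(** By the uniqueness hypothesis the events for different [A] are disjoint, so their probabilities
    add up. Independence splits off [copy_prob A], and the avoidance factor is bounded below through
    the expected number of dense edge sets. *)
Lemma Pr_good_copy p : 0 <= p <= 2^-1 ->
  (forall A A' E, #|A| = h -> #|A'| = h -> E \subset pairs n ->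
     good_copy A E -> good_copy A' E -> A = A') ->
  copy_mean e n p *
    expR (- 2 * ((2 ^ (L ^ 2))%:R * \sum_(l < L.+1) (n%:R * p) ^+ l)) <=
  Pr p (pairs n) (fun E => [exists A : {set 'I_n}, (#|A| == h) && good_copy A E]) :> R.
Proof.
move=> p01 uniqA.
have p1 : 0 <= p <= 1 by case/andP: p01 => ? ?; apply/andP; split; lra.
have p0 : 0 <= p by case/andP: p01.
apply: (@le_trans _ _ (\sum_(A : {set 'I_n} | #|A| == h) Pr p (pairs n) (good_copy A))).
  rewrite /copy_mean big_distrl; apply: ler_sum => A /eqP hA /=.
  rewrite (Pr_is_copy_indep e_irr x0 p (avoids A) hA) ler_wpM2l //.
    by apply: copy_prob_ge0.
  set D := (pairs n :\: meeting A)%SET.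
  pose Fs := [seq F <- enum {set {set 'I_n}} | dense_edges L F && (F \subset D)].
  have FsP F : F \in Fs -> dense_edges L F /\ F \subset D.
    by rewrite mem_filter => /andP[/andP[]].
  apply: (@le_trans _ _ (\prod_(F <- Fs) (1 - p ^+ #|F|))).
    apply: (@le_trans _ _ (expR (- 2 * \sum_(F <- Fs) p ^+ #|F|))).
      rewrite ler_expR ler_nM2l; last by lra.
      apply: le_trans (sum_dense_edges n L p0).
      rewrite big_filter big_enum_cond /= big_mkcond [leRHS]big_mkcond /=.
      apply: ler_sum => F _; case: (dense_edges L F) => //=.
      by case: ifP => // _; exact: exprn_ge0.
    (* [F] is nonempty since [dense_edges] asks for [0 < #|K|], so [p ^+ #|F|] is at most [p], hence
       at most 1/2. *)
    apply: prod_onem_ge => F /FsP[/existsP[K /andP[/andP[K0 _] /andP[_ /eqP FK]]] _].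
    rewrite exprn_ge0 //= FK; case: #|K| K0 => // k _.
    rewrite exprS; apply: (@le_trans _ _ (p * 1)); last by case/andP: p01 => *; lra.
    by rewrite ler_wpM2l // exprn_ile1 //; case/andP: p1.
  apply: le_trans (Pr_avoid p1 (D := D) (Fs := Fs) (fun F h => (FsP F h).2)) _.
  apply: le_Pr => // E ED /allP aE; apply/forallP => F; apply/implyP => FD.
  by apply: aE; rewrite mem_filter FD mem_enum.
rewrite /Pr -Ex_sum; apply: le_Ex => // E EP.
case: existsP => [[A /andP[/eqP hA gA]]|nex].
  rewrite (bigD1 A) /= ?hA ?eqxx // big1 ?addr0 => [|A' /andP[/eqP hA' ne]].
    by rewrite -[leRHS]/(1%:R) ler_nat leq_b1.
  case: (boolP (good_copy A' E)) => // gA'.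
  by case/eqP: ne; exact: (uniqA A' A E).
rewrite big1 // => A hA; case: (boolP (good_copy A E)) => // gA.
by case: nex; exists A; rewrite hA.
Qed.

End GoodCopies.

(** * From dense lists and violations of [NO] to finite edge sets *)

Section EdgeSets.
Local Close Scope classical_set_scope.
Variables (n : nat) (E : {set {set 'I_n}}).

Lemma dense_edge_set (s : seq 'I_n) : dense (@edge_adj n E) s ->
  exists F : {set {set 'I_n}},
    [/\ F \subset pairs_in [set x in s]%SET, F \subset E & #|F| = size s].
Proof.
move=> [us s0 se].
pose g (x y : 'I_n) : {set 'I_n} := [set x; y]%SET.
pose l := [seq g p.1 p.2 | p <- elist (@edge_adj n E) s].
have ul : uniq l.
  by apply: uniq_map_elist => // x y x' y' /(@finset2_inj _ x y x' y').
have lP f : f \in l -> (f \in pairs_in [set x in s]%SET) && (f \in E).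
  case/mapP => -[x y] /(elistP us)[xs ys [xy xyE] _] -> /=.
  rewrite xyE andbT !inE cards2 xy /=; apply/fintype.subsetP => z.
  by rewrite !inE => /orP[] /eqP ->.
(* [dense_edges] asks for exactly as many edges as vertices, so surplus edges are cut off. *)
exists [set f in take (size s) l]%SET; split.
- by apply/fintype.subsetP => f; rewrite inE => /mem_take/lP/andP[].
- by apply/fintype.subsetP => f; rewrite inE => /mem_take/lP/andP[].
- rewrite cardsE (card_uniqP (take_uniq _ ul)) size_takel // size_map size_elist.
  exact: se.
Qed.

Lemma NO_edge_set l : ~ NO l (graph_of_edges E) ->
  exists K : {set 'I_n}, #|K| = l /\
    exists F : {set {set 'I_n}}, [/\ F \subset pairs_in K, F \subset E & #|F| = l.+1].
Proof.
move=> /contrapT[A [Al /at_leastP[es [ues ses esP]]]].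
pose K := [set x : 'I_n | `[< A x >]]%SET.
have AK : A = [set` enum K]%classic.
  by apply/seteqP; split=> x /=; rewrite mem_enum inE => /asboolP.
exists K; split.
  have := card_set_seq (enum_uniq K); rewrite -AK -cardE => AK'.
  have : `I_#|K| #= `I_l by apply: card_eq_trans Al; rewrite card_eq_sym.
  by rewrite card_eq_le !card_le_II => /anti_leq.
pose toset (f : {classic (set 'I_n)}) : {set 'I_n} := [set x | `[< (f : set 'I_n) x >]]%SET.
have toset_inj : injective toset.
  move=> f g /finset.setP fg; apply/seteqP; split=> x fx.
    by have := fg x; rewrite !inE (asboolT fx) => /esym/asboolP.
  by have := fg x; rewrite !inE (asboolT fx) => /asboolP.
have tsP f : f \in es -> (toset f \in pairs_in K) && (toset f \in E).
  move=> /esP[x [y [Ax Ay [xy xyE] ->]]].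
  have -> : toset [set x; y]%classic = [set x; y]%SET.
    apply/finset.setP => z; rewrite !inE; apply/asboolP/orP.
      by case=> ->; [left|right].
    by case=> /eqP ->; [left|right].
  rewrite xyE andbT !inE cards2 xy /=; apply/fintype.subsetP => z.
  by case/finset.set2P=> ->; rewrite inE; apply/asboolP.
exists [set f in map toset es]%SET; split.
- by apply/fintype.subsetP => f; rewrite inE => /mapP[g /tsP/andP[gK _] ->].
- by apply/fintype.subsetP => f; rewrite inE => /mapP[g /tsP/andP[_ gK] ->].
- by rewrite cardsE (card_uniqP _) ?size_map // map_inj_uniq.
Qed.

(** A short dense set missing [A] would have all its edges outside [meeting A], which [avoids]
    forbids. *)
Lemma good_copy_nodense h (e : ssrbool.rel 'I_h) x0 L (A : {set 'I_n}) (hA : #|A| = h)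
    (s : seq 'I_n) : E \subset pairs n -> good_copy e x0 L A E ->
  dense (@edge_adj n E) s -> size s <= L ->
  exists2 x, x \in s & exists i : 'I_h, x = embed x0 A i.
Proof.
move=> EP /andP[_ av] ds sL; apply: contrapT => nex.
have nA x : x \in s -> x \notin A.
  move=> xs; apply/negP => xA; apply: nex; exists x => //; exact: embed_surj.
have [F [FK FE cF]] := dense_edge_set ds; have [us s0 _] := ds.
have FD f : f \in F -> f \notin meeting A.
  move=> fF; apply/negP; rewrite inE => /andP[_ /finset.set0Pn[x]].
  rewrite inE => /andP[xf xA]; have := fintype.subsetP FK f fF.
  rewrite inE => /andP[_ /fintype.subsetP/(_ x xf)]; rewrite inE => /nA.
  by rewrite xA.
have := forallP av F; rewrite (_ : dense_edges L F); last first.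
  apply/existsP; exists [set x in s]%SET; rewrite FK cardsE (card_uniqP us) s0 sL.
  by rewrite cF eqxx.
have -> : F \subset (pairs n :\: meeting A)%SET.
  apply/fintype.subsetP => f fF; rewrite inE FD //=.
  exact: (fintype.subsetP EP) (fintype.subsetP FE f fF).
rewrite /= => /negP; apply; apply/fintype.subsetP => f fF.
by rewrite inE FD //=; exact: (fintype.subsetP FE).
Qed.

End EdgeSets.

(** * Almost sure statements *)

Section Limits.
Local Open Scope ring_scope.
Context {R : realType} (c : R).
Hypothesis c_gt0 : 0 < c.

Let p (n : nat) : R := c * n%:R^-1.

Lemma eventually_edge_prob (x : R) : 0 < x ->
  exists N, forall n, (N <= n)%N -> [/\ (0 < n)%N, 0 <= p n <= x & n%:R * p n = c].
Proof.
move=> x0; exists (maxn 1 (Num.bound (c / x))) => n; rewrite geq_max => /andP[n0 nN].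
have n0' : 0 < n%:R :> R by rewrite ltr0n.
split=> //; last by rewrite /p mulrCA mulfV ?mulr1 // gt_eqF.
rewrite /p; apply/andP; split; first by rewrite divr_ge0 // ltW.
rewrite ler_pdivrMr // mulrC -ler_pdivrMr //; apply: ltW.
apply: lt_le_trans (archi_boundP _) _; first by rewrite divr_ge0 // ltW.
by rewrite ler_nat.
Qed.

Lemma almost_surelyP (A : property) : almost_surely p A <->
  forall x, 0 < x -> exists N, forall n, (N <= n)%N -> 1 - x <= Gnp n (p n) A.
Proof.
have [N0 N0P] := eventually_edge_prob (@ltr01 R).
split=> [/cvgrPdist_lt h x x0|h].
  have [N _ NP] := h x x0; exists N => n /NP.
  by rewrite ltr_distlC => /andP[/ltW].
apply/cvgrPdist_le => x x0; have [N NP] := h x x0.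
exists (maxn N N0) => // n /=; rewrite geq_max => /andP[/NP nN /N0P[_ p01 _]].
rewrite ler_distlC nN /= GnpE; apply: le_trans (Pr_le1 p01 _ _) _; lra.
Qed.

Lemma almost_surely_rate (A : property) (K : R) N :
  (forall n, (N <= n)%N -> 1 - Gnp n (p n) A <= K / n%:R) -> almost_surely p A.
Proof.
move=> h; apply/almost_surelyP => x x0.
exists (maxn (maxn 1 N) (Num.bound (`|K| / x))) => n; rewrite !geq_max -andbA.
move=> /and3P[n0 /h nN nK]; rewrite lerBlDl -lerBlDr; apply: le_trans nN _.
rewrite ler_pdivrMr ?ltr0n // mulrC -ler_pdivrMr //.
apply: (@le_trans _ _ (`|K| / x)); first by rewrite ler_pM2r ?invr_gt0 // ler_norm.
apply/ltW/(lt_le_trans (archi_boundP _)); first by rewrite divr_ge0 // ltW.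
by rewrite ler_nat.
Qed.

Lemma almost_surely_forall (I : finType) (A : I -> property) :
  (forall i, almost_surely p (A i)) -> almost_surely p (fun G => forall i, A i G).
Proof.
move=> h; apply/almost_surelyP => x x0; pose y := x / (#|I|.+1)%:R.
have y0 : 0 < y by rewrite divr_gt0 // ltr0n.
have [N0 N0P] := eventually_edge_prob (@ltr01 R).
have ex i := (almost_surelyP (A i)).1 (h i) y y0.
pose N i := sval (cid (ex i)).
have NP i : forall n, (N i <= n)%N -> 1 - y <= Gnp n (p n) (A i) by rewrite /N; case: cid.
exists (maxn N0 (\max_i N i)) => n; rewrite geq_max => /andP[/N0P[_ p01 _] /bigmax_leqP nN].
rewrite lerBlDl -lerBlDr GnpE -Pr_compl.
apply: (@le_trans _ _ (\sum_(i : I) Pr (p n) (pairs n)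
    (fun E => ~~ `[< A i (graph_of_edges E) >]))).
  apply: le_trans (Pr_union p01 _ xpredT (fun i E => ~~ `[< A i (graph_of_edges E) >])).
  apply: le_Pr => // E _ /asboolPn/existsNP[i ni]; apply/existsP; exists i => /=.
  exact/asboolPn.
apply: (@le_trans _ _ (\sum_(i : I) y)).
  apply: ler_sum => i _; rewrite Pr_compl -GnpE; have := NP i n (nN i isT); lra.
rewrite sumr_const -mulr_natl /y mulrCA -[leRHS]mulr1 ler_pM2l //.
by rewrite ler_pdivrMr ?ltr0n // mul1r ler_nat; exact: leqnSn.
Qed.

(** First moment over sets of [l] vertices and [l.+1] pairs inside them: of the order of n^l
    choices, each of probability p^(l+1), leave one factor p and thus the rate 1/n. *)
Lemma NO_almost_surely l : almost_surely p (NO l).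
Proof.
pose S : R := \sum_(j < l.+1) c ^+ j.
have [N NP] := eventually_edge_prob (@ltr01 R).
apply: (@almost_surely_rate _ ((2 ^ (l ^ 2))%:R * S * c) N) => n /NP[n0 p01 np].
have p0 : 0 <= p n by case/andP: p01.
rewrite GnpE -Pr_compl.
pose P (KF : {set 'I_n} * {set {set 'I_n}}) :=
  (#|KF.1| == l) && ((KF.2 \subset pairs_in KF.1) && (#|KF.2| == l.+1)).
apply: (@le_trans _ _ (\sum_(KF | P KF) Pr (p n) (pairs n) (fun E => KF.2 \subset E))).
  apply: le_trans (Pr_union p01 _ P (fun KF E => KF.2 \subset E)).
  apply: le_Pr => // E _ /asboolPn /NO_edge_set[K [cK [F [FK FE cF]]]]; apply/existsP; exists (K, F).
  by rewrite /P /= cK cF FK FE !eqxx.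
rewrite (eq_bigr (fun KF : {set 'I_n} * {set {set 'I_n}} => p n ^+ #|KF.2|)); last first.
  move=> KF /andP[_ /andP[FK _]]; apply: Pr_sub.
  exact: fintype.subset_trans FK (pairs_in_sub _).
rewrite -(pair_big_dep (fun K : {set 'I_n} => #|K| == l)
  (fun (K : {set 'I_n}) (F : {set {set 'I_n}}) => (F \subset pairs_in K) && (#|F| == l.+1))
  (fun K F => p n ^+ #|F|)) /=.
apply: (@le_trans _ _ (\sum_(K : {set 'I_n} | #|K| == l) (2 ^ (l ^ 2))%:R * p n ^+ l.+1)).
  by apply: ler_sum => K /eqP cK; apply: sum_edge_sets => //; rewrite cK.
rewrite (eq_bigr (fun K : {set 'I_n} => ((2 ^ (l ^ 2))%:R * p n) * p n ^+ #|K|)); last first.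
  by move=> K /eqP ->; rewrite exprS mulrA.
rewrite -big_distrr /= /p -/(p n) [leRHS](_ : _ = ((2 ^ (l ^ 2))%:R * p n) * S); last first.
  by rewrite /p; ring.
apply: ler_wpM2l; first by apply: mulr_ge0 => //; exact: ler0n.
rewrite /S -np; apply: le_trans (sum_card_expr n l p0).
rewrite big_mkcond [leRHS]big_mkcond /=; apply: ler_sum => K _.
by case: eqP => [->|_]; rewrite ?leqnn //; case: ifP => // _; exact: exprn_ge0.
Qed.

End Limits.

(** * Templates induced by vertex lists, and tree templates *)

Section InducedTemplate.
Context {V : eqType} (ad : V -> V -> Prop).
Hypothesis ad_sym : forall x y, ad x y -> ad y x.
Hypothesis ad_irr : forall x, ~ ad x x.
Variable J : seq V.

Definition induced (i j : 'I_(size J)) : bool :=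
  `[< ad (tnth (in_tuple J) i) (tnth (in_tuple J) j) >].

Lemma induced_sym : symmetric induced.
Proof. by move=> i j; apply/asboolP/asboolP; exact: ad_sym. Qed.

Lemma induced_irr : irreflexive induced.
Proof. by move=> i; apply/asboolP; exact: ad_irr. Qed.

Lemma mem_elist (T : eqType) (r : T -> T -> Prop) (s : seq T) x y :
  (forall a b, r a b -> r b a) ->
  x \in s -> y \in s -> x <> y -> r x y -> (x, y) \in elist r s \/ (y, x) \in elist r s.
Proof.
move=> rs; elim: s => //= z s IH; rewrite !inE !mem_cat => xs ys xy rxy.
have [exz|xz] := eqVneq x z.
  left; apply/orP; left; apply/mapP; exists y; last by rewrite exz.
  rewrite mem_filter -exz; apply/andP; split; first exact/asboolP.
  by move: ys; rewrite -exz eq_sym; case: eqP => // /esym.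
have [eyz|yz] := eqVneq y z.
  right; apply/orP; left; apply/mapP; exists x; last by rewrite eyz.
  rewrite mem_filter -eyz; apply/andP; split; first exact/asboolP/rs.
  by move: xs; rewrite (negbTE xz).
rewrite (negbTE xz) in xs; rewrite (negbTE yz) in ys.
by have [h|h] := IH xs ys xy rxy; [left|right]; rewrite h orbT.
Qed.

Lemma card_template_le : #|template induced| <= ecount ad J.
Proof.
pose s := enum 'I_(size J).
pose g (i j : 'I_(size J)) : {set 'I_(size J)} := [set i; j]%SET.
pose r (i j : 'I_(size J)) : Prop := induced i j.
have -> : ecount ad J = ecount r s.
  rewrite -{1}[J]/(tval (in_tuple J)) -(map_tnth_enum (in_tuple J)).
  apply: (@ecount_map _ _ r ad s) => // x y _ _.
  by split=> [h|/asboolP]; [exact/asboolP|].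
rewrite -size_elist -(size_map (fun q => g q.1 q.2)).
apply: leq_trans (card_size _); apply: subset_leq_card.
apply/fintype.subsetP => f /templateP[i [j [-> eij]]].
have ij : i <> j by move=> e; move: eij; rewrite e induced_irr.
have rs : forall a b, r a b -> r b a by move=> a b; rewrite /r induced_sym.
have [h|h] := mem_elist rs (mem_enum _ i) (mem_enum _ j) ij eij.
  by apply/mapP; exists (i, j).
by apply/mapP; exists (j, i) => //; rewrite /g finset.setUC.
Qed.

End InducedTemplate.

Lemma mem_tnth_ex (V : eqType) (J : seq V) x : x \in J -> exists i, x = tnth (in_tuple J) i.
Proof.
move=> xJ; have lt : index x J < size J by rewrite index_mem.
by exists (Ordinal lt); rewrite (tnth_nth x) /= nth_index.
Qed.

Section TreeTemplate.
Variables (m k : nat) (s : Sigma m k) (J : seq (seq nat)).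
Hypothesis J_uniq : uniq J.
Hypothesis J_nil : [::] \in J.
Hypothesis J_suffix : forall a u, a :: u \in J -> u \in J.
Hypothesis J_size : forall w, w \in J -> size w <= m.
Hypothesis J_type : tree_type m k ([set` J] : set word_tree) [::] = s.

Let D : set word_tree := [set` J].
Let e := induced word_adj (J := J).

Let tnth_inj : injective (tnth (in_tuple J)).
Proof. by apply/tuple_uniqP. Qed.

Lemma word_set_tree : is_tree D.
Proof. by apply: word_is_tree => //; exists m. Qed.

Lemma word_template_connected : connected_rel e.
Proof.
move=> P [i Pi] Pcl j; have [[_ conn] _] := word_set_tree.
have walk_ext d (x y : word_tree) : walk D d x y -> forall i1, x = tnth (in_tuple J) i1 -> P i1 ->
    exists2 j1, y = tnth (in_tuple J) j1 & P j1.
  elim=> [x1 _ i1 -> Pi1|d1 x1 y1 z1 _ IH Dz yz i1 xi Pi1]; first by exists i1.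
  have [j1 yj Pj] := IH _ xi Pi1; have [j2 zj] := mem_tnth_ex Dz.
  exists j2 => //; apply: (Pcl j1) => //; apply/asboolP; rewrite -zj -yj; exact: yz.
have [d w] := conn _ _ (mem_tnth i (in_tuple J)) (mem_tnth j (in_tuple J)).
by have [j1 /tnth_inj ->] := walk_ext _ _ _ w i erefl Pi.
Qed.

(** A tree is not dense. Having fewer edges than vertices makes the expected number of copies grow
    at least linearly in [n]. *)
Lemma word_template_card : #|template e| < size J.
Proof.
apply: leq_ltn_trans (card_template_le word_adj_sym word_adj_irrefl J) _.
rewrite ltnNge; apply/negP => le; have [_ ac] := word_set_tree.
apply: (@acyclic_not_dense word_tree D J ac).
  by move=> x xJ; apply: etrans xJ; exact: (esym (@mem_classic _ x J)).
split.
- by rewrite uniq_classic.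
- by case: (J) J_nil.
- exact: le.
Qed.

Variables (n : nat) (x0 : 'I_n) (E : {set {set 'I_n}}) (A : {set 'I_n}).
Hypothesis hA : #|A| = size J.
Hypothesis copyA : is_copy e x0 A E.

Let N := graph_of_edges E.
Let phi (w : word_tree) : N := nth x0 (enum A) (index (w : seq nat) J).

Lemma copy_tree_component : tree_component ([set` A] : set N) /\
  component_has_type s ([set` A] : set N).
Proof.
have [emb_inj emb_adj emb_cl] := is_copy_isolated (induced_sym word_adj_sym (J := J))
  (induced_irr word_adj_irrefl (J := J)) hA copyA.
have phiE i : phi (tnth (in_tuple J) i) = embed x0 A i.
  by rewrite /phi /embed (tnth_nth [::]) /= index_uniq.
have phi_inj x y : D x -> D y -> phi x = phi y -> x = y.
  by move=> /mem_tnth_ex[i ->] /mem_tnth_ex[j ->]; rewrite !phiE => /emb_inj ->.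
have phi_adj x y : D x -> D y -> adj (phi x) (phi y) <-> adj x y.
  move=> /mem_tnth_ex[i ->] /mem_tnth_ex[j ->]; rewrite !phiE.
  by split=> [/emb_adj/asboolP|h] //; apply/emb_adj/asboolP.
have imA : phi @` D = [set` A].
  apply/seteqP; split=> [_ [w /mem_tnth_ex[i ->] <-]|x xA].
    by rewrite phiE /=; exact: embed_in.
  have [i ->] := embed_surj x0 hA xA; exists (tnth (in_tuple J) i); last exact: phiE.
  exact: mem_tnth.
have tA : is_tree ([set` A] : set N).
  rewrite -imA; exact: (is_tree_image phi_adj (fun _ h => h) word_set_tree).
have Acl a b : [set` A] a -> @adj N a b -> [set` A] b.
  move=> /(embed_surj x0 hA)[i ->] /emb_cl[j ->]; exact: embed_in.
split; last first.
  exists (phi [::]); first by rewrite -imA; exists [::].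
  rewrite -imA (tree_type_image phi_inj phi_adj) //; exact: J_type.
split=> //; exists (phi [::]).
have A0 : [set` A] (phi [::]) by rewrite -imA; exists [::].
apply/seteqP; split=> [x xA|x [d]].
  have [[_ conn] _] := tA; have [d w] := conn _ _ A0 xA; exists d.
  by elim: w => [y _|d' y z t _ IH _ zt]; [exact: walk0|exact: walkS IH I zt].
move=> w; elim: w A0 => // d' y z t _ IH _ zt /IH zA; exact: Acl zA zt.
Qed.

End TreeTemplate.

Lemma YES_copies m k (s : Sigma m k) (J : seq (seq nat)) n (x0 : 'I_n) (E : {set {set 'I_n}}) :
  uniq J -> [::] \in J -> (forall a u, a :: u \in J -> u \in J) ->
  (forall w, w \in J -> size w <= m) ->
  tree_type m k ([set` J] : set word_tree) [::] = s ->
  k <= copies (induced word_adj (J := J)) x0 E -> YES s (graph_of_edges E).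
Proof.
move=> J1 J2 J3 J4 J5 kc; apply: at_least_le kc _; apply/at_leastP.
pose toset (A : {set 'I_n}) : {classic (set (graph_of_edges E))} := [set` A].
have toset_inj : injective toset.
  by move=> A B /seteqP[h1 h2]; apply/finset.setP => x; apply/idP/idP; [exact: h1|exact: h2].
rewrite /copies cardE; set l := enum _.
exists [seq toset A | A <- l]; split.
- by rewrite map_inj_uniq // enum_uniq.
- by rewrite size_map.
move=> _ /mapP[A Al ->]; move: Al; rewrite mem_enum inE => /andP[/eqP hA cA].
exact: (copy_tree_component J1 J2 J3 J4 J5 hA cA).
Qed.

(** * Almost sure tree components and derivability of almost sure sentences *)

Section MainProof.
Local Open Scope ring_scope.
Context {R : realType} (c : R).
Hypothesis c_gt0 : 0 < c.

Let p (n : nat) : R := c * n%:R^-1.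

(** Only an upper bound [j] on the number of template edges is at hand: [h] for the template of a
    model, [h.-1] for a tree. As [p n <= 1], a larger exponent only lowers the bound. *)
Lemma copy_mean_lower h (e : ssrbool.rel 'I_h) n j : (0 < n)%N -> (2 * h <= n)%N ->
  0 <= p n <= 2^-1 -> n%:R * p n = c -> (#|template e| <= j <= h)%N ->
  c ^+ j * (expR (- 2 * (h%:R * c)) / (2 ^ h * h`!)%:R) * n%:R ^+ (h - j) <= copy_mean e n (p n).
Proof.
move=> n0 hn p01 np /andP[mj jh]; have p0 : 0 <= p n by case/andP: p01.
have mh := leq_trans mj jh.
apply: le_trans (copy_mean_ge p01 hn mh).
have -> : (h * n)%:R * p n = h%:R * c by rewrite natrM -mulrA np.
rewrite mulrAC ler_wpM2r ?divr_ge0 ?expR_ge0 ?ler0n //.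
have -> : n%:R ^+ h = n%:R ^+ j * n%:R ^+ (h - j) :> R by rewrite -exprD subnKC.
rewrite -{1}np exprMn [n%:R ^+ j * p n ^+ j]mulrC -mulrA.
apply: ler_wpM2r; first by rewrite mulr_ge0 ?exprn_ge0 ?ler0n.
by apply: ler_wiXn2l => //; case/andP: p01 => *; lra.
Qed.

Lemma YES_almost_surely m k (s : Sigma m k) : almost_surely p (YES s).
Proof.
have [J [J1 J2 J3 J4 J5]] := type_realization s.
pose e := induced word_adj (J := J); pose h := size J.
have e_sym : symmetric e by exact: induced_sym word_adj_sym _.
have e_irr : irreflexive e by exact: induced_irr word_adj_irrefl _.
have e_conn : connected_rel e by exact: word_template_connected J1 J2 J3 J4.
have mh : (#|template e| < h)%N by exact: word_template_card J1 J2 J3 J4.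
have h0 : (0 < h)%N := leq_ltn_trans (leq0n _) mh.
pose a := c ^+ h.-1 * (expR (- 2 * (h%:R * c)) / (2 ^ h * h`!)%:R).
have a0 : 0 < a.
  by rewrite mulr_gt0 ?exprn_gt0 // divr_gt0 ?expR_gt0 // ltr0n muln_gt0 expn_gt0 fact_gt0.
(* The first bound keeps [p n] in the range of the exponential estimate, the second gives
   [(h ^ 2)%:R * p n <= 2^-1] for [Pr_few_copies]. *)
pose x := Num.min 2^-1 (2^-1 / (h ^ 2).+1%:R) : R.
have x0 : 0 < x by rewrite lt_min invr_gt0 ltr0n /= divr_gt0 ?invr_gt0 ?ltr0n.
have [N NP] := eventually_edge_prob c_gt0 x0.
pose N1 := maxn (maxn N (2 * h)) (Num.bound (2 * k%:R / a)).
apply: (@almost_surely_rate _ _ c_gt0 _ (4 / a + 8 * ((h ^ 2)%:R * c)) N1) => n.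
rewrite !geq_max -andbA => /and3P[/NP[n0 /andP[p0 px] np] hn kn].
have p01 : 0 <= p n <= 2^-1.
  by rewrite p0 /=; apply: le_trans px _; rewrite ge_min lexx.
have n0' : 0 < n%:R :> R by rewrite ltr0n.
have mu_ge : a * n%:R <= copy_mean e n (p n).
  have := @copy_mean_lower h e n h.-1 n0 hn p01 np.
  have -> : (h - h.-1 = 1)%N by rewrite -{1}(prednK h0) subSnn.
  by rewrite expr1 -/a leq_pred -ltnS prednK // mh; exact.
have mu0 : 0 < copy_mean e n (p n) by apply: lt_le_trans mu_ge; rewrite mulr_gt0.
have kmu : 2 * k%:R <= copy_mean e n (p n).
  apply: le_trans mu_ge; rewrite [a * _]mulrC -ler_pdivrMr //.
  have k0 : 0 <= 2 * k%:R / a by apply: divr_ge0; [rewrite mulr_ge0 ?ler0n|exact: ltW].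
  by apply/ltW/(lt_le_trans (archi_boundP k0)); rewrite ler_nat.
have hp : (h ^ 2)%:R * p n <= 2^-1.
  apply: (@le_trans _ _ ((h ^ 2).+1%:R * x)).
    by rewrite ler_pM ?ler0n // ler_nat.
  apply: (@le_trans _ _ ((h ^ 2).+1%:R * (2^-1 / (h ^ 2).+1%:R))).
    by rewrite ler_wpM2l ?ler0n // ge_min lexx orbT.
  by rewrite mulrCA mulfV ?mulr1 // pnatr_eq0.
pose y0 : 'I_n := Ordinal n0.
rewrite GnpE -Pr_compl.
have := Pr_few_copies e_sym e_irr y0 p01 e_conn mu0 kmu hp.
have p1 : 0 <= p n <= 1 by case/andP: p01 => *; apply/andP; split; lra.
move=> few; apply: (@le_trans _ _ (Pr (p n) (pairs n) (fun E => (copies e y0 E < k)%N))).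
  apply: le_Pr => // E _; apply: contraNT; rewrite -leqNgt => kc.
  by apply/asboolP; exact: YES_copies J1 J2 J3 J4 J5 kc.
apply: le_trans few _; rewrite [leRHS]mulrDl; apply: lerD.
  have an0 : 0 < a * n%:R := mulr_gt0 a0 n0'.
  by rewrite -mulrA -invfM ler_pM2l ?ltr0n // lef_pV2 ?posrE.
by rewrite -/h /p !mulrA.
Qed.

(** If [B] fails in [M], then a good copy of the template of [M] together with enough tree
    components forces [B] to fail in the random graph; a single [n] beyond all thresholds gives the
    contradiction. *)
Lemma derivable_from_theoryT (B : sentence) :
  almost_surely p (satisfies B) -> derivable theoryT (satisfies B).
Proof.
move=> asB M MT; apply: contrapT => nB.
pose q := rank B.
have [L [r [J [eJ transfer]]]] := model_transfer q MT.
pose adM : {classic M} -> {classic M} -> Prop := @adj M.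
pose e := induced adM (J := J); pose h := size J.
have e_sym : symmetric e by apply: induced_sym; exact: adj_sym.
have e_irr : irreflexive e by apply: induced_irr; exact: adj_irrefl.
have mh : (#|template e| <= h)%N.
  by apply: leq_trans eJ; apply: card_template_le; [exact: adj_sym|exact: adj_irrefl].
pose YESq : property := fun G =>
  forall j : 'I_q, forall s : Sigma (radius j) (rounds j + q).+1, YES s G.
have asY : almost_surely p YESq.
  by do 2!apply: (almost_surely_forall c_gt0) => ?; exact: YES_almost_surely.
(* The first line bounds the expected number of copies from below, the second the probability of
   avoiding further short dense sets; neither depends on [n]. *)
pose b := c ^+ h * (expR (- 2 * (h%:R * c)) / (2 ^ h * h`!)%:R) *
  expR (- 2 * ((2 ^ (L ^ 2))%:R * \sum_(l < L.+1) c ^+ l)).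
have b0 : 0 < b.
  rewrite mulr_gt0 ?expR_gt0 // mulr_gt0 ?exprn_gt0 // divr_gt0 ?expR_gt0 //.
  by rewrite ltr0n muln_gt0 expn_gt0 fact_gt0.
(* Failure of [B] and failure of [YESq] get probability at most [b / 3] each, yet together they must
   cover an event of probability at least [b]. *)
have b3 : 0 < b / 3 by rewrite divr_gt0 ?ltr0n.
have [N1 N1P] := (almost_surelyP c_gt0 _).1 asB _ b3.
have [N2 N2P] := (almost_surelyP c_gt0 _).1 asY _ b3.
have half0 : 0 < 2^-1 :> R by rewrite invr_gt0 ltr0n.
have [N3 N3P] := eventually_edge_prob c_gt0 half0.
pose n := maxn (maxn N1 N2) (maxn N3 (2 * h)).
have [n0 p01 np] : [/\ (0 < n)%N, 0 <= p n <= 2^-1 & n%:R * p n = c] by apply: N3P; rewrite /n; lia.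
have hn : (2 * h <= n)%N by rewrite /n; lia.
have hB : 1 - b / 3 <= Gnp n (p n) (satisfies B) by apply: N1P; rewrite /n; lia.
have hY : 1 - b / 3 <= Gnp n (p n) YESq by apply: N2P; rewrite /n; lia.
have p1 : 0 <= p n <= 1 by case/andP: p01 => *; apply/andP; split; lra.
pose x0 : 'I_n := Ordinal n0.
pose core_ball (E : {set {set 'I_n}}) : set 'I_n := let N := graph_of_edges E in
  ball (@adj N) setT (core (@adj N : {classic N} -> {classic N} -> Prop) L) r.
have trE (A : {set 'I_n}) (E : {set {set 'I_n}}) : #|A| = h -> E \subset pairs n -> good_copy e x0 L A E ->
    (forall y, core_ball E y <-> exists i : 'I_h, y = embed x0 A i) /\
    (YESq (graph_of_edges E) -> ~ satisfies B (graph_of_edges E)).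
  move=> hA EP gA; have /andP[cA _] := gA.
  have iso : @isolated_copy (graph_of_edges E) _ (fun i j => @adj M (tnth (in_tuple J) i)
      (tnth (in_tuple J) j)) (embed (h := h) x0 A).
    have [h1 h2 h3] := is_copy_isolated e_sym e_irr hA cA.
    by split=> // i j; split=> [/h2/asboolP|eij] //; apply/h2/asboolP.
  have [|h1 h2] := transfer (graph_of_edges E) x0 _ iso.
    move=> s [us s0 se] sL.
    have ds : dense (@edge_adj n E) (s : seq 'I_n).
      by split=> //; rewrite -(@uniq_classic 'I_n).
    have [x xs xi] := good_copy_nodense hA EP gA ds sL.
    by exists x => //; apply: etrans xs; exact: (@mem_classic _ (x : 'I_n) s).
  split; first exact: h1.
  move=> Y BN; apply: nB.
  exact/(h2 (fun j jq s' => Y (Ordinal jq) s') B (leqnn _)).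
(* Both vertex sets equal [core_ball E], which depends on the graph only. *)
have good_uniq (A A' : {set 'I_n}) (E : {set {set 'I_n}}) : #|A| = h -> #|A'| = h -> E \subset pairs n ->
    good_copy e x0 L A E -> good_copy e x0 L A' E -> A = A'.
  move=> hA hA' EP gA gA'.
  have [h1 _] := trE A E hA EP gA; have [h2 _] := trE A' E hA' EP gA'.
  apply/finset.setP => y; apply/idP/idP.
    by move=> /(embed_surj x0 hA)/h1/h2[i ->]; exact: embed_in.
  by move=> /(embed_surj x0 hA')/h2/h1[i ->]; exact: embed_in.
have := Pr_good_copy e_irr (L := L) p01 good_uniq; rewrite np => good.
have mu := copy_mean_lower n0 hn p01 np (introT andP (conj mh (leqnn h))).
rewrite subnn expr0 mulr1 in mu.
have bgood : b <= Pr (p n) (pairs n)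
    (fun E => [exists A : {set 'I_n}, (#|A| == h) && good_copy e x0 L A E]).
  by apply: le_trans good; rewrite /b ler_wpM2r ?expR_ge0.
set G := (fun E => _) in bgood.
have : Pr (p n) (pairs n) G <=
    (1 - Gnp n (p n) (satisfies B)) + (1 - Gnp n (p n) YESq).
  rewrite !GnpE -!Pr_compl /Pr -ExD; apply: le_Ex => // E EP.
  case: (boolP (G E)) => [/existsP[A /andP[/eqP hA gA]]|_]; last first.
    by rewrite addr_ge0 ?ler0n.
  have [_ key] := trE A E hA EP gA.
  case: (boolP `[< YESq (graph_of_edges E) >]) => [/asboolP/key nBE|_].
    by rewrite asboolF //= lerDl ler0n.
  by rewrite lerDr ler0n.
lra.
Qed.

End MainProof.

Local Open Scope ring_scope.

Theorem theorem1p1 (R : realType) (c : R) (hc : 0 < c) :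
  (forall A : property, theoryT A ->
     almost_surely (fun n : nat => c * n%:R^-1) A) /\
  (forall B : sentence,
     almost_surely (fun n : nat => c * n%:R^-1) (satisfies B) ->
     derivable theoryT (satisfies B)).
Proof.
split; last exact: derivable_from_theoryT.
move=> A [[l _ ->]|[m [k [s [_ ->]]]]]; first exact: NO_almost_surely.
exact: YES_almost_surely.
Qed.
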